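(* Let $w_1=r_1/q_1,\ldots,w_N=r_N/q_N$ ($r_i,q_i\in\mathbb Z_{>0}$, $\gcd(r_i,q_i)=1$) be positive rational numbers and put $w:=\operatorname{lcm}(r_1,\ldots,r_N)/\gcd(q_1,\ldots,q_N)$, $\ell_i:=w/w_i$ ($i=1,\ldots,N$). For any positive rational number $x$ and $\ell,n\in\mathbb Z_{\geq 0}$, \begin{align*} &\zeta^{(n)}_N(-\ell,x\mid w_1,\ldots,w_N)\\ &=\frac{1}{(N-1)!}\sum_{j=0}^n\binom{n}{j}(-\log w)^{n-j}w^{\ell}\sum_{k_1=0}^{\ell_1-1}\cdots\sum_{k_N=0}^{\ell_N-1}\sum_{k=0}^{N-1}\frac{C^{(k)}_{N,y(k_1,\ldots,k_N)}(0)}{k!}\\ &\times\Bigg[(-1)^j2\sum_{\substack{a+b+c=j\\ a,b,c\geq 0}}\Bigg\{\frac{j!}{a!\,b!\,c!}\,\Gamma^{(a)}(\ell+k+1)\,(-\log(2\pi v(k_1,\ldots,k_N)))^b\\ &\qquad\times(2\pi v(k_1,\ldots,k_N))^{-(\ell+k+1)}\,H^{(c)}\!\left(\ell+k+1,\frac{u(k_1,\ldots,k_N)}{v(k_1,\ldots,k_N)}\right)\Bigg\}\\ &\quad-\sum_{m=0}^{Y(k_1,\ldots,k_N)-1}\left\{-\log\left(m+\frac{u(k_1,\ldots,k_N)}{v(k_1,\ldots,k_N)}\right)\right\}^j\left(m+\frac{u(k_1,\ldots,k_N)}{v(k_1,\ldots,k_N)}\right)^{\ell+k}\Bigg], \end{align*}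 where $y(k_1,\ldots,k_N):=w^{-1}(x+k_1w_1+\cdots+k_Nw_N)=Y(k_1,\ldots,k_N)+u(k_1,\ldots,k_N)/v(k_1,\ldots,k_N)$ with $Y(k_1,\ldots,k_N)\in\mathbb Z_{\geq0}$, $u(k_1,\ldots,k_N),v(k_1,\ldots,k_N)\in\mathbb Z_{>0}$, $1\leq u(k_1,\ldots,k_N)\leq v(k_1,\ldots,k_N)$.
   Context: $\zeta_N(s,x\mid w_1,\ldots,w_N)=\sum_{n_1,\ldots,n_N\ge0}(x+n_1w_1+\cdots+n_Nw_N)^{-s}$ (Barnes zeta function, meromorphically continued), $\zeta_N^{(n)}$ its $n$-th derivative in $s$; $\zeta(s,x)=\sum_{n\ge0}(n+x)^{-s}$ is the Hurwitz zeta function and $\zeta(s)=\zeta(s,1)$. $C_N(t):=1$ if $N=1$ and $C_N(t):=(t+N-1)(t+N-2)\cdots(t+1)$ if $N\ge2$; $C_{N,x}(t):=C_N(t-x)$, and $C^{(k)}_{N,x}$ denotes its $k$-th derivative in $t$. The generalized Stieltjes constants $\gamma_n(x)$ are defined by $\zeta(s,x)=\frac{1}{s-1}+\sum_{n\ge0}\frac{(-1)^n}{n!}\gamma_n(x)(s-1)^n$; $\gamma$ is Euler's constant. For integers $1\le u\le v$, $H(s,u/v):=\sum_{k=1}^v\cos\left(\frac{\pi s}{2}-\frac{2\pi ku}{v}\right)\zeta\left(s,\frac{k}{v}\right)$ (an entire function), $H^{(c)}$ its $c$-th derivative in $s$, and for $m\in\mathbb Z_{>0}$: if $m\ge2$,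 $H^{(c)}(m,u/v)=-\sum_{k=1}^v\sum_{i=0}^c\binom{c}{i}\left(\frac{\pi}{2}\right)^{c-i}\sin\left(\frac{\pi(m+c-i-1)}{2}-\frac{2\pi ku}{v}\right)\zeta^{(i)}\left(m,\frac kv\right)$ with $\zeta^{(i)}(m,k/v)=\sum_{\ell\ge0}\left(-\log(\ell+k/v)\right)^i(\ell+k/v)^{-m}$; if $m=1$, $H^{(c)}(1,u/v)=\varepsilon_{c,u/v}+\sum_{k=1}^v\sum_{i=0}^c(-1)^{i+1}\binom{c}{i}\left(\frac{\pi}{2}\right)^{c-i}\sin\left(\frac{\pi(c-i)}{2}-\frac{2\pi ku}{v}\right)\gamma_i\left(\frac kv\right)$, where $\varepsilon_{c,u/v}=\frac{(-1)^{c/2+1}}{c+1}\left(\frac{\pi}{2}\right)^{c+1}v$ if $c$ is even and $u=v$, and $\varepsilon_{c,u/v}=0$ otherwise. For $m\in\mathbb Z_{>0}$, $\Gamma^{(a)}(m)=(m-1)!\sum_{(k_1,\ldots,k_a)\in\pi(a)}\frac{a!}{k_1!\cdots k_a!}\prod_{i=1}^a\left(\frac{\psi^{(i-1)}(m)}{i!}\right)^{k_i}$, where $\pi(a)=\{(k_1,\ldots,k_a)\in\mathbb Z_{\ge0}^a: k_1+2k_2+\cdots+ak_a=a\}$, $\psi=\Gamma'/\Gamma$, $\psi(m)=-\gamma+\sum_{k=1}^{m-1}\frac1k$, and $\psi^{(\ell)}(m)=(-1)^{\ell+1}\ell!\left(\zeta(\ell+1)-\sum_{k=1}^{m-1}k^{-\ell-1}\right)$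 for $\ell\ge1$. *)

(* Defs.v *)
From HB Require Import structures.
From mathcomp Require Export all_boot all_order all_algebra.
From mathcomp Require Export all_classical all_reals all_analysis.
From mathcomp Require Export complex.
From mathcomp Require Import ring.

Set Implicit Arguments.
Unset Strict Implicit.
Unset Printing Implicit Defensive.

Export Order.TTheory GRing.Theory Num.Theory.
Export numFieldNormedType.Exports.

Local Open Scope classical_set_scope.
Local Open Scope ring_scope.
Local Open Scope complex_scope.

Definition cexp {R : realType} (z : R[i]) : R[i] :=
  (expR (complex.Re z))%:C * (cos (complex.Im z) +i* sin (complex.Im z)).

(* a ^ s for a > 0, with the real logarithm of a. *)
Definition cpow {R : realType} (a : R) (s : R[i]) : R[i] := cexp (s * (ln a)%:C).

Definition ccos {R : realType} (z : R[i]) : R[i] :=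
  (cexp ('i * z) + cexp (- ('i * z))) / 2.

(* n-th complex derivative: [derive1n] over the field R[i], whose topology is the
   one of its structure of [numFieldType]. *)
Definition cderiven {R : realType} (n : nat) (f : R[i] -> R[i]) : R[i] -> R[i] :=
  derive1n n (f : (R[i] : numFieldType) -> (R[i] : numFieldType)).

Definition analytic_at {R : realType} (f : R[i] -> R[i]) (z : R[i]) : Prop :=
  exists a : nat -> R[i],
    \forall s \near (z : (R[i] : numFieldType)),
      series (fun n => a n * (s - z) ^+ n) @ \oo --> (f s : (R[i] : numFieldType)).

(* The value of [f] at the pole itself is irrelevant. *)
Definition pole_at {R : realType} (f : R[i] -> R[i]) (z : R[i]) : Prop :=
  exists (p : nat) (g : R[i] -> R[i]),
    [/\ (0 < p)%N, analytic_at g z, g z != 0 &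
        \forall s \near (z : (R[i] : numFieldType))^',
          f s = g s / (s - z) ^+ p].

Definition entire {R : realType} (f : R[i] -> R[i]) : Prop :=
  forall z, analytic_at f z.

Definition meromorphic {R : realType} (f : R[i] -> R[i]) : Prop :=
  forall z, analytic_at f z \/ pole_at f z.

(* The meromorphic function on the plane which equals the limit of the sequence
   [F s] for Re s > sigma. Such a function is determined up to its values at its
   own poles, since [meromorphic] leaves no freedom at a removable singularity;
   the default value 0 only matters if there is none. *)
Definition continuation {R : realType} (sigma : R) (F : R[i] -> nat -> R[i]) :
    R[i] -> R[i] :=
  xget (fun=> 0) [set f | meromorphic f /\
    forall s, sigma < complex.Re s ->
      F s @ \oo --> (f s : (R[i] : numFieldType))].

(* For Re s > N and positive x, w_1, ..., w_N the N-fold series is absolutely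
   convergent, so it is the limit of its sums over the boxes {0, ..., K-1}^N. *)
Definition barnes_zeta {R : realType} (N : nat) (w : 'I_N -> R) (x : R) :
    R[i] -> R[i] :=
  continuation N%:R (fun s K =>
    \sum_(n : {ffun 'I_N -> 'I_K}) cpow (x + \sum_(i < N) (n i)%:R * w i) (- s)).

Definition hurwitz_zeta {R : realType} (x : R) : R[i] -> R[i] :=
  continuation 1 (fun s => series (fun n => cpow (n%:R + x) (- s))).

(* The defining sum has a removable singularity at s = 1, whence the choice of
   the entire function which extends it. *)
Definition Hfun {R : realType} (u v : nat) : R[i] -> R[i] :=
  xget (fun=> 0) [set f | entire f /\
    forall s, s != 1 -> f s =
      \sum_(1 <= k < v.+1)
        ccos ((pi / 2)%:C * s - (2 * pi * k%:R * u%:R / v%:R)%:C)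
          * hurwitz_zeta (k%:R / v%:R) s].

(* Only used on the positive half-line, where the real derivatives of this
   function are those of the complex Gamma function. *)
Definition Gamma {R : realType} (s : R) : R :=
  \int[lebesgue_measure]_(t in `]0, +oo[) (t `^ (s - 1) * expR (- t)).

Definition CN {R : realType} (N : nat) : {poly R} :=
  \prod_(1 <= i < N) ('X + i%:R%:P).

Definition CNx {R : realType} (N : nat) (x : R) : {poly R} :=
  CN N \Po ('X - x%:P).

Definition wpar (R : realType) (N : nat) (r q : 'I_N -> nat) (i : 'I_N) : R :=
  (r i)%:R / (q i)%:R.

Definition wcom (R : realType) (N : nat) (r q : 'I_N -> nat) : R :=
  (\big[lcmn/1%N]_(i < N) r i)%:R / (\big[gcdn/0%N]_(i < N) q i)%:R.

(* The natural number w / w_i; the division is exact, see [ellE]. *)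
Definition ell (N : nat) (r q : 'I_N -> nat) (i : 'I_N) : nat :=
  ((\big[lcmn/1%N]_(i < N) r i) * q i) %/ ((\big[gcdn/0%N]_(i < N) q i) * r i).

Lemma ellE (R : realType) (N : nat) (r q : 'I_N -> nat) (i : 'I_N) :
  (forall j, 0 < r j)%N -> (forall j, 0 < q j)%N ->
  (ell r q i)%:R = wcom R r q / wpar R r q i.
Proof.
move=> r0 q0; rewrite /ell /wcom /wpar.
set L := \big[lcmn/1%N]_(j < N) r j; set g := \big[gcdn/0%N]_(j < N) q j.
have dL : (r i %| L)%N by rewrite /L (bigD1 i) //= dvdn_lcml.
have dg : (g %| q i)%N by rewrite /g (bigD1 i) //= dvdn_gcdl.
have g0 : (0 < g)%N by apply: dvdn_gt0 dg.
have /dvdnP [m ->] := dL; have /dvdnP [p qE] := dg.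
have rn0 : (r i)%:R != 0 :> R by rewrite pnatr_eq0 -lt0n.
have gn0 : g%:R != 0 :> R by rewrite pnatr_eq0 -lt0n.
have p0 : (0 < p)%N by have := q0 i; rewrite qE muln_gt0 => /andP[].
have pn0 : p%:R != 0 :> R by rewrite pnatr_eq0 -lt0n.
have -> : (m * r i * q i = m * p * (g * r i))%N by rewrite {1}qE; ring.
by rewrite mulnK ?muln_gt0 ?g0 ?r0 // qE !natrM; field; rewrite rn0 gn0 pn0.
Qed.

(* Multi-indices (k_1, ..., k_N) with 0 <= k_i < l_i. *)
Definition kbox (N : nat) (r q : 'I_N -> nat) : finType :=
  {dffun forall i : 'I_N, 'I_(ell r q i)}.

Definition yk (R : realType) (N : nat) (r q : 'I_N -> nat) (x : R)
    (k : kbox r q) : R :=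
  (wcom R r q)^-1 * (x + \sum_(i < N) (k i)%:R * wpar R r q i).

(* Main.v *)
(* For x > 0, 0 < a < 1 let q = exp (- 2 pi t + 2 pi i a), g (t, a) = 2 q / (1 - q), and let
   V (s) be the integral of Im ((x - i t)^(- s) g (t, a)) over t > 0, which is entire in s.
   If y = x + a is fixed, then by the Cauchy-Riemann equations the a-derivative of the
   integrand is a t-derivative, and R = x^(1 - s) / (s - 1) + V (s) does not depend on a.
   Averaging R over a = (j + 1/2) / 2^k, j < 2^k, where g (t, a) + g (t, a + 1/2) =
   2 g (2 t, 2 a) collapses the average of g, one finds that R satisfies the difference
   equation of zeta (s, y); hence R = zeta (s, y) for s > 1, and this continues zeta (s, y).
   For s < 0 one may let x tend to 0 and expand g in powers of q. This is Hurwitz's formula,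
   which by grouping residue classes modulo v reads
     zeta (1 - t, u / v) = 2 Gamma (t) (2 pi v)^(- t) H (t, u / v),   t > 1.
   Comparing the power series of both sides at t = l + m + 1 gives the derivatives of
   zeta (s, u / v) at s = - (l + m).

   In the Barnes series write n_i = k_i + l_i m_i with k_i < l_i and M = m_1 + ... + m_N. The
   general term only depends on k and M, and M occurs binomial (M + N - 1, N - 1) =
   C_N (M) / (N - 1)! times; expanding C_N at - y in powers of M + y expresses zeta_N (s) by
   the functions zeta (s - m, y (k)), m < N, which are shifts of zeta (s - m, u / v). *)
From mathcomp Require Import measurable_realfun ring lra.
Require Import Defs.

Set Implicit Arguments.
Unset Strict Implicit.
Unset Printing Implicit Defensive.

Local Open Scope classical_set_scope.
Local Open Scope ring_scope.
Local Open Scope complex_scope.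

(** No contour integral occurs: every function is handled through its Taylor series at a point, with
    geometric bounds on the coefficients, and two series are identified from values at points
    [z + t] with [t > 0] real. Hence real integrals and the real function [Gamma] suffice. [R] is an
    Abel-Plana representation whose phase [a] is left free, and this freedom replaces the residue
    theorem: the value [-1] of [Re g] at [t = 0] produces the boundary term [- x^(- s)] that cancels
    the derivative of [x^(1 - s) / (s - 1)], and averaging over phases turns a small shift of [x]
    into the shift of [y] by 1. The limit [x -> 0] is taken for [y < 1]; the case [u = v] is reached
    from [y = 1/2] by [zeta (s, 1/2) + zeta (s) = 2^s zeta (s)]. As [continuation] and [Hfun] are
    values of a choice operator, only their defining properties are available: an identity theorem
    along lines identifies the continuation, and sums of meromorphic functions, which may take
    arbitrary values at removable singularities, are first treated through the weaker notion
    [laurent]. *)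

Definition cabs {R : realType} (z : R[i]) : R := Normc.normc z.

Arguments cabs : simpl never.

(** Real radii suit the estimates below; [cvgCP] identifies this with convergence in the topology of
    [R[i]], whose radii are elements of [R[i]]. *)
Definition cvgC {R : realType} (u : nat -> R[i]) (l : R[i]) : Prop :=
  forall e : R, 0 < e -> exists N, forall n, (N <= n)%N -> cabs (u n - l) < e.

Local Notation "u ~> l" := (cvgC u l) (at level 70).

(** * Complex sequences and series *)

Section ComplexTopology.
Variable R : realType.
Implicit Types (z h l : R[i]) (u v : nat -> R[i]) (P : R[i] -> Prop).

Lemma normCE z : `|z| = (cabs z)%:C. Proof. by []. Qed.

Lemma cabs_ge0 z : 0 <= cabs z.
Proof. by rewrite -lecR -normCE normr_ge0. Qed.

Lemma cabs0 : cabs (0 : R[i]) = 0. Proof. exact: Normc.normc0. Qed.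

Lemma cabs1 : cabs (1 : R[i]) = 1. Proof. exact: Normc.normc1. Qed.

Lemma cabs_eq0 z : (cabs z == 0) = (z == 0).
Proof.
by apply/eqP/eqP => [/Normc.eq0_normc|->]; rewrite ?cabs0.
Qed.

Lemma cabs_gt0 z : (0 < cabs z) = (z != 0).
Proof. by rewrite lt_def cabs_ge0 andbT cabs_eq0. Qed.

Lemma cabsM z h : cabs (z * h) = cabs z * cabs h.
Proof. exact: Normc.normcM. Qed.

Lemma cabsV z : cabs z^-1 = (cabs z)^-1.
Proof. exact: Normc.normcV. Qed.

Lemma cabsX z n : cabs (z ^+ n) = cabs z ^+ n.
Proof.
by elim: n => [|n ih]; rewrite ?expr0 ?cabs1// !exprS cabsM ih.
Qed.

Lemma cabsN z : cabs (- z) = cabs z. Proof. exact: normcN. Qed.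

Lemma cabsD z h : cabs (z + h) <= cabs z + cabs h.
Proof. exact: le_normcD. Qed.

Lemma cabsB z h : cabs (z - h) <= cabs z + cabs h.
Proof. by rewrite -(cabsN h) cabsD. Qed.

Lemma cabsC z h : cabs (z - h) = cabs (h - z).
Proof. by rewrite -cabsN opprB. Qed.

Lemma cabs_real (a : R) : cabs a%:C = `|a|.
Proof. by rewrite /cabs /= expr0n addr0 sqrtr_sqr. Qed.

Lemma cabs_nat n : cabs (n%:R : R[i]) = n%:R.
Proof.
have -> : (n%:R : R[i]) = (n%:R : R)%:C by rewrite rmorph_nat.
by rewrite cabs_real ger0_norm.
Qed.

Lemma cabs_sum (I : Type) (s : seq I) (Q : pred I) (F : I -> R[i]) :
  cabs (\sum_(i <- s | Q i) F i) <= \sum_(i <- s | Q i) cabs (F i).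
Proof.
elim/big_ind2 : _ => [|x y z t h1 h2|//]; first by rewrite cabs0.
by rewrite (le_trans (cabsD _ _))// lerD.
Qed.

Lemma ler_Re_cabs z : `|complex.Re z| <= cabs z.
Proof.
by case: z => a b; rewrite /cabs/= -sqrtr_sqr ler_wsqrtr// lerDl sqr_ge0.
Qed.

Lemma ler_Im_cabs z : `|complex.Im z| <= cabs z.
Proof.
by case: z => a b; rewrite /cabs/= -sqrtr_sqr ler_wsqrtr// lerDr sqr_ge0.
Qed.

Lemma cabs_le_ReIm z : cabs z <= `|complex.Re z| + `|complex.Im z|.
Proof.
case: z => a b; rewrite [in leLHS](_ : a +i* b = a%:C + (0 +i* b)); last first.
  by apply/eqP; rewrite eq_complex /= addr0 add0r !eqxx.
rewrite (le_trans (cabsD _ _))// cabs_real lerD2l.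
by rewrite /cabs/= expr0n add0r sqrtr_sqr.
Qed.

Lemma ReD z h : complex.Re (z + h) = complex.Re z + complex.Re h.
Proof. by case: z; case: h. Qed.
Lemma ImD z h : complex.Im (z + h) = complex.Im z + complex.Im h.
Proof. by case: z; case: h. Qed.
Lemma ReN z : complex.Re (- z) = - complex.Re z. Proof. by case: z. Qed.
Lemma ImN z : complex.Im (- z) = - complex.Im z. Proof. by case: z. Qed.

Lemma Re_sum (I : Type) (s : seq I) (Q : pred I) (F : I -> R[i]) :
  complex.Re (\sum_(i <- s | Q i) F i) = \sum_(i <- s | Q i) complex.Re (F i).
Proof. by elim/big_ind2 : _ => // x a y b <- <-; rewrite ReD. Qed.

Lemma Im_sum (I : Type) (s : seq I) (Q : pred I) (F : I -> R[i]) :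
  complex.Im (\sum_(i <- s | Q i) F i) = \sum_(i <- s | Q i) complex.Im (F i).
Proof. by elim/big_ind2 : _ => // x a y b <- <-; rewrite ImD. Qed.

(** A positive element of [R[i]] is real, so balls with complex radii are balls with real radii. *)
Lemma nearCP (z : (R[i] : numFieldType)) P :
  (\forall s \near z, P s) <->
  exists2 e : R, 0 < e & forall h, cabs h < e -> P (z + h).
Proof.
split.
  move=> /nbhs_ballP[[e e']] /=; rewrite ltcE /= => /andP[/eqP -> e0] zeP.
  exists e => // h he; apply: zeP; rewrite /ball/= opprD addNKr normrN.
  by rewrite normCE ltcR.
move=> [e e0 zeP]; apply/nbhs_ballP; exists e%:C; first by rewrite /= ltcR.
move=> s /=; rewrite /ball/= distrC normCE ltcR => /zeP.
by rewrite addrC subrK.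
Qed.

Lemma dnearCP (z : (R[i] : numFieldType)) P :
  (\forall s \near z^', P s) <->
  exists2 e : R, 0 < e & forall h, h != 0 -> cabs h < e -> P (z + h).
Proof.
rewrite near_withinE; split.
  move=> /nearCP[e e0 H]; exists e => // h h0 /H; apply.
  by rewrite -subr_eq0 addrC addKr.
move=> [e e0 H]; apply/nearCP; exists e => // h he hz; apply: H => //.
by apply: contra hz => /eqP ->; rewrite addr0.
Qed.

Lemma cvgCP u l : (u @ \oo --> (l : (R[i] : numFieldType))) <-> u ~> l.
Proof.
split.
  move=> /(@cvgrPdist_lt _ (R[i] : numFieldType) _ _ _ u l) ul e e0.
  have /ul[N _ H] : (0 : R[i]) < e%:C by rewrite ltcR.
  exists N => n Nn; rewrite cabsC -ltcR -normCE; exact: H.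
move=> H; apply/(@cvgrPdist_lt _ (R[i] : numFieldType) _ _ _ u l) => -[e e'].
rewrite ltcE /= => /andP[/eqP -> e0].
have [N NH] := H _ e0.
by exists N => // n /NH; rewrite cabsC normCE -ltcR.
Qed.

Lemma cvgRP (u : R^nat) (l : R) : (u @ \oo --> l) <->
  forall e : R, 0 < e -> exists N, forall n, (N <= n)%N -> `|u n - l| < e.
Proof.
split.
  move=> /cvgrPdist_lt ul e /ul[N _ H].
  by exists N => n /H; rewrite distrC.
move=> H; apply/cvgrPdist_lt => e /H[N NH].
by exists N => // n /NH; rewrite distrC.
Qed.

Lemma cvgC_ReIm u l : u ~> l <->
  ((complex.Re (u n)) @[n --> \oo] --> complex.Re l) /\
  ((complex.Im (u n)) @[n --> \oo] --> complex.Im l).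
Proof.
split.
  move=> ul; split; apply/cvgRP => e /ul[N H]; exists N => n /H.
    by rewrite -ReN -ReD; apply: le_lt_trans; exact: ler_Re_cabs.
  by rewrite -ImN -ImD; apply: le_lt_trans; exact: ler_Im_cabs.
move=> [/cvgRP ur /cvgRP ui] e e0.
have e2 : 0 < e / 2 by rewrite divr_gt0.
have [N NH] := ur _ e2; have [M MH] := ui _ e2.
exists (maxn N M) => n; rewrite geq_max => /andP[/NH Nn /MH Mn].
apply: le_lt_trans (cabs_le_ReIm _) _.
by rewrite ReD ImD ReN ImN (splitr e) ltrD.
Qed.

Lemma cvgC_unique u l l' : u ~> l -> u ~> l' -> l = l'.
Proof.
move=> /cvgC_ReIm[ur ui] /cvgC_ReIm[ur' ui'].
have := cvg_unique _ ur ur'; have := cvg_unique _ ui ui'.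
by case: l l' {ur ui ur' ui'} => [a b] [c d] /= -> // ->.
Qed.

Lemma ler_dist_cabs z h : `|cabs z - cabs h| <= cabs (z - h).
Proof.
have H (x y : R[i]) : cabs x - cabs y <= cabs (x - y).
  by rewrite lerBlDr; apply: le_trans (cabsD _ _); rewrite subrK.
by rewrite ler_norml H andbT lerNl opprB cabsC H.
Qed.

Lemma cvgC_abs u l : u ~> l -> cabs (u n) @[n --> \oo] --> cabs l.
Proof.
move=> ul; apply/cvgRP => e /ul[N H]; exists N => n /H; apply: le_lt_trans.
exact: ler_dist_cabs.
Qed.

Lemma cvgC_cst l : (fun=> l) ~> l.
Proof. by apply/cvgC_ReIm; split; exact: cvg_cst. Qed.

Lemma cvgC_add u v l m : u ~> l -> v ~> m -> (fun n => u n + v n) ~> (l + m).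
Proof.
move=> /cvgC_ReIm[ur ui] /cvgC_ReIm[vr vi]; apply/cvgC_ReIm.
by split; under eq_fun do rewrite ?ReD ?ImD; rewrite ?ReD ?ImD; exact: cvgD.
Qed.

Lemma ReM z h : complex.Re (z * h) =
  complex.Re z * complex.Re h - complex.Im z * complex.Im h.
Proof. by case: z; case: h. Qed.
Lemma ImM z h : complex.Im (z * h) =
  complex.Re z * complex.Im h + complex.Im z * complex.Re h.
Proof. by case: z; case: h. Qed.

Lemma cvgC_mul u v l m : u ~> l -> v ~> m -> (fun n => u n * v n) ~> (l * m).
Proof.
move=> /cvgC_ReIm[ur ui] /cvgC_ReIm[vr vi]; apply/cvgC_ReIm.
split; under eq_fun do rewrite ?ReM ?ImM; rewrite ?ReM ?ImM.
  by apply: cvgB; exact: cvgM.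
by apply: cvgD; exact: cvgM.
Qed.

Lemma cvgC_scale u l c : u ~> l -> (fun n => c * u n) ~> (c * l).
Proof. by move=> ul; apply: cvgC_mul => //; exact: cvgC_cst. Qed.

Lemma cvgC_sub u v l m : u ~> l -> v ~> m -> (fun n => u n - v n) ~> (l - m).
Proof.
move=> ul vm; rewrite -[- m]mulN1r; under eq_fun do rewrite -[- v _]mulN1r.
by apply: cvgC_add => //; exact: cvgC_scale.
Qed.

Lemma cvgC_shift u l N : (fun n => u (n + N)%N) ~> l <-> u ~> l.
Proof.
split=> ul; move=> e /ul[M MH].
  exists (M + N)%N => n Mn; have Nn : (N <= n)%N by rewrite (leq_trans _ Mn) ?leq_addl.
  by have := MH (n - N)%N; rewrite subnK// leq_subRL// addnC; apply.
by exists M => n Mn; apply: MH; rewrite (leq_trans Mn) ?leq_addr.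
Qed.

Lemma cvgC_sum (I : Type) (s : seq I) (P : pred I) (f : I -> nat -> R[i]) (l : I -> R[i]) :
  (forall i, f i ~> l i) ->
  (fun n => \sum_(i <- s | P i) f i n) ~> (\sum_(i <- s | P i) l i).
Proof.
move=> fl; elim: s => [|i s ih].
  rewrite big_nil; under eq_fun do rewrite big_nil; exact: cvgC_cst.
rewrite big_cons; under eq_fun do rewrite big_cons.
by case: (P i) => //; exact: cvgC_add.
Qed.

Lemma cvgC_le u l B : u ~> l -> (forall n, cabs (u n) <= B) -> cabs l <= B.
Proof.
move=> /cvgC_abs ul uB; have /cvg_lim <- // := ul.
by apply: limr_le; [apply/cvg_ex; exists (cabs l) | exact: nearW].
Qed.

Lemma cvgC_near_le u l c B N : u ~> l ->
  (forall n, (N <= n)%N -> cabs (u n - c) <= B) -> cabs (l - c) <= B.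
Proof.
move=> ul uB; apply: (@cvgC_le (fun n => u (n + N)%N - c)) => [|n].
  by apply: cvgC_sub; [apply/cvgC_shift | exact: cvgC_cst].
by apply: uB; rewrite leq_addl.
Qed.

Lemma cvgC_real (a : R^nat) (l : R) :
  a @ \oo --> l -> (fun n => (a n)%:C) ~> (l%:C).
Proof. by move=> al; apply/cvgC_ReIm; split => //=; exact: cvg_cst. Qed.

Lemma seriesRe u n : complex.Re (series u n) = series (fun k => complex.Re (u k)) n.
Proof. by rewrite /series /= Re_sum. Qed.
Lemma seriesIm u n : complex.Im (series u n) = series (fun k => complex.Im (u k)) n.
Proof. by rewrite /series /= Im_sum. Qed.

Lemma bounded_series (u : R^nat) B : (forall n, 0 <= u n) ->
  (forall n, series u n <= B) -> cvgn (series u).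
Proof.
move=> u0 uB; apply: nondecreasing_is_cvgn.
  by apply: nondecreasing_series => n _ _; exact: u0.
by exists B => _ [n _ <-]; exact: uB.
Qed.

(** Real and imaginary parts are dominated by the modulus, so both real series converge
    absolutely. *)
Lemma abs_seriesC u B : (forall n, series (fun k => cabs (u k)) n <= B) ->
  exists2 l, series u ~> l & cabs l <= B.
Proof.
move=> uB.
have cu : cvgn (series (fun k => cabs (u k))).
  by apply: bounded_series uB => n; exact: cabs_ge0.
have aux (v : R^nat) : (forall n, `|v n| <= cabs (u n)) -> cvgn (series v).
  move=> vu; apply: normed_cvg; apply: (@series_le_cvg _ _ (fun k => cabs (u k))) => //.
  - by move=> n; exact: normr_ge0.
  - by move=> n; exact: cabs_ge0.
have cr := aux (fun k => complex.Re (u k)) (fun n => ler_Re_cabs _).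
have ci := aux (fun k => complex.Im (u k)) (fun n => ler_Im_cabs _).
set l := limn (series (fun k => complex.Re (u k))) +i* limn (series (fun k => complex.Im (u k))).
have ul : series u ~> l.
  apply/cvgC_ReIm; split; first by rewrite (eq_cvg _ _ (seriesRe u)).
  by rewrite (eq_cvg _ _ (seriesIm u)).
exists l => //; have /cvg_lim <- // := cvgC_abs ul.
apply: limr_le; first by apply/cvg_ex; exists (cabs l); exact: cvgC_abs.
by apply: nearW => n; exact: le_trans (cabs_sum _ _ _) (uB n).
Qed.

End ComplexTopology.

(** * Double series and Cauchy products *)

Section SeriesToolkit.
Variable R : realType.
Implicit Types (a b : nat -> nat -> R[i]) (u v : nat -> R[i]).

Let rect a n m := \sum_(0 <= i < n) \sum_(0 <= j < m) a i j.
Let rabs a n m := \sum_(0 <= i < n) \sum_(0 <= j < m) cabs (a i j).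

(** Both sides are sums over the same L-shaped difference of two rectangles, where the triangle
    inequality applies termwise. *)
Let rect_split a n' n m' m : (n' <= n)%N -> (m' <= m)%N ->
  cabs (rect a n m - rect a n' m') <= rabs a n m - rabs a n' m'.
Proof.
move=> nn mm.
have split3 (V : zmodType) (F : nat -> nat -> V) :
    \sum_(0 <= i < n) \sum_(0 <= j < m) F i j
      - \sum_(0 <= i < n') \sum_(0 <= j < m') F i j =
    \sum_(0 <= i < n') \sum_(m' <= j < m) F i j
      + \sum_(n' <= i < n) \sum_(0 <= j < m) F i j.
  rewrite (big_cat_nat _ nn)//= addrAC -sumrB; congr (_ + _).
  by apply: eq_bigr => i _; rewrite (big_cat_nat _ mm)//= addrAC subrr add0r.
rewrite /rect /rabs !split3 (le_trans (cabsD _ _))// lerD//.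
  by rewrite (le_trans (cabs_sum _ _ _))// ler_sum// => i _; exact: cabs_sum.
by rewrite (le_trans (cabs_sum _ _ _))// ler_sum// => i _; exact: cabs_sum.
Qed.

Let rabs_mono a n' n m' m : (n' <= n)%N -> (m' <= m)%N ->
  rabs a n' m' <= rabs a n m.
Proof.
by move=> nn mm; rewrite -subr_ge0; apply: le_trans (rect_split a nn mm); exact: cabs_ge0.
Qed.

Lemma series_row_bound a B n : (forall n m, rabs a n m <= B) ->
  forall m, series (fun j => cabs (a n j)) m <= B.
Proof.
move=> aB m; apply: le_trans (aB n.+1 m); rewrite /rabs big_nat_recr//=.
by rewrite lerDr; apply: sumr_ge0 => i _; apply: sumr_ge0 => j _; exact: cabs_ge0.
Qed.

Let rabsT a n m : rabs a n m = rabs (fun i j => a j i) m n.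
Proof. by rewrite /rabs exchange_big. Qed.

Let half_double a B r s (N : nat) (e : R) :
  (forall i, series (a i) ~> r i) -> series r ~> s ->
  (forall n m, (N <= n)%N -> (N <= m)%N -> cabs (rect a n m - rect a N N) <= e) ->
  (forall n m, rabs a n m <= B) ->
  cabs (s - rect a N N) <= e.
Proof.
move=> ar rs aN aB; apply: (cvgC_near_le (N := N) rs) => n Nn.
apply: (@cvgC_near_le _ (fun m => rect a n m) _ _ _ N) => [|m Nm]; last exact: aN.
exact: cvgC_sum.
Qed.

Let row_sums a B : (forall n m, rabs a n m <= B) ->
  exists2 r, (forall i, series (a i) ~> r i) & exists2 s, series r ~> s & cabs s <= B.
Proof.
move=> aB.
have /choice [r ar] : forall i, exists l, series (a i) ~> l.
  by move=> i; have [l al _] := abs_seriesC (series_row_bound i aB); exists l.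
exists r => //; apply: abs_seriesC => n.
have cn : (fun m => \sum_(0 <= k < n) cabs (series (a k) m)) @ \oo --> series (fun k => cabs (r k)) n.
  rewrite /series /=; elim: n => [|n ih].
    by rewrite big_nil; under eq_fun do rewrite big_nil; exact: cvg_cst.
  rewrite big_nat_recr//=; under eq_fun do rewrite big_nat_recr//=.
  by apply: cvgD => //; exact: (cvgC_abs (ar n)).
have -> : series (fun k => cabs (r k)) n = limn (fun m => \sum_(0 <= k < n) cabs (series (a k) m)).
  by apply/esym/cvg_lim.
apply: limr_le; first exact: cvgP cn.
apply: nearW => m; apply: le_trans (aB n m); apply: ler_sum => i _; exact: cabs_sum.
Qed.

(** Both iterated sums lie within [e / 2] of one square partial sum [rect a N N], where [N] comes
    from the convergence of the bounded increasing sequence [rabs a n n]. *)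
Lemma double_series a B : (forall n m, rabs a n m <= B) ->
  exists r c s, [/\ forall i, series (a i) ~> r i,
    forall j, series (fun i => a i j) ~> c j, series r ~> s & series c ~> s].
Proof.
move=> aB; have aBT n m : rabs (fun i j => a j i) n m <= B by rewrite -rabsT.
have [r ar [s rs _]] := row_sums aB; have [c ac [s' cs' _]] := row_sums aBT.
suff ss : s = s' by exists r, c, s; split => //; rewrite ss.
apply/eqP; rewrite -subr_eq0 -cabs_eq0; apply/eqP/le_anti; rewrite cabs_ge0 andbT.
apply/ler_addgt0Pl => e e0; rewrite addr0.
have cb : cvgn (fun n => rabs a n n).
  apply: nondecreasing_is_cvgn => [n m nm|]; first exact: rabs_mono.
  by exists B => _ [n _ <-].
have e2 : 0 < e / 2 by rewrite divr_gt0.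
have cbm : {homo (fun n => rabs a n n) : n m / (n <= m)%N >-> n <= m}.
  by move=> p q pq; exact: rabs_mono.
have /cvgRP /(_ _ e2)[N NH] := cb.
have aN n m : (N <= n)%N -> (N <= m)%N -> cabs (rect a n m - rect a N N) <= e / 2.
  move=> Nn Nm; rewrite (le_trans (rect_split _ Nn Nm))// ltW//.
  have /NH := leqnn N; apply: le_lt_trans.
  rewrite distrC ger0_norm ?subr_ge0; last first.
    exact: (nondecreasing_cvgn_le cbm cb N).
  rewrite lerD2r (le_trans (rabs_mono a (leq_maxl n m) (leq_maxr n m)))//.
  exact: (nondecreasing_cvgn_le cbm cb).
have h1 := half_double ar rs aN aB.
have rT n m : rect (fun i j => a j i) n m = rect a m n by rewrite /rect exchange_big.
have aNT n m : (N <= n)%N -> (N <= m)%N ->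
    cabs (rect (fun i j => a j i) n m - rect (fun i j => a j i) N N) <= e / 2.
  by move=> Nn Nm; rewrite !rT; exact: aN.
have h2 := half_double ac cs' aNT aBT; rewrite rT in h2.
have -> : s - s' = (s - rect a N N) - (s' - rect a N N) by rewrite opprB addrA subrK.
by rewrite (le_trans (cabsB _ _))// (splitr e) lerD.
Qed.

Definition cauchy_prod u v n : R[i] := \sum_(0 <= i < n.+1) u i * v (n - i)%N.

Lemma series_finite u N : (forall k, (N <= k)%N -> u k = 0) ->
  series u ~> (\sum_(0 <= k < N) u k).
Proof.
move=> u0; move=> e e0; exists N => n Nn.
rewrite /series /= (big_cat_nat _ Nn)//= addrAC subrr add0r big_nat big1 ?cabs0//.
by move=> k /andP[/u0].
Qed.

Lemma series_scale u l c : series u ~> l -> series (fun n => c * u n) ~> (c * l).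
Proof.
move=> /(cvgC_scale c); congr (_ ~> _).
by apply/funext => n; rewrite /series /= mulr_sumr.
Qed.

Lemma series_add u v l m : series u ~> l -> series v ~> m ->
  series (fun n => u n + v n) ~> (l + m).
Proof.
move=> ul vm; have := cvgC_add ul vm; congr (_ ~> _).
by apply/funext => n; rewrite /series /= big_split.
Qed.

Lemma series_shift u l N : series (fun n => u (n + N)%N) ~> l ->
  series u ~> (\sum_(0 <= k < N) u k + l).
Proof.
move=> ul; apply/(cvgC_shift _ _ N).
have -> : (fun n => series u (n + N)%N) =
    (fun n => \sum_(0 <= k < N) u k + series (fun n => u (n + N)%N) n).
  apply/funext => n; rewrite /series /= (big_cat_nat _ (leq_addl n N))//=.
  by congr (_ + _); rewrite -{1}(add0n N) big_addn addnK.
by apply: cvgC_add => //; exact: cvgC_cst.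
Qed.

Lemma cauchy_prod_cvg u v A B x y :
  (forall n, series (fun k => cabs (u k)) n <= A) ->
  (forall n, series (fun k => cabs (v k)) n <= B) ->
  series u ~> x -> series v ~> y ->
  series (cauchy_prod u v) ~> (x * y) /\
  forall n, series (fun k => cabs (cauchy_prod u v k)) n <= A * B.
Proof.
move=> uA vB ux vy.
have A0 : 0 <= A by have := uA 0%N; rewrite /series /= big_nil.
(* The array is zero for [n < i]; its rows sum to the Cauchy product and its columns to [u i * y],
   so [double_series] gives the product of the sums. *)
pose c n i := if (i <= n)%N then u i * v (n - i)%N else 0.
have bd n m : rabs c n m <= A * B.
  rewrite rabsT /rabs; apply: (@le_trans _ _ (\sum_(0 <= i < m) cabs (u i) * B)).
    apply: ler_sum => i _.
    have [ni|ni] := leqP n i.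
      rewrite big_nat_cond big1 ?mulr_ge0 ?cabs_ge0//.
        by have := vB 0%N; rewrite /series /= big_nil.
      by move=> k /andP[/andP[_ kn] _]; rewrite /c leqNgt (leq_trans kn ni) cabs0.
    rewrite (big_cat_nat _ (ltnW ni))//= big_nat_cond big1 ?add0r; last first.
      by move=> k /andP[/andP[_ kn] _]; rewrite /c leqNgt kn cabs0.
    rewrite -{1}(add0n i) big_addn; apply: le_trans (_ : cabs (u i) * series (fun k => cabs (v k)) (n - i)%N <= _).
      rewrite /series /= mulr_sumr; apply: ler_sum => k _.
      by rewrite /c leq_addl cabsM addnK.
    by rewrite ler_wpM2l ?cabs_ge0.
  rewrite -mulr_suml ler_wpM2r//; last exact: uA.
  by have := vB 0%N; rewrite /series /= big_nil.
have rowE n : cauchy_prod u v n = \sum_(0 <= i < n.+1) c n i.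
  by apply: eq_big_nat => i /andP[_]; rewrite ltnS /c => ->.
split; last first.
  move=> n; apply: le_trans (bd n n); rewrite /series /= /rabs !big_nat.
  apply: ler_sum => k /andP[_ kn].
  rewrite rowE (le_trans (cabs_sum _ _ _))// (big_cat_nat _ kn)//= lerDl.
  by apply: sumr_ge0 => ? _; exact: cabs_ge0.
have [r [k [s [cr ck rs ks]]]] := double_series bd.
have -> : cauchy_prod u v = r.
  apply/funext => n; apply: cvgC_unique (cr n); rewrite rowE.
  by apply: series_finite => i; rewrite /c ltnNge => /negbTE ->.
suff -> : x * y = s by [].
apply: cvgC_unique ks.
suff -> : k = (fun i => u i * y).
  rewrite mulrC; under eq_fun do rewrite mulrC; exact: series_scale.
apply/funext => i; apply: (cvgC_unique (ck i)).
have -> : u i * y = \sum_(0 <= n < i) c n i + u i * y.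
  rewrite big_nat_cond big1 ?add0r// => j /andP[/andP[_ ji] _].
  by rewrite /c leqNgt ji.
apply: series_shift; under eq_fun do rewrite /c leq_addl addnK.
exact: series_scale.
Qed.

End SeriesToolkit.

(** * Power series *)

(* The bound on the coefficients is implied by convergence (see [analytic_PS]); having it
   in the definition makes all estimates geometric. *)
Definition PS {R : realType} (f : R[i] -> R[i]) (z : R[i]) (a : nat -> R[i]) (r : R) :=
  [/\ 0 < r, exists M, forall k, cabs (a k) * r ^+ k <= M &
      forall h, cabs h < r -> series (fun k => a k * h ^+ k) ~> f (z + h)].

Section PowerSeries.
Variable R : realType.
Implicit Types (f g : R[i] -> R[i]) (a b : nat -> R[i]) (r q : R) (z d h : R[i]).

Lemma geometric_bound q M n : 0 <= q < 1 -> 0 <= M ->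
  \sum_(0 <= k < n) M * q ^+ k <= M / (1 - q).
Proof.
move=> /andP[q0 q1] M0; rewrite -mulr_sumr ler_wpM2l//.
have -> : \sum_(0 <= k < n) q ^+ k = (1 - q ^+ n) / (1 - q).
  have q1' : 1 - q != 0 by rewrite subr_eq0 eq_sym lt_eqF.
  apply: (mulIf q1'); rewrite divfK// mulr_suml.
  elim: n => [|n ih]; first by rewrite big_nil expr0 subrr.
  by rewrite big_nat_recr//= ih exprS; ring.
by rewrite ler_pdivrMr ?subr_gt0// mulVf ?lerBlDr ?lerDl ?exprn_ge0// subr_eq0 eq_sym lt_eqF.
Qed.

Lemma geometric_coef_bound a r M q : 0 < r -> 0 <= q < r ->
  (forall k, cabs (a k) * r ^+ k <= M) ->
  exists B, forall n, \sum_(0 <= k < n) cabs (a k) * q ^+ k <= B.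
Proof.
move=> r0 /andP[q0 qr] aM; exists (M / (1 - q / r)) => n.
have M0 : 0 <= M by apply: le_trans (aM 0%N); rewrite mulr_ge0 ?cabs_ge0 ?exprn_ge0 ?ltW.
apply: le_trans (_ : \sum_(0 <= k < n) M * (q / r) ^+ k <= _); last first.
  by apply: geometric_bound => //; rewrite ltr_pdivrMr// mul1r qr andbT divr_ge0// ltW.
apply: ler_sum => k _.
have -> : cabs (a k) * q ^+ k = cabs (a k) * r ^+ k * (q / r) ^+ k.
  by rewrite expr_div_n -mulrA; congr (_ * _); rewrite mulrCA divff ?mulr1// expf_neq0// gt_eqF.
by rewrite ler_wpM2r// exprn_ge0// divr_ge0// ltW.
Qed.

Lemma PS_abs f z a r q : PS f z a r -> 0 <= q < r ->
  exists B, forall n, \sum_(0 <= k < n) cabs (a k) * q ^+ k <= B.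
Proof. by move=> [r0 [M aM] _] qr; exact: geometric_coef_bound qr aM. Qed.

Lemma PS_le f z a r r' : 0 < r' <= r -> PS f z a r -> PS f z a r'.
Proof.
move=> /andP[r'0 r'r] [r0 [M aM] H]; split => //; last first.
  by move=> h hr; apply: H; exact: lt_le_trans r'r.
exists M => k; apply: le_trans (aM k).
by rewrite ler_wpM2l ?cabs_ge0// lerXn2r// nnegrE ltW.
Qed.

Lemma PS_ext f g z a r : (forall h, cabs h < r -> f (z + h) = g (z + h)) ->
  PS f z a r -> PS g z a r.
Proof. by move=> fg [r0 aM H]; split => // h hr; rewrite -fg//; exact: H. Qed.

(* Convergence at one point of modulus [e / 2] bounds the terms. *)
Lemma PS_of_cvg f z a e : 0 < e ->
  (forall h, cabs h < e -> series (fun k => a k * h ^+ k) ~> f (z + h)) ->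
  PS f z a (e / 2).
Proof.
move=> e0 H; have e2 : 0 < e / 2 by rewrite divr_gt0.
have e2e : e / 2 < e by rewrite ltr_pdivrMr// ltr_pMr// ltr1n.
split => //; last by move=> h he; apply: H; exact: lt_trans e2e.
have /H /cvgC_ReIm[cr ci] : cabs (e / 2)%:C < e by rewrite cabs_real gtr0_norm.
have br := cvg_series_cvg_0 (cvgP _ (_ : series (fun k => complex.Re (a k * (e / 2)%:C ^+ k)) @ \oo --> _)).
have {}br : (fun k => complex.Re (a k * (e / 2)%:C ^+ k)) @ \oo --> (0 : R).
  by apply: br; rewrite -(eq_cvg _ _ (seriesRe _)); exact: cr.
have bi := cvg_series_cvg_0 (cvgP _ (_ : series (fun k => complex.Im (a k * (e / 2)%:C ^+ k)) @ \oo --> _)).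
have {}bi : (fun k => complex.Im (a k * (e / 2)%:C ^+ k)) @ \oo --> (0 : R).
  by apply: bi; rewrite -(eq_cvg _ _ (seriesIm _)); exact: ci.
have c0 : (fun k => a k * (e / 2)%:C ^+ k) ~> 0 by apply/cvgC_ReIm; split.
have [N NH] := c0 1 ltr01.
exists (1 + \sum_(0 <= k < N) cabs (a k) * (e / 2) ^+ k) => k.
have t0 j : 0 <= cabs (a j) * (e / 2) ^+ j by rewrite mulr_ge0 ?cabs_ge0 ?exprn_ge0 ?ltW.
have tE j : cabs (a j * (e / 2)%:C ^+ j) = cabs (a j) * (e / 2) ^+ j.
  by rewrite cabsM cabsX cabs_real gtr0_norm.
have [Nk|kN] := leqP N k.
  have := NH _ Nk; rewrite subr0 tE => /ltW /le_trans; apply.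
  by rewrite lerDl; apply: sumr_ge0.
rewrite (big_cat_nat _ (ltnW kN))//= [X in _ + (_ + X)]big_ltn//.
rewrite (le_trans (_ : _ <= cabs (a k) * (e / 2) ^+ k + 0)) ?addr0//.
have : 0 <= \sum_(0 <= i < k) cabs (a i) * (e / 2) ^+ i by apply: sumr_ge0.
have : 0 <= \sum_(k.+1 <= i < N) cabs (a i) * (e / 2) ^+ i by apply: sumr_ge0.
by have := t0 k; lra.
Qed.

Lemma analytic_PS f z : analytic_at f z <-> exists a r, PS f z a r.
Proof.
split=> [[a /nearCP[e e0 H]]|[a [r [r0 _ H]]]].
  exists a, (e / 2); apply: PS_of_cvg => // h he.
  by have /cvgCP := H h he; rewrite [z + h]addrC addrK addrC.
exists a; apply/nearCP; exists r => // h hr; apply/cvgCP.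
by rewrite [z + h]addrC addrK addrC; exact: H.
Qed.

Lemma PS_val f z a r : PS f z a r -> f z = a 0%N.
Proof.
move=> [r0 _ /(_ 0)]; rewrite cabs0 addr0 => /(_ r0) H.
apply: (cvgC_unique H); have := @series_finite _ (fun k => a k * 0 ^+ k) 1%N.
rewrite big_nat1 expr0 mulr1; apply => k k0.
by rewrite expr0n -leqn0 leqNgt k0 /= mulr0.
Qed.

Lemma PS_cst c z r : 0 < r -> PS (fun=> c) z (fun k => if k == 0%N then c else 0) r.
Proof.
move=> r0; split => // [|h _].
  exists (cabs c) => -[|k] /=; first by rewrite expr0 mulr1.
  by rewrite cabs0 mul0r cabs_ge0.
have := @series_finite _ (fun k => (if k == 0%N then c else 0) * h ^+ k) 1%N.
by rewrite big_nat1/= expr0 mulr1; apply => -[//|k] _; rewrite mul0r.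
Qed.

Lemma PS_id z r : 0 < r -> PS id z (fun k => if k == 0%N then z else (k == 1%N)%:R) r.
Proof.
move=> r0; split => // [|h _].
  exists (cabs z + r) => -[|[|k]] /=; rewrite ?expr0 ?cabs1 ?cabs0 ?mulr1 ?mul1r ?mul0r.
  - by rewrite lerDl ltW.
  - by rewrite lerDr cabs_ge0.
  - by rewrite addr_ge0 ?cabs_ge0 ?ltW.
have := @series_finite _ (fun k => (if k == 0%N then z else (k == 1%N)%:R) * h ^+ k) 2%N.
by rewrite big_ltn// big_nat1 /= expr0 mulr1 expr1 mul1r; apply => -[|[|k]]// _; rewrite mul0r.
Qed.

Lemma PS_add f g z a b r : PS f z a r -> PS g z b r ->
  PS (fun s => f s + g s) z (fun k => a k + b k) r.
Proof.
move=> [r0 [M aM] fa] [_ [N bN] gb]; split => //.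
  exists (M + N) => k; apply: le_trans (_ : (cabs (a k) + cabs (b k)) * r ^+ k <= _).
    by rewrite ler_wpM2r ?cabsD// exprn_ge0// ltW.
  by rewrite mulrDl lerD.
move=> h hr; under eq_fun do rewrite mulrDl.
by apply: series_add; [exact: fa|exact: gb].
Qed.

Lemma PS_scale f z a r c : PS f z a r -> PS (fun s => c * f s) z (fun k => c * a k) r.
Proof.
move=> [r0 [M aM] fa]; split => // [|h hr].
  by exists (cabs c * M) => k; rewrite cabsM -mulrA ler_wpM2l ?cabs_ge0.
by under eq_fun do rewrite -mulrA; apply: series_scale; exact: fa.
Qed.

Lemma PS_sum (I : Type) (s : seq I) (F : I -> R[i] -> R[i]) (A : I -> nat -> R[i]) z r :
  0 < r -> (forall i, PS (F i) z (A i) r) ->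
  PS (fun t => \sum_(i <- s) F i t) z (fun k => \sum_(i <- s) A i k) r.
Proof.
move=> r0 FA; elim: s => [|i s ih].
  have := @PS_cst 0 z r r0; congr (PS _ _ _ _); apply/funext => k; rewrite big_nil//.
  by case: ifP.
under eq_fun do rewrite big_cons; under [X in PS _ _ X]eq_fun do rewrite big_cons.
exact: PS_add.
Qed.

Lemma PS_mul f g z a b r r' : 0 < r' < r -> PS f z a r -> PS g z b r ->
  PS (fun s => f s * g s) z (cauchy_prod a b) r'.
Proof.
move=> /andP[r'0 r'r] fa gb.
have key h : cabs h < r -> series (fun k => cauchy_prod a b k * h ^+ k) ~> (f (z + h) * g (z + h))
    /\ exists B, forall n, series (fun k => cabs (cauchy_prod a b k) * cabs h ^+ k) n <= B.
  move=> hr; have hr' : 0 <= cabs h < r by rewrite cabs_ge0.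
  have [A hA] := PS_abs fa hr'; have [B hB] := PS_abs gb hr'.
  have EA a' : (fun k => cabs (a' k * h ^+ k)) = (fun k => cabs (a' k) * cabs h ^+ k).
    by apply/funext => k; rewrite cabsM cabsX.
  have [_ _ /(_ _ hr) fx] := fa; have [_ _ /(_ _ hr) gy] := gb.
  have [||c1 c2] := @cauchy_prod_cvg _ _ _ A B _ _ _ _ fx gy.
  - by rewrite EA.
  - by rewrite EA.
  have E : cauchy_prod (fun k => a k * h ^+ k) (fun k => b k * h ^+ k) =
      (fun k => cauchy_prod a b k * h ^+ k).
    apply/funext => n; rewrite /cauchy_prod mulr_suml big_nat [RHS]big_nat.
    apply: eq_bigr => i; rewrite ltnS => /andP[_ ni].
    by rewrite mulrACA -exprD subnKC.
  rewrite E in c1 c2; split => //; exists (A * B) => n; rewrite -EA; exact: c2.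
split => //; last by move=> h hr; apply: (key h _).1; exact: lt_trans r'r.
have r'n : cabs r'%:C < r by rewrite cabs_real gtr0_norm.
have [_ [B hB]] := key r'%:C r'n.
rewrite cabs_real gtr0_norm// in hB; exists B => k.
apply: le_trans (hB k.+1); rewrite /series /= big_nat_recr//= lerDr.
by apply: sumr_ge0 => i _; rewrite mulr_ge0 ?cabs_ge0 ?exprn_ge0 ?ltW.
Qed.

Lemma PS_affine f c d z a r : c != 0 -> PS f (c * z + d) a r ->
  PS (fun s => f (c * s + d)) z (fun k => a k * c ^+ k) (r / cabs c).
Proof.
move=> c0 [r0 [M aM] fa]; have c0' : 0 < cabs c by rewrite cabs_gt0.
split; first by rewrite divr_gt0.
  exists M => k; apply: le_trans (aM k).
  rewrite cabsM cabsX expr_div_n -mulrA ler_wpM2l ?cabs_ge0//.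
  by rewrite mulrCA divff ?mulr1// expf_neq0// gt_eqF.
move=> h; rewrite ltr_pdivlMr// mulrC -cabsM => /fa.
rewrite (_ : c * (z + h) + d = c * z + d + c * h); last by ring.
by under eq_fun do rewrite exprMn mulrA.
Qed.

(** Expanding [(d + h)^k] gives a double series bounded by the sum of [|a k| (|d| + r')^k], so the
    order of summation may be exchanged. The formula for [b m] is kept because its case [m = 1] is
    the derivative in [PS_derive1]. *)
Lemma PS_recenter f z a r d r' : PS f z a r -> 0 < r' -> cabs d + r' < r ->
  exists2 b, (forall m, series (fun k => a k * ('C(k, m)%:R * d ^+ (k - m))) ~> b m) &
    PS f (z + d) b r'.
Proof.
move=> fa r'0 drr.
have dr0 : 0 <= cabs d + r' < r by rewrite drr andbT addr_ge0 ?cabs_ge0 ?ltW.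
have [B hB] := PS_abs fa dr0.
pose c h k m := a k * ('C(k, m)%:R * d ^+ (k - m)) * h ^+ m.
have cbd h : cabs h <= r' -> forall n m, \sum_(0 <= i < n) \sum_(0 <= j < m) cabs (c h i j) <= B.
  move=> hr' n m; apply: le_trans (hB n); apply: ler_sum => k _.
  under eq_bigr do rewrite /c !cabsM -!mulrA.
  rewrite -mulr_sumr ler_wpM2l ?cabs_ge0// exprDn.
  under eq_bigr do rewrite cabs_nat !cabsX.
  rewrite -(big_mkord xpredT (fun i => cabs d ^+ (k - i) * r' ^+ i *+ 'C(k, i))).
  apply: (@le_trans _ _ (\sum_(0 <= j < maxn m k.+1) cabs d ^+ (k - j) * r' ^+ j *+ 'C(k, j))).
    rewrite [leRHS](big_cat_nat _ (leq_maxl m k.+1))//=.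
    apply: ler_wpDr; first by apply: sumr_ge0 => j _; rewrite mulrn_wge0// mulr_ge0 ?exprn_ge0 ?cabs_ge0 ?ltW.
    apply: ler_sum => j _; rewrite mulr_natl -mulrnAl; rewrite mulrnAl ler_wMn2r//.
    by apply: ler_wpM2l; rewrite ?exprn_ge0 ?cabs_ge0//; apply: lerXn2r => //; rewrite nnegrE ?cabs_ge0 ?(ltW r'0).
  rewrite [leLHS](big_cat_nat _ (leq_maxr m k.+1))//= [X in _ + X](_ : _ = 0) ?addr0//.
  by rewrite big_nat big1// => j /andP[kj _]; rewrite bin_small.
have r'C : r'%:C != 0 :> R[i] by rewrite -cabs_eq0 cabs_real gtr0_norm// gt_eqF.
have r'n : cabs r'%:C = r' :> R by rewrite cabs_real gtr0_norm.
have r'n' : cabs r'%:C <= r' by rewrite r'n.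
(* At [h = r'] the column sums are [b m * r'^m]: this defines [b] and bounds it geometrically at
   once. *)
have [_ [col [_ [_ hcol _ _]]]] := double_series (cbd r'%:C r'n').
pose b m := col m / r'%:C ^+ m.
have hb m : series (fun k => a k * ('C(k, m)%:R * d ^+ (k - m))) ~> b m.
  have := series_scale (r'%:C ^- m) (hcol m); rewrite /b mulrC; congr (series _ ~> _).
  by apply/funext => k; rewrite /c mulrCA mulVf ?mulr1// expf_neq0.
exists b => //; split => //.
  exists B => m; rewrite -[X in X ^+ m]r'n -cabsX -cabsM /b divfK ?expf_neq0//.
  suff /abs_seriesC[l hl lB] : forall n, series (fun k => cabs (c r'%:C k m)) n <= B.
    by rewrite (cvgC_unique (hcol m) hl).
  move=> n; have := cbd r'%:C r'n' n m.+1; apply: le_trans.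
  by apply: ler_sum => i _; rewrite big_nat_recr//= lerDr; apply: sumr_ge0 => j _; exact: cabs_ge0.
move=> h hr'; have [row [col' [s [h1 h2 h3 h4]]]] := double_series (cbd h (ltW hr')).
have -> : f (z + d + h) = s.
  apply: cvgC_unique h3.
  have [_ _ /(_ (d + h)) fx] := fa.
  have := fx (le_lt_trans (cabsD _ _) (lt_trans _ drr)); rewrite ltrD2l => /(_ hr').
  rewrite addrA; congr (series _ ~> _); apply/funext => k.
  apply: cvgC_unique (h1 k).
  have := @series_finite _ (c h k) k.+1; rewrite exprDn mulr_sumr.
  rewrite -(big_mkord xpredT (fun i => a k * (d ^+ (k - i) * h ^+ i *+ 'C(k, i)))).
  rewrite [in X in _ -> X](eq_bigr (c h k)); last by move=> j _; rewrite /c -mulr_natl; ring.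
  by apply => j kj; rewrite /c bin_small// mul0r mulr0 mul0r.
move: h4; congr (series _ ~> _); apply/funext => m.
apply: (cvgC_unique (h2 m)).
have := series_scale (h ^+ m) (hb m); rewrite mulrC; congr (series _ ~> _).
by apply/funext => k; rewrite mulrC.
Qed.

End PowerSeries.

(** * Uniqueness of coefficients and complex derivatives *)

Section Derivatives.
Variable R : realType.
Implicit Types (f g : R[i] -> R[i]) (a b : nat -> R[i]) (r q : R) (z d h : R[i]).

Lemma PS_tail f z a r q : PS f z a r -> 0 <= q < r ->
  exists B, forall h, cabs h <= q -> cabs (f (z + h) - a 0%N) <= B * cabs h.
Proof.
move=> fa qr; have [r0 [M aM] H] := fa.
have aM' k : cabs (a k.+1) * r ^+ k <= M / r.
  by rewrite ler_pdivlMr// -mulrA -exprSr.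
have [B hB] := geometric_coef_bound r0 qr aM'.
exists B => h hq; have hr : cabs h < r by move: qr => /andP[_]; exact: le_lt_trans.
have c1 := cvgC_sub (H h hr) (cvgC_cst (a 0%N)).
have {}c1 := (cvgC_shift _ _ 1%N).2 c1.
apply: cvgC_le c1 _ => n; rewrite addn1 /series /= big_nat_recl//= expr0 mulr1 addrAC subrr add0r.
apply: le_trans (cabs_sum _ _ _) _; apply: le_trans (_ : (\sum_(0 <= k < n) cabs (a k.+1) * q ^+ k) * cabs h <= _).
  rewrite mulr_suml; apply: ler_sum => k _; rewrite cabsM cabsX exprSr mulrA.
  apply: ler_wpM2r; rewrite ?cabs_ge0//; apply: ler_wpM2l; rewrite ?cabs_ge0//.
  by apply: lerXn2r; rewrite ?nnegrE ?cabs_ge0//; case/andP: qr.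
by apply: ler_wpM2r; rewrite ?cabs_ge0.
Qed.

Lemma PS_continuous f z a r : PS f z a r ->
  forall e : R, 0 < e -> exists2 d : R, 0 < d & forall h, cabs h < d -> cabs (f (z + h) - f z) < e.
Proof.
move=> fa e e0; have [r0 _ _] := fa; rewrite (PS_val fa).
have [|B hB] := PS_tail (q := r / 2) fa.
  by rewrite divr_ge0 ?ltW//= ltr_pdivrMr// ltr_pMr// ltr1n.
have B1 : 0 < `|B| + 1 by rewrite ltr_wpDl.
exists (Num.min (r / 2) (e / (`|B| + 1))); first by rewrite lt_min !divr_gt0.
move=> h; rewrite lt_min => /andP[hr he].
apply: le_lt_trans (hB _ (ltW hr)) _; move: he; rewrite ltr_pdivlMr//; apply: le_lt_trans.
rewrite mulrC ler_wpM2l ?cabs_ge0//.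
by rewrite (le_trans (ler_norm B))// lerDl.
Qed.

(* It is enough that the series vanish on a sequence of reals decreasing to 0. *)
Lemma PS_zero a r : 0 < r -> (exists M, forall k, cabs (a k) * r ^+ k <= M) ->
  (forall t : R, 0 < t < r -> series (fun k => a k * t%:C ^+ k) ~> 0) ->
  forall k, a k = 0.
Proof.
move=> r0 aM H k; elim/ltn_ind : k => n ih.
have [M MH] := aM.
have aM' k : cabs (a (k + n)%N) * r ^+ k <= M / r ^+ n.
  by rewrite ler_pdivlMr ?exprn_gt0// -mulrA -exprD.
have r2 : 0 <= r / 2 < r by rewrite divr_ge0 ?ltW//= ltr_pdivrMr// ltr_pMr// ltr1n.
have /choice[F FP] : forall h, exists l, cabs h < r -> series (fun k => a (k + n)%N * h ^+ k) ~> l.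
  move=> h; have [hr|hr] := ltP (cabs h) r; last by exists 0.
  have hr' : 0 <= cabs h < r by rewrite cabs_ge0.
  have [B hB] := geometric_coef_bound r0 hr' aM'.
  have [|l hl _] := @abs_seriesC _ (fun k => a (k + n)%N * h ^+ k) B; last by exists l.
  by move=> m; under eq_fun do rewrite cabsM cabsX; exact: hB.
have PF : PS F 0 (fun k => a (k + n)%N) r.
  by split => //; [exists (M / r ^+ n)|move=> h; rewrite add0r; exact: FP].
have F0 t : 0 < t < r -> F t%:C = 0.
  move=> tr; have t0 : t%:C != 0 :> R[i] by rewrite -cabs_eq0 cabs_real gtr0_norm ?gt_eqF//; case/andP: tr.
  have h1 := FP t%:C; rewrite cabs_real gtr0_norm in h1; last by case/andP: tr.
  have {}h1 := h1 (andP tr).2.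
  have := series_scale (t%:C ^+ n) h1.
  have -> : (fun k => t%:C ^+ n * (a (k + n)%N * t%:C ^+ k)) =
      (fun k => (fun k => a k * t%:C ^+ k) (k + n)%N).
    by apply/funext => k; rewrite mulrCA -exprD addnC.
  move/(@series_shift _ (fun k => a k * t%:C ^+ k)); rewrite big_nat big1 ?add0r; last first.
    by move=> k kn; rewrite ih ?mul0r//; case/andP: kn.
  move/(cvgC_unique (H t tr))/esym/eqP; rewrite mulf_eq0 expf_eq0 (negbTE t0) andbF /=.
  by move/eqP.
rewrite -[n]add0n -(PS_val PF); apply/eqP; rewrite -cabs_eq0; apply/eqP/le_anti.
rewrite cabs_ge0 andbT; apply/ler_addgt0Pl => e e0; rewrite addr0.
have [d d0 hd] := PS_continuous PF e0.
pose t := Num.min (d / 2) (r / 2).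
have tP : 0 < t < r.
  by rewrite /t lt_min !divr_gt0//= gt_min; apply/orP; right; case/andP: r2.
have := hd t%:C; rewrite add0r F0// sub0r cabsN => /(_ _)/ltW; apply.
rewrite cabs_real gtr0_norm; last by case/andP: tP.
by rewrite /t gt_min ltr_pdivrMr// ltr_pMr// ltr1n.
Qed.

(** Comparison on real increments [t > 0] is what allows identities between real integrals and real
    series to pass to complex functions. *)
Lemma PS_unique f g z a b r r' e : PS f z a r -> PS g z b r' -> 0 < e ->
  (forall t : R, 0 < t < e -> f (z + t%:C) = g (z + t%:C)) -> a = b.
Proof.
move=> fa gb e0 fg; have [r0 _ _] := fa; have [r'0 _ _] := gb.
pose m := Num.min r (Num.min r' e).
have m0 : 0 < m by rewrite !lt_min r0 r'0 e0.
have mr : 0 < m <= r by rewrite m0 ge_min lexx.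
have mr' : 0 < m <= r' by rewrite m0 !ge_min lexx orbT.
have := PS_add (PS_le mr fa) (PS_scale (-1) (PS_le mr' gb)).
move=> [_ bd H]; apply/funext => k; apply/eqP; rewrite -subr_eq0 -[- b k]mulN1r; apply/eqP.
apply: (PS_zero m0 bd) => t /andP[t0 tm].
have := H t%:C; rewrite cabs_real gtr0_norm// fg ?mulN1r ?subrr; first exact.
by rewrite t0 (lt_le_trans tm)// !ge_min lexx !orbT.
Qed.

Lemma PS_derive f z a r : PS f z a r ->
  derivable (f : (R[i] : numFieldType) -> (R[i] : numFieldType)) z 1 /\
  derive1 (f : (R[i] : numFieldType) -> (R[i] : numFieldType)) z = a 1%N.
Proof.
move=> fa; have [r0 [M aM] H] := fa.
have r2 : 0 <= r / 2 < r by rewrite divr_ge0 ?ltW//= ltr_pdivrMr// ltr_pMr// ltr1n.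
have fa' : PS (fun h => f (z + h) - a 0%N) 0 (fun k => if k == 0%N then 0 else a k) r.
  split => //; first by exists M => -[|k] //=; rewrite cabs0 mul0r (le_trans _ (aM 0%N))// mulr_ge0 ?cabs_ge0 ?exprn_ge0 ?ltW.
  move=> h hr; rewrite add0r.
  have := series_add (H h hr) (@series_finite _ (fun k => if k == 0%N then - a 0%N else 0) 1%N _).
  rewrite big_nat1 /= => /(_ _)/(_ _).
  have E : (fun n => a n * h ^+ n + (if n == 0%N then - a 0%N else 0)) =
     (fun k => (if k == 0%N then 0 else a k) * h ^+ k).
    by apply/funext => -[|k] /=; rewrite ?expr0 ?mulr1 ?mul0r ?subrr ?addr0.
  by rewrite E; apply; case.
have key : (fun h : (R[i] : numFieldType) => h^-1 *: ((f (h + z) : (R[i] : numFieldType)) - f z)) @ 0^' --> (a 1%N : (R[i] : numFieldType)).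
  apply/(@cvgrPdist_lt _ (R[i] : numFieldType)) => -[e e']; rewrite ltcE /= => /andP[/eqP -> e0].
  apply/dnearCP.
  have aM' k : cabs (a k.+1) * r ^+ k <= M / r by rewrite ler_pdivlMr// -mulrA -exprSr.
  pose F h := if h == 0 then a 1%N else (f (z + h) - a 0%N) / h.
  have PF : PS F 0 (fun k => a k.+1) r.
    split => //; first by exists (M / r).
    move=> h hr; rewrite add0r /F; case: eqP => [->|/eqP h0].
      have := @series_finite _ (fun k => a k.+1 * 0 ^+ k) 1%N; rewrite big_nat1 expr0 mulr1.
      by apply; case => // k _; rewrite expr0n mulr0.
    have := H h hr; rewrite -(cvgC_shift _ _ 1%N) => c1.
    have := cvgC_scale h^-1 (cvgC_sub c1 (cvgC_cst (a 0%N))); rewrite mulrC.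
    congr (_ ~> _); apply/funext => n.
    rewrite addn1 /series /= big_nat_recl//= expr0 mulr1 addrAC subrr add0r mulr_sumr.
    by apply: eq_bigr => k _; rewrite exprS mulrCA mulKf.
  have [d d0 hd] := PS_continuous PF e0; exists d => // h h0 hd'.
  have := hd h hd'; rewrite !add0r (PS_val PF) /F (negbTE h0).
  by rewrite -cabsC normCE ltcR -(PS_val fa) [h + z]addrC mulrC.
split; first by apply/cvg_ex; exists (a 1%N); under eq_fun do rewrite scaler1.
by apply/cvg_lim => //; exact: norm_hausdorff.
Qed.

(** Bernoulli's inequality for [r / q = 1 + d]; a smaller radius pays for the factor [k + 1] of
    termwise differentiation. *)
Lemma linear_geometric_bound r q : 0 < q < r -> exists K, forall k, k.+1%:R * q ^+ k <= K * r ^+ k.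
Proof.
move=> /andP[q0 qr]; have d0 : 0 < r / q - 1 by rewrite subr_gt0 ltr_pdivlMr// mul1r.
pose d := r / q - 1; exists (1 + d^-1) => k.
have -> : r ^+ k = (1 + d) ^+ k * q ^+ k.
  by rewrite -exprMn /d addrCA subrr addr0 divfK// gt_eqF.
rewrite mulrA ler_wpM2r ?exprn_ge0 ?(ltW q0)//.
apply: le_trans (_ : (1 + d^-1) * (1 + d *+ k) <= _); last first.
  rewrite ler_wpM2l ?addr_ge0 ?invr_ge0 ?(ltW d0)//.
  elim: k => [|k ih]; first by rewrite mulr0n addr0.
  rewrite exprS mulrSr addrA; apply: le_trans (_ : (1 + d) * (1 + d *+ k) <= _); last first.
    by rewrite ler_wpM2l// addr_ge0// ltW.
  rewrite mulrDl mul1r lerD2l mulrDr mulr1 lerDl mulr_ge0 ?mulrn_wge0// ltW//.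
have dn0 : d != 0 by rewrite gt_eqF.
have -> : (1 + d^-1) * (1 + d *+ k) = 1 + d *+ k + d^-1 + k%:R by rewrite -mulr_natr; field.
have : 0 <= d *+ k by rewrite mulrn_wge0// ltW.
have : 0 <= d^-1 by rewrite invr_ge0 ltW.
by rewrite -natr1; lra.
Qed.

(** At each [z + d] the derivative is the coefficient [b 1] of the recentred series, which
    [PS_recenter] expresses as the sum of [k a_k d^(k - 1)]. *)
Lemma PS_derive1 f z a r r' : PS f z a r -> 0 < r' < r ->
  PS (derive1 (f : (R[i] : numFieldType) -> (R[i] : numFieldType))) z
     (fun k => k.+1%:R * a k.+1) r'.
Proof.
move=> fa rr'; have [r0 [M aM] H] := fa; have [r'0 r'r] := andP rr'.
split => //.
  have [K hK] := linear_geometric_bound rr'.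
  exists (`|K| * (M / r)) => k; rewrite cabsM cabs_nat mulrAC.
  apply: le_trans (_ : `|K| * r ^+ k * cabs (a k.+1) <= _).
    rewrite ler_wpM2r ?cabs_ge0// (le_trans (hK k))// ler_wpM2r ?ler_norm// exprn_ge0// ltW//.
  by rewrite -mulrA ler_wpM2l// ler_pdivlMr// mulrC mulrA -exprS mulrC.
move=> d dr'.
have [||b hb Pb] := @PS_recenter _ f z a r d ((r - r') / 2) fa.
- by rewrite divr_gt0// subr_gt0.
- by lra.
have -> : derive1 (f : (R[i] : numFieldType) -> (R[i] : numFieldType)) (z + d) = b 1%N.
  exact: (PS_derive Pb).2.
have := (cvgC_shift _ _ 1%N).2 (hb 1%N); congr (_ ~> _); apply/funext => n.
rewrite addn1 /series /= big_nat_recl//= bin0n mul0r mulr0 add0r.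
by apply: eq_bigr => k _; rewrite bin1 subn1 /= mulrCA mulrA.
Qed.

Lemma PS_deriven f z a r n : PS f z a r ->
  exists r', PS (cderiven n f) z (fun k => ((k + n)`!%:R / k`!%:R) * a (k + n)%N) r'.
Proof.
move=> fa; elim: n => [|n [r' ih]].
  exists r; move: fa; congr (PS _ _ _ _); apply/funext => k; rewrite addn0.
  have k0 : (k`!)%:R != 0 :> R[i] by rewrite pnatr_eq0 -lt0n fact_gt0.
  by rewrite (divff k0) mul1r.
have [r'0 _ _] := ih; exists (r' / 2); rewrite /cderiven derive1nS.
have := @PS_derive1 _ _ _ _ (r' / 2) ih; rewrite divr_gt0//= ltr_pdivrMr// ltr_pMr// ltr1n.
move=> /(_ isT); congr (PS _ _ _ _); apply/funext => k.
rewrite addSnnS mulrA; congr (_ * _).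
have k0 : (k`!)%:R != 0 :> R[i] by rewrite pnatr_eq0 -lt0n fact_gt0.
have k1 : k.+1%:R != 0 :> R[i] by rewrite pnatr_eq0.
rewrite (factS k) natrM; field; rewrite k0 /=.
by have : k.+1%:R != 0 :> R[i] by rewrite pnatr_eq0.
Qed.

(** All complex derivatives in the theorem are read off from Taylor coefficients through this
    identity. *)
Lemma cderiven_PS f z a r n : PS f z a r -> cderiven n f z = n`!%:R * a n.
Proof.
by move=> /(@PS_deriven _ _ _ _ n)[r' /PS_val ->]; rewrite add0n fact0 divr1.
Qed.

End Derivatives.

(** * The complex exponential and complex powers *)

Section Exponential.
Variable R : realType.
Implicit Types (z h c : R[i]) (r : R).

Lemma exp_term_le (x : R) n : 0 <= x -> x ^+ n / n`!%:R <= expR x.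
Proof.
case: n => [|n] x0; first by rewrite expr0 fact0 divr1 -expR0 ler_expR.
by apply: le_trans (expR_ge1Dxn n x0); rewrite lerDr.
Qed.

Lemma exp_series_le (x : R) n : 0 <= x -> \sum_(0 <= k < n) x ^+ k / k`!%:R <= expR x.
Proof.
move=> x0; have E : (fun k => x ^+ k / k`!%:R) = exp_coeff x.
  by rewrite exp_coeffE; apply/funext => k; rewrite mulrC.
rewrite (_ : \sum_(0 <= k < n) _ = series (exp_coeff x) n); last by rewrite -E.
apply: (@nondecreasing_cvgn_le _ (series (exp_coeff x))).
  by apply: nondecreasing_series => k _ _; rewrite -E mulr_ge0 ?exprn_ge0.
exact: is_cvg_series_exp_coeff.
Qed.

Lemma cabs_fact_term z k : cabs (z ^+ k / k`!%:R) = cabs z ^+ k / k`!%:R.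
Proof. by rewrite cabsM cabsX cabsV cabs_nat. Qed.

(** The series at [x] and at [i y] are the real series of [expR], [cos] and [sin]; by the binomial
    formula their Cauchy product is the series at [x + i y]. *)
Lemma cexp_cvg z : series (fun k => z ^+ k / k`!%:R) ~> cexp z.
Proof.
case: z => x y.
have f0 n : n`!%:R != 0 :> R[i] by rewrite pnatr_eq0 -lt0n fact_gt0.
have cx : series (fun k => x%:C ^+ k / k`!%:R) ~> (expR x)%:C.
  have := cvgC_real (is_cvg_series_exp_coeff x); rewrite -/(expR x).
  congr (_ ~> _); apply/funext => n; rewrite /series /= rmorph_sum/=; apply: eq_bigr => k _.
  by rewrite exp_coeffE /= rmorphM /= fmorphV rmorphXn rmorph_nat mulrC.
have cy : series (fun k => ('i * y%:C) ^+ k / k`!%:R) ~> (cos y +i* sin y).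
  have E k : ('i * y%:C) ^+ k / k`!%:R = cos_coeff y k +i* sin_coeff y k :> R[i].
    have -> : (k`!%:R : R[i])^-1 = ((k`!%:R : R)^-1)%:C by rewrite fmorphV rmorph_nat.
    have -> : ('i * y%:C) ^+ k = 'i ^+ k * (y ^+ k)%:C :> R[i] by rewrite exprMn rmorphXn.
    rewrite cos_coeffE sin_coeffE -mulrA -rmorphM/=.
    rewrite -[in LHS](odd_double_half k) exprD -muln2 mulnC exprM sqr_i.
    rewrite mulnC muln2 odd_double_half; set t := y ^+ k / _.
    have -> : (-1) ^+ k./2 = ((-1) ^+ k./2 : R)%:C by rewrite rmorphXn rmorphN rmorph1.
    have -> : (odd k)%:R * (-1) ^+ k.-1./2 = (odd k)%:R * (-1) ^+ k./2 :> R.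
      case: (k) => // j /=; case: (boolP (odd j)) => oj /=; first by rewrite !mul0r.
      by rewrite uphalf_half (negbTE oj).
    case: (odd k); rewrite /= ?expr1 ?expr0; apply/eqP; rewrite eq_complex /= /t; apply/andP; split; apply/eqP; ring.
  apply/cvgC_ReIm; split; under eq_fun do rewrite ?seriesRe ?seriesIm.
    have -> : (fun k => complex.Re (('i * y%:C) ^+ k / k`!%:R)) = cos_coeff y.
      by apply/funext => k; rewrite E.
    have -> : cos y = limn (series (cos_coeff y)) by rewrite unlock.
    exact: is_cvg_series_cos_coeff.
  have -> : (fun k => complex.Im (('i * y%:C) ^+ k / k`!%:R)) = sin_coeff y.
    by apply/funext => k; rewrite E.
  have -> : sin y = limn (series (sin_coeff y)) by rewrite unlock.
  exact: is_cvg_series_sin_coeff.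
have bx z n : series (fun k => cabs (z ^+ k / k`!%:R)) n <= expR (cabs z).
  by rewrite /series /=; under eq_bigr do rewrite cabs_fact_term; rewrite exp_series_le ?cabs_ge0.
have [+ _] := cauchy_prod_cvg (bx x%:C) (bx ('i * y%:C)) cx cy.
rewrite /cexp /=; congr (series _ ~> _); apply/funext => n.
have -> : x +i* y = x%:C + 'i * y%:C by exact: (complexE (x +i* y)).
rewrite addrC exprDn mulr_suml /cauchy_prod big_mkord; apply: eq_bigr => i _.
have ni : (i <= n)%N by rewrite -ltnS.
rewrite -mulr_natr.
have := bin_fact ni => /(congr1 (fun n => n%:R : R[i])); rewrite !natrM => <-.
have b0 : ('C(n, i)%:R : R[i]) != 0 by rewrite pnatr_eq0 -lt0n bin_gt0.
by field; rewrite b0 !f0.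
Qed.

Lemma cexpD z h : cexp (z + h) = cexp z * cexp h.
Proof.
rewrite /cexp ReD ImD expRD cosD sinD rmorphM/= -!mulrA; congr (_ * _).
rewrite mulrCA; congr (_ * _); apply/eqP; rewrite eq_complex /=.
by apply/andP; split; apply/eqP; ring.
Qed.

Lemma cexp_real (x : R) : cexp x%:C = (expR x)%:C.
Proof. by rewrite /cexp /= cos0 sin0 mulr1. Qed.

Lemma cexp0 : cexp (0 : R[i]) = 1.
Proof. by rewrite (_ : 0 = (0 : R)%:C)// cexp_real expR0. Qed.

Lemma cabs_cexp z : cabs (cexp z) = expR (complex.Re z).
Proof.
rewrite /cexp cabsM cabs_real ger0_norm ?expR_ge0//.
by rewrite /cabs /= cos2Dsin2 sqrtr1 mulr1.
Qed.

Lemma PS_cexp c z r : 0 < r ->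
  PS (fun s => cexp (c * s)) z (fun k => cexp (c * z) * (c ^+ k / k`!%:R)) r.
Proof.
move=> r0; split => //.
  exists (cabs (cexp (c * z)) * expR (cabs c * r)) => k.
  rewrite cabsM -mulrA ler_wpM2l ?cabs_ge0// cabs_fact_term mulrAC -exprMn.
  by rewrite exp_term_le// mulr_ge0 ?cabs_ge0// ltW.
move=> h _; rewrite mulrDr cexpD.
have := series_scale (cexp (c * z)) (cexp_cvg (c * h)).
have E k : cexp (c * z) * ((c * h) ^+ k / k`!%:R) = cexp (c * z) * (c ^+ k / k`!%:R) * h ^+ k.
  by rewrite exprMn; set t := _^-1; ring.
by under eq_fun do rewrite E.
Qed.

Lemma cpow_real (a t : R) : 0 < a -> cpow a t%:C = (a `^ t)%:C.
Proof.
by move=> a0; rewrite /cpow -rmorphM cexp_real /powR gt_eqF.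
Qed.

Lemma cabs_cpow (a : R) z : 0 < a -> cabs (cpow a z) = a `^ complex.Re z.
Proof.
by move=> a0; rewrite cabs_cexp ReM /= mulr0 subr0 /powR gt_eqF.
Qed.

Lemma cpowD (a : R) z h : cpow a (z + h) = cpow a z * cpow a h.
Proof. by rewrite /cpow mulrDl cexpD. Qed.

Lemma cpowM (a b : R) z : 0 < a -> 0 < b -> cpow (a * b) z = cpow a z * cpow b z.
Proof. by move=> a0 b0; rewrite /cpow lnM ?posrE// rmorphD mulrDr cexpD. Qed.

Lemma cpow0 (a : R) : cpow a 0 = 1. Proof. by rewrite /cpow mul0r cexp0. Qed.

Lemma cpow_nat (a : R) n : 0 < a -> cpow a n%:R = a%:C ^+ n.
Proof.
move=> a0; have -> : (n%:R : R[i]) = (n%:R : R)%:C by rewrite rmorph_nat.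
by rewrite cpow_real// powR_mulrn ?ltW// rmorphXn.
Qed.

Lemma PS_cpow (a : R) z r : 0 < r ->
  PS (cpow a) z (fun k => cpow a z * ((ln a)%:C ^+ k / k`!%:R)) r.
Proof.
move=> r0; have := PS_cexp (ln a)%:C z r0.
have E s : cexp ((ln a)%:C * s) = cpow a s by rewrite /cpow mulrC.
by rewrite E (funext E).
Qed.

Lemma PS_cpowN (a : R) z r : 0 < r ->
  PS (fun s => cpow a (- s)) z (fun k => cpow a (- z) * ((- (ln a)%:C) ^+ k / k`!%:R)) r.
Proof.
move=> r0; have := PS_cexp (- (ln a)%:C) z r0.
have E s : cexp (- (ln a)%:C * s) = cpow a (- s) by rewrite /cpow mulrC mulrN mulNr.
by rewrite E (funext E).
Qed.

End Exponential.

(** * Meromorphic functions *)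

(* Unlike [meromorphic], this allows removable singularities, hence is stable under sums. *)
Definition laurent {R : realType} (f : R[i] -> R[i]) (z : R[i]) :=
  exists m k a r, PS k z a r /\
    forall h, h != 0 -> cabs h < r -> f (z + h) * h ^+ m = k (z + h).

Section Meromorphic.
Variable R : realType.
Implicit Types (f g k : R[i] -> R[i]) (a b : nat -> R[i]) (r q : R) (z d h : R[i]).

Lemma PS_Xsub z m r : 0 < r -> PS (fun s => (s - z) ^+ m) z (fun j => (j == m)%:R) r.
Proof.
move=> r0; split => //.
  by exists (r ^+ m) => j; case: eqP => [->|_]; rewrite ?cabs1 ?cabs0 ?mul1r ?mul0r ?exprn_ge0// ltW.
move=> h _; rewrite addrAC subrr add0r.
have := @series_finite _ (fun j => (j == m)%:R * h ^+ j) m.+1.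
rewrite big_nat_recr//= eqxx mul1r big_nat big1 ?add0r; last first.
  by move=> i /andP[_ im]; rewrite ltn_eqF// mul0r.
by apply => j mj; rewrite gtn_eqF// mul0r.
Qed.

Lemma PS_inv z w : w != z -> PS (fun s => (s - w)^-1) z
  (fun j => - (w - z)^-1 ^+ j.+1) (cabs (w - z)).
Proof.
rewrite -subr_eq0 => wz; have c0 : 0 < cabs (w - z) by rewrite cabs_gt0.
split => //.
  exists (cabs (w - z))^-1 => j; rewrite cabsN cabsX cabsV exprS -mulrA -exprMn mulVf ?gt_eqF//.
  by rewrite expr1n mulr1.
move=> h hw; set d := w - z in wz c0 hw *.
have -> : z + h - w = h - d by rewrite /d opprB addrCA addrA.
have hd : h - d != 0 by apply: contraTneq hw => /eqP; rewrite subr_eq0 => /eqP ->; rewrite ltxx.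
have q1 : cabs h / cabs d < 1 by rewrite ltr_pdivrMr// mul1r.
have q0 : 0 <= cabs h / cabs d by rewrite divr_ge0 ?cabs_ge0.
have E n : \sum_(0 <= j < n) - d^-1 ^+ j.+1 * h ^+ j = (h - d)^-1 - (h - d)^-1 * (h / d) ^+ n.
  elim: n => [|n ih]; first by rewrite big_geq// expr0 mulr1 subrr.
  rewrite big_nat_recr//= ih.
  by rewrite !exprMn !exprS; set A := d^-1 ^+ n; set B := h ^+ n; field; rewrite wz hd.
have cq : (fun n => (cabs h / cabs d) ^+ n) @ \oo --> (0 : R) by apply: cvg_expr; rewrite ger0_norm.
have c2 : (fun n => (h / d) ^+ n) ~> 0.
  move/cvgRP : cq => cq e /cq[N NH]; exists N => n /NH.
  by rewrite !subr0 cabsX cabsM cabsV ger0_norm ?exprn_ge0.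
have := cvgC_sub (cvgC_cst (h - d)^-1) (cvgC_scale (h - d)^-1 c2); rewrite mulr0 subr0.
by rewrite -(funext E).
Qed.

Lemma PS_prod_exists f g z a b r r' : PS f z a r -> PS g z b r' ->
  exists r'', PS (fun s => f s * g s) z (cauchy_prod a b) r''.
Proof.
move=> fa gb; have [r0 _ _] := fa; have [r'0 _ _] := gb.
have m0 : 0 < Num.min r r' by rewrite lt_min r0.
have m1 : 0 < Num.min r r' <= r by rewrite m0 ge_min lexx.
have m2 : 0 < Num.min r r' <= r' by rewrite m0 ge_min lexx orbT.
exists (Num.min r r' / 2); apply: PS_mul (PS_le m1 fa) (PS_le m2 gb).
by rewrite divr_gt0//= ltr_pdivrMr// ltr_pMr// ltr1n.
Qed.

Lemma PS_add_exists f g z a b r r' : PS f z a r -> PS g z b r' ->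
  exists r'', PS (fun s => f s + g s) z (fun j => a j + b j) r''.
Proof.
move=> fa gb; have [r0 _ _] := fa; have [r'0 _ _] := gb.
have m0 : 0 < Num.min r r' by rewrite lt_min r0.
have m1 : 0 < Num.min r r' <= r by rewrite m0 ge_min lexx.
have m2 : 0 < Num.min r r' <= r' by rewrite m0 ge_min lexx orbT.
by exists (Num.min r r'); exact: PS_add (PS_le m1 fa) (PS_le m2 gb).
Qed.

Lemma PS_factor k z a r : PS k z a r ->
  (forall h, cabs h < r -> k (z + h) = 0) \/
  exists n G b, [/\ PS G z b r, b 0%N != 0 & forall h, cabs h < r -> k (z + h) = h ^+ n * G (z + h)].
Proof.
move=> ka; have [r0 [M aM] H] := ka.
have [a0|/existsNP an] := pselect (forall j, a j = 0).
  left => h hr; apply: (cvgC_unique (H h hr)); under eq_fun do rewrite a0 mul0r.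
  by have := @series_finite R (fun=> 0) 0%N; rewrite big_geq//; apply.
have {}an : exists j, a j != 0 by have [j /eqP ?] := an; exists j.
right; pose n := ex_minn an; exists n.
have [an0 amin] : a n != 0 /\ forall j, (j < n)%N -> a j = 0.
  rewrite /n; case: ex_minnP => m am mm; split => // j jm.
  by apply/eqP; apply: contraLR jm => /mm; rewrite -leqNgt.
have aM' j : cabs (a (j + n)%N) * r ^+ j <= M / r ^+ n.
  by rewrite ler_pdivlMr ?exprn_gt0// -mulrA -exprD.
have /choice[F FP] : forall h, exists l, cabs h < r -> series (fun j => a (j + n)%N * h ^+ j) ~> l.
  move=> h; have [hr|hr] := ltP (cabs h) r; last by exists 0.
  have hr' : 0 <= cabs h < r by rewrite cabs_ge0.
  have [B hB] := geometric_coef_bound r0 hr' aM'.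
  have [|l hl _] := @abs_seriesC _ (fun j => a (j + n)%N * h ^+ j) B; last by exists l.
  by move=> m; under eq_fun do rewrite cabsM cabsX; exact: hB.
exists (fun s => F (s - z)), (fun j => a (j + n)%N); split => //.
  split => //; first by exists (M / r ^+ n).
  by move=> h hr; rewrite addrAC subrr add0r; exact: FP.
move=> h hr; rewrite addrAC subrr add0r; apply: (cvgC_unique (H h hr)).
have := series_scale (h ^+ n) (FP h hr).
have -> : (fun j => h ^+ n * (a (j + n)%N * h ^+ j)) =
    (fun j => (fun j => a j * h ^+ j) (j + n)%N).
  by apply/funext => j; rewrite mulrCA -exprD addnC.
move/(@series_shift _ (fun j => a j * h ^+ j)); rewrite big_nat big1 ?add0r//.
by move=> j /andP[_ jn]; rewrite amin// mul0r.
Qed.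

Lemma PS_nonzero_near k z a r : PS k z a r -> a 0%N != 0 ->
  exists2 e : R, 0 < e & forall h, cabs h < e -> k (z + h) != 0.
Proof.
move=> ka a0; have c0 : 0 < cabs (a 0%N) by rewrite cabs_gt0.
have [d d0 H] := PS_continuous ka c0; exists d => // h /H; rewrite (PS_val ka).
by apply: contraTneq => ->; rewrite sub0r cabsN ltxx.
Qed.

(** [k] is recentred at [z + h] and divided by [(s - z)^m], one factor at a time; the radius [r1]
    keeps the disc away from [z]. *)
Lemma laurent_near f z : laurent f z -> exists2 e : R, 0 < e &
  forall h, h != 0 -> cabs h < e -> exists a r, PS f (z + h) a r.
Proof.
move=> [m [k [a [r [ka fk]]]]]; have [r0 _ _] := ka; exists r => // h h0 hr.
pose r1 := Num.min (r - cabs h) (cabs h) / 2.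
have r10 : 0 < r1 by rewrite divr_gt0// lt_min subr_gt0 hr cabs_gt0.
have r1r : r1 < r - cabs h /\ r1 < cabs h.
  have : 0 < Num.min (r - cabs h) (cabs h) by rewrite lt_min subr_gt0 hr cabs_gt0.
  have : Num.min (r - cabs h) (cabs h) <= r - cabs h by rewrite ge_min lexx.
  have : Num.min (r - cabs h) (cabs h) <= cabs h by rewrite ge_min lexx orbT.
  by rewrite /r1; split; lra.
have [//||b _ kb] := @PS_recenter _ k z a r h r1 ka; first by move: r1r.1; lra.
have [c [r2 Pc]] : exists c r2, PS (fun s => (s - z)^-1 ^+ m) (z + h) c r2.
  elim: (m) => [|j [c [r2 ih]]].
    by exists (fun j => if j == 0%N then 1 else 0), 1; exact: PS_cst.
  have zh : z != z + h by rewrite eq_sym -subr_eq0 addrAC subrr add0r.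
  have [r3 P3] := PS_prod_exists (PS_inv zh) ih.
  by eexists; exists r3; under eq_fun do rewrite exprS; exact: P3.
have [r3 P3] := PS_prod_exists kb Pc; have [r30 _ _] := P3.
exists (cauchy_prod b c), (Num.min r3 r1).
have m3 : 0 < Num.min r3 r1 <= r3 by rewrite lt_min r30 r10 ge_min lexx.
apply: PS_ext (PS_le m3 P3) => h'; rewrite lt_min => /andP[_ h'r].
have hh0 : h + h' != 0.
  apply: contraTneq h'r => /eqP; rewrite addr_eq0 => /eqP hE.
  by rewrite -leNgt -cabsN -hE ltW// r1r.2.
rewrite -addrA -fk//; last by have := cabsD h h'; move: r1r.1 h'r; lra.
by rewrite [z + _]addrC addrK -mulrA exprVn divff ?mulr1// expf_neq0.
Qed.

Lemma PS_laurent f z a r : PS f z a r -> laurent f z.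
Proof. by move=> fa; exists 0%N, f, a, r; split => // h _ _; rewrite expr0 mulr1. Qed.

Lemma analytic_laurent f z : analytic_at f z -> laurent f z.
Proof. by move=> /analytic_PS[a [r /PS_laurent]]. Qed.

Lemma pole_laurent f z : pole_at f z -> laurent f z.
Proof.
move=> [p [g [p0 /analytic_PS[a [r ga]] _ /dnearCP[e e0 H]]]].
have [r0 _ _] := ga; exists p, g, a, (Num.min r e); split.
  by apply: PS_le ga; rewrite lt_min r0 e0 ge_min lexx.
move=> h h0; rewrite lt_min => /andP[_ he]; rewrite H// addrAC subrr add0r.
by rewrite divfK// expf_neq0.
Qed.

Lemma meromorphic_laurent f z : meromorphic f -> laurent f z.
Proof. by move=> /(_ z)[/analytic_laurent|/pole_laurent]. Qed.

Let eqn f g z := exists2 e : R, 0 < e & forall h, h != 0 -> cabs h < e -> f (z + h) = g (z + h).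
Let neqn f g z := exists2 e : R, 0 < e & forall h, h != 0 -> cabs h < e -> f (z + h) != g (z + h).

(** After both poles are cleared, [(f - g) h^(m + m')] is a power series; by [PS_factor] it vanishes
    identically near [z] or has no zero in a punctured disc. *)
Let eqn_or_neqn f g z : laurent f z -> laurent g z -> eqn f g z \/ neqn f g z.
Proof.
move=> [m [k [a [r [ka fk]]]]] [m' [k' [a' [r' [ka' gk]]]]].
have [r0 _ _] := ka; have [r'0 _ _] := ka'.
have [r1 P1] := PS_prod_exists ka (PS_Xsub z m' ltr01).
have [r2 P2] := PS_prod_exists ka' (PS_Xsub z m ltr01).
have [r3 P3] := PS_add_exists P1 (PS_scale (-1) P2); have [r30 _ _] := P3.
have key h : h != 0 -> cabs h < r -> cabs h < r' ->
    k (z + h) * (z + h - z) ^+ m' + -1 * (k' (z + h) * (z + h - z) ^+ m) =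
    (f (z + h) - g (z + h)) * h ^+ (m + m').
  move=> h0 hr hr'; rewrite -fk// -gk// addrAC subrr add0r exprD.
  by set A := h ^+ m; set B := h ^+ m'; ring.
have [z0|[n [G [b [Gb b0 GE]]]]] := PS_factor P3.
  left; exists (Num.min r3 (Num.min r r')); first by rewrite !lt_min r0 r'0 r30.
  move=> h h0; rewrite !lt_min => /and3P[h3 hr hr'].
  have := z0 h h3; rewrite key// => /eqP; rewrite mulf_eq0 (negbTE (expf_neq0 _ h0)) orbF.
  by rewrite subr_eq0 => /eqP.
have [e e0 He] := PS_nonzero_near Gb b0.
right; exists (Num.min e (Num.min r3 (Num.min r r'))); first by rewrite !lt_min r0 r'0 e0 r30.
move=> h h0; rewrite !lt_min => /and4P[he h3 hr hr'].
have := GE h h3; rewrite key// => E; rewrite -subr_eq0; apply: contraTneq isT => fg0.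
have /eqP := E; rewrite fg0 mul0r eq_sym mulf_eq0 (negbTE (expf_neq0 _ h0)) /=.
by rewrite (negbTE (He h he)).
Qed.

Let spread (Q : R[i] -> Prop) z (e : R) : 0 < e -> (forall h, h != 0 -> cabs h < e -> Q (z + h)) ->
  forall d, cabs d < e -> d != 0 -> exists2 e' : R, 0 < e' & forall h, h != 0 -> cabs h < e' -> Q (z + d + h).
Proof.
move=> e0 H d de d0; exists (Num.min (e - cabs d) (cabs d)).
  by rewrite lt_min subr_gt0 de cabs_gt0.
move=> h h0; rewrite lt_min => /andP[h1 h2]; rewrite -addrA; apply: H.
  apply: contraTneq h2 => /eqP; rewrite addr_eq0 => /eqP ->.
  by rewrite cabsN ltxx.
by apply: le_lt_trans (cabsD _ _) _; move: h1; lra.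
Qed.

(** On the real line through [w] and [z], the parameters near which [f] and [g] agree form an open
    set, and by [eqn_or_neqn] so do the others; the line is connected. Agreement is meant on
    punctured neighbourhoods, so that values at poles stay free. *)
Lemma identity_theorem f g w : (forall z, laurent f z) -> (forall z, laurent g z) ->
  eqn f g w -> forall z, eqn f g z.
Proof.
move=> lf lg fgw z.
pose p (t : R) := w + t%:C * (z - w).
pose A := [set t : R | eqn f g (p t)].
have pE t u : p u = p t + (u - t)%:C * (z - w) by rewrite /p rmorphB/=; ring.
have opn (Q : R[i] -> Prop) : (forall t, Q (p t) -> exists2 e : R, 0 < e & forall d, cabs d < e -> Q (p t + d)) ->
    open [set t | Q (p t)].
  move=> HQ; rewrite openE => t /HQ[e e0 H]; apply/nbhs_ballP.
  exists (e / (cabs (z - w) + 1)); first by rewrite /= divr_gt0// ltr_wpDl ?cabs_ge0.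
  move=> u; rewrite /ball /= ltr_pdivlMr ?ltr_wpDl ?cabs_ge0// => tu.
  rewrite (pE t); apply: H; rewrite cabsM cabs_real distrC; apply: le_lt_trans tu.
  by rewrite ler_wpM2l// lerDl.
have oA : open A.
  apply: opn => t [e e0 H]; exists e => // d de.
  have [->|d0] := eqVneq d 0; first by rewrite addr0; exists e.
  exact: (spread (Q := fun s => f s = g s) e0 H de d0).
have oB : open (~` A).
  have -> : ~` A = [set t | neqn f g (p t)].
    apply/seteqP; split => t /=.
      by move=> nA; have [//|] := eqn_or_neqn (lf (p t)) (lg (p t)).
    move=> [e e0 H] [e' e'0 H'].
    pose h : R[i] := (Num.min e e' / 2)%:C.
    have m0 : 0 < Num.min e e' by rewrite lt_min e0.
    have h0 : h != 0 by rewrite -cabs_eq0 cabs_real gt_eqF// gtr0_norm divr_gt0.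
    have hm : cabs h < Num.min e e' by rewrite cabs_real gtr0_norm ?divr_gt0// ltr_pdivrMr// ltr_pMr// ltr1n.
    move: hm; rewrite lt_min => /andP[h1 h2].
    by have := H h h0 h1; rewrite (H' h h0 h2) eqxx.
  apply: opn => t [e e0 H]; exists e => // d de.
  have [->|d0] := eqVneq d 0; first by rewrite addr0; exists e.
  exact: (spread (Q := fun s => f s != g s) e0 H de d0).
have cR : connected [set: R] by apply/connected_intervalP => x y _ _ t _.
have : A = setT.
  apply: cR.
  - by exists 0; rewrite /A /= /p rmorph0 mul0r addr0.
  - by exists A => //; rewrite setTI.
  - by exists A; [rewrite -openC|rewrite setTI].
move=> /seteqP[_ /(_ 1 I)]; rewrite /A /= /p rmorph1 mul1r addrC subrK.
by move.
Qed.

(** A pole is impossible: its numerator would be [g] times [(s - z)^p] with [p > 0], which vanishes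
    at [z]. In the analytic case uniqueness of coefficients also fixes the value at [z] itself. *)
Lemma eqn_PS f g z a r : (analytic_at f z \/ pole_at f z) -> PS g z a r -> eqn f g z ->
  exists r', PS f z a r'.
Proof.
move=> fz ga [e e0 fg]; have fg' t : 0 < t < e -> f (z + t%:C) = g (z + t%:C).
  by move=> /andP[t0 te]; apply: fg; rewrite -?cabs_eq0 cabs_real gtr0_norm// gt_eqF.
case: fz => [/analytic_PS[b [r' fb]]|fp].
  by exists r'; rewrite -(PS_unique fb ga e0 fg').
have [p [k [p0 /analytic_PS[b [r' kb]] kz /dnearCP[d d0 fk]]]] := fp.
have [r1 P1] := PS_prod_exists ga (PS_Xsub z p ltr01).
have E : b = cauchy_prod a (fun j => (j == p)%:R).
  apply: (PS_unique kb P1 (e := Num.min e d)) => [|t]; first by rewrite lt_min e0.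
  rewrite lt_min => /and3P[t0 te td].
  have tC : t%:C != 0 :> R[i] by rewrite -cabs_eq0 cabs_real gtr0_norm// gt_eqF.
  rewrite -fg' ?t0// fk// ?cabs_real ?gtr0_norm// addrAC subrr add0r.
  by rewrite divfK// expf_neq0.
move: kz; rewrite (PS_val kb) E /cauchy_prod big_nat1 subnn.
by rewrite (_ : (0%N == p) = false) ?mulr0 ?eqxx// eq_sym gtn_eqF.
Qed.

(** Whatever function the choice operator returns agrees with [g] near [sigma + 1], hence near every
    point by [identity_theorem]; [eqn_PS] then recovers the value at [z]. *)
Lemma continuation_PS (sigma : R) (F : R[i] -> nat -> R[i]) g z a r :
  meromorphic g -> (forall s, sigma < complex.Re s -> F s ~> g s) ->
  PS g z a r -> exists r', PS (continuation sigma F) z a r'.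
Proof.
move=> mg Fg ga; rewrite /continuation; set P := [set f | _].
have Pg : P g by split => // s ss; apply/cvgCP; exact: Fg.
have [mf Ff] := xgetPex (fun=> 0) (ex_intro _ g Pg); set f := xget _ _ in mf Ff *.
apply: (eqn_PS (mf z) ga).
apply: (@identity_theorem f g (sigma + 1)%:C) => [w|w|]; [exact: meromorphic_laurent..|].
exists 1 => // h _ h1; have s1 : sigma < complex.Re ((sigma + 1)%:C + h).
  rewrite ReD /=; have := ler_Re_cabs h; rewrite ler_norml => /andP[+ _].
  by move: h1; lra.
by apply: cvgC_unique (Fg _ s1); apply/cvgCP; exact: Ff.
Qed.

(** Removable singularities are filled: [P z] singles out the only value that makes [g] analytic at
    [z], and the default [0] is taken at genuine poles. *)
Lemma meromorphic_of_laurent g : (forall z, laurent g z) ->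
  exists2 g', meromorphic g' & forall z a r, PS g z a r -> g' z = g z.
Proof.
move=> lg.
pose P z := [set c | exists a r, PS (fun s => if s == z then c else g s) z a r].
have Puniq z c c' : P z c -> P z c' -> c = c'.
  move=> [a [r ha]] [b [r' hb]].
  have := PS_val ha; have := PS_val hb; rewrite eqxx => -> ->.
  rewrite (PS_unique ha hb ltr01)// => t /andP[t0 _].
  by rewrite -subr_eq0 addrAC subrr add0r -cabs_eq0 cabs_real gtr0_norm// gt_eqF.
pose g' z := xget 0 (P z).
have g'g z a r : PS g z a r -> g' z = g z.
  move=> ga; have Pg : P z (g z).
    by exists a, r; apply: PS_ext ga => h _; case: eqP => // ->.
  by apply: (Puniq z) => //; apply: xgetPex; exists (g z).
exists g' => // z; have [m [k [a [r [ka gk]]]]] := lg z.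
have [r0 _ _] := ka.
have [e e0 He] := laurent_near (lg z).
have g'E h : h != 0 -> cabs h < e -> g' (z + h) = g (z + h).
  by move=> h0 he; have [b [r' /g'g]] := He h h0 he.
have ana c : P z c -> analytic_at g' z.
  move=> Pc; have [b [r' hb]] := Pc; have [r'0 _ _] := hb.
  apply/analytic_PS; exists b, (Num.min r' e).
  have mr : 0 < Num.min r' e <= r' by rewrite lt_min r'0 e0 ge_min lexx.
  apply: PS_ext (PS_le mr hb) => h; rewrite lt_min => /andP[_ he].
  rewrite -[X in _ == X]addr0 (inj_eq (addrI _)); case: eqP => [->|/eqP h0].
    by rewrite addr0; apply: (Puniq z) => //; apply: xgetPex; exists c.
  by rewrite g'E.
have [z0|[n [G [b [Gb b0 GE]]]]] := PS_factor ka.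
  left; apply: (ana 0); exists (fun j => if j == 0%N then 0 else 0), r.
  apply: PS_ext (PS_cst 0 z r0) => h hr; case: eqP => // /eqP.
  rewrite -[X in _ == X]addr0 (inj_eq (addrI _)) => h0.
  have := gk h h0 hr; rewrite z0// => /eqP; rewrite mulf_eq0 (negbTE (expf_neq0 _ h0)) orbF.
  by move=> /eqP.
have [mn|nm] := leqP m n.
  left; apply: (ana (if (n - m)%N == 0%N then G z else 0)).
  have [r1 P1] := PS_prod_exists (PS_Xsub z (n - m) ltr01) Gb; have [r10 _ _] := P1.
  eexists; exists (Num.min r1 r).
  have mr : 0 < Num.min r1 r <= r1 by rewrite lt_min r10 r0 ge_min lexx.
  apply: PS_ext (PS_le mr P1) => h; rewrite lt_min => /andP[_ hr].
  rewrite addrAC subrr add0r; case: eqP => [/eqP|/eqP].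
    rewrite -[X in _ == X]addr0 (inj_eq (addrI _)) => /eqP ->; rewrite addr0 expr0n.
    by case: eqP => _; rewrite ?mul1r ?mul0r.
  rewrite -[X in _ == X]addr0 (inj_eq (addrI _)) => h0.
  apply: (mulIf (expf_neq0 m h0)); by rewrite gk// GE// mulrAC -exprD subnK.
right; exists (m - n)%N, G; split; first by rewrite subn_gt0.
- by apply/analytic_PS; exists b, r.
- by rewrite (PS_val Gb).
apply/dnearCP; exists (Num.min e r); first by rewrite lt_min e0.
move=> h h0; rewrite lt_min => /andP[he hr]; rewrite g'E// addrAC subrr add0r.
apply: (mulIf (expf_neq0 m h0)); rewrite gk// GE//.
have -> : h ^+ m = h ^+ (m - n) * h ^+ n by rewrite -exprD subnK// ltnW.
by rewrite mulrA divfK ?expf_neq0// mulrC.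
Qed.

End Meromorphic.

(** * The kernel of the integral representation *)

Section RealCalculus.
Variable R : realType.
Implicit Types (f g : R -> R) (x y t s a d e : R).

(** These rules are for functions given pointwise, so that the derivative of a formula is assembled
    as a term of the same shape; its value is then adjusted by [is_derive_eq]. *)
Lemma isd_add f g x d e : is_derive x 1 f d -> is_derive x 1 g e ->
  is_derive x 1 (fun u => f u + g u) (d + e).
Proof. by move=> fd ge; exact: is_deriveD. Qed.

Lemma isd_sub f g x d e : is_derive x 1 f d -> is_derive x 1 g e ->
  is_derive x 1 (fun u => f u - g u) (d - e).
Proof. by move=> fd ge; exact: is_deriveB. Qed.

Lemma isd_mul f g x d e : is_derive x 1 f d -> is_derive x 1 g e ->
  is_derive x 1 (fun u => f u * g u) (d * g x + f x * e).
Proof.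
move=> fd ge; have h := is_deriveM fd ge; apply: is_derive_eq h _.
by rewrite /GRing.scale/= addrC [d * _]mulrC.
Qed.

Lemma isd_cst x (c : R) : is_derive x 1 (fun=> c) 0.
Proof. exact: is_derive_cst. Qed.

Lemma isd_id x : is_derive x 1 (fun u : R => u) 1.
Proof. exact: is_derive_id. Qed.

Lemma isd_comp f g x d e : is_derive (g x) 1 f d -> is_derive x 1 g e ->
  is_derive x 1 (fun u => f (g u)) (d * e).
Proof. by move=> fd ge; exact: is_derive1_comp. Qed.

Lemma isd_inv f x d : f x != 0 -> is_derive x 1 f d ->
  is_derive x 1 (fun u => (f u)^-1) (- d / f x ^+ 2).
Proof.
by move=> fx fd; have h := is_deriveV fx fd; apply: is_derive_eq h _; rewrite /GRing.scale/= mulrC mulrN mulNr.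
Qed.

Lemma isd_scale f x (c : R) d : is_derive x 1 f d ->
  is_derive x 1 (fun u => c * f u) (c * d).
Proof. by move=> fd; apply: is_derive_eq (isd_mul (isd_cst x c) fd) _; rewrite mul0r add0r. Qed.

Lemma isd_exp f x d : is_derive x 1 f d ->
  is_derive x 1 (fun u => expR (f u)) (expR (f x) * d).
Proof. by move=> fd; apply: isd_comp fd; exact: is_derive_expR. Qed.

Lemma isd_cos f x d : is_derive x 1 f d ->
  is_derive x 1 (fun u => cos (f u)) (- sin (f x) * d).
Proof. by move=> fd; apply: isd_comp fd; exact: is_derive_cos. Qed.

Lemma isd_sin f x d : is_derive x 1 f d ->
  is_derive x 1 (fun u => sin (f u)) (cos (f x) * d).
Proof. by move=> fd; apply: isd_comp fd; exact: is_derive_sin. Qed.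

Lemma isd_ln f x d : is_derive x 1 f d -> 0 < f x ->
  is_derive x 1 (fun u => ln (f u)) ((f x)^-1 * d).
Proof. by move=> fd f0; apply: isd_comp fd; exact: is_derive1_ln. Qed.

Lemma isd_atan f x d : is_derive x 1 f d ->
  is_derive x 1 (fun u => atan (f u)) ((1 + f x ^+ 2)^-1 * d).
Proof. by move=> fd; apply: isd_comp fd; exact: is_derive1_atan. Qed.

Lemma isd_eq f g x d : f =1 g -> is_derive x 1 f d -> is_derive x 1 g d.
Proof. by move=> /funext ->. Qed.

(* [x - i t] has modulus [exp (lmod x t)] and argument [- larg x t]. *)
Definition lmod x t : R := ln (x ^+ 2 + t ^+ 2) / 2.
Definition larg x t : R := atan (t / x).

(** Real and imaginary part of [(x - i t)^(- s)]. *)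
Definition Fre s x t : R := expR (- s * lmod x t) * cos (s * larg x t).
Definition Fim s x t : R := expR (- s * lmod x t) * sin (s * larg x t).

(* [Gre + i Gim = 2 q / (1 - q)] with [q = exp (- 2 pi t + 2 pi i a)]. *)
Definition Gden a t : R := (expR (2 * pi * t) + expR (- (2 * pi * t))) / 2 - cos (2 * pi * a).
Definition Gre a t : R := (cos (2 * pi * a) - expR (- (2 * pi * t))) / Gden a t.
Definition Gim a t : R := sin (2 * pi * a) / Gden a t.

Definition Gsh t : R := (expR (2 * pi * t) - expR (- (2 * pi * t))) / 2.

(* Partial derivatives; each is shared by two functions by the Cauchy-Riemann equations. *)
Definition dFre s x t : R := - s * (x * Fre s x t - t * Fim s x t) / (x ^+ 2 + t ^+ 2).
Definition dFim s x t : R := - s * (x * Fim s x t + t * Fre s x t) / (x ^+ 2 + t ^+ 2).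
Definition dGre a t : R := - (2 * pi * sin (2 * pi * a) * Gsh t) / Gden a t ^+ 2.
Definition dGim a t : R := 2 * pi * (cos (2 * pi * a) * Gden a t - sin (2 * pi * a) ^+ 2) / Gden a t ^+ 2.

Lemma modsq_gt0 x t : 0 < x -> 0 < x ^+ 2 + t ^+ 2.
Proof. by move=> x0; rewrite ltr_wpDr ?sqr_ge0// exprn_gt0. Qed.

Lemma isd_lmod_l x t : 0 < x -> is_derive x 1 (fun u => lmod u t) (x / (x ^+ 2 + t ^+ 2)).
Proof.
move=> x0; have m0 := modsq_gt0 t x0.
have h1 := isd_add (isd_mul (isd_id x) (isd_id x)) (isd_cst x (t ^+ 2)).
have h2 : 0 < x * x + t ^+ 2 by rewrite -expr2.
have h3 := isd_mul (isd_ln h1 h2) (isd_cst x 2^-1).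
apply: (is_derive_eq (isd_eq _ h3)) => [u|]; first by rewrite -expr2.
by rewrite -expr2; field; rewrite gt_eqF.
Qed.

Lemma lmodC x t : lmod x t = lmod t x. Proof. by rewrite /lmod addrC. Qed.

Lemma isd_lmod_r x t : 0 < x -> is_derive t 1 (fun u => lmod x u) (t / (x ^+ 2 + t ^+ 2)).
Proof.
move=> x0; have m0 := modsq_gt0 t x0.
have h1 := isd_add (isd_cst t (x ^+ 2)) (isd_mul (isd_id t) (isd_id t)).
have h2 : 0 < x ^+ 2 + t * t by rewrite -expr2.
have h3 := isd_mul (isd_ln h1 h2) (isd_cst t 2^-1).
apply: (is_derive_eq (isd_eq _ h3)) => [u|]; first by rewrite -expr2.
by rewrite -expr2; field; rewrite gt_eqF.
Qed.

Lemma isd_larg_r x t : 0 < x -> is_derive t 1 (fun u => larg x u) (x / (x ^+ 2 + t ^+ 2)).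
Proof.
move=> x0; have m0 := modsq_gt0 t x0.
have h1 := isd_mul (isd_id t) (isd_cst t x^-1).
apply: (is_derive_eq (isd_atan h1)).
by field; rewrite ?(gt_eqF x0) ?(gt_eqF m0).
Qed.

Lemma isd_larg_l x t : 0 < x -> is_derive x 1 (fun u => larg u t) (- t / (x ^+ 2 + t ^+ 2)).
Proof.
move=> x0; have m0 := modsq_gt0 t x0.
have h1 := isd_scale t (isd_inv (lt0r_neq0 x0) (isd_id x)).
apply: (is_derive_eq (isd_atan h1)).
by field; rewrite ?(gt_eqF x0) ?(gt_eqF m0).
Qed.

Lemma isd_Fre_l s x t : 0 < x -> is_derive x 1 (fun u => Fre s u t) (dFre s x t).
Proof.
move=> x0; have m0 := modsq_gt0 t x0.
have h := isd_mul (isd_exp (isd_scale (- s) (isd_lmod_l t x0)))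
  (isd_cos (isd_scale s (isd_larg_l t x0))).
by apply: (is_derive_eq h); rewrite /dFre /Fre /Fim; field; rewrite gt_eqF.
Qed.

Lemma isd_Fim_l s x t : 0 < x -> is_derive x 1 (fun u => Fim s u t) (dFim s x t).
Proof.
move=> x0; have m0 := modsq_gt0 t x0.
have h := isd_mul (isd_exp (isd_scale (- s) (isd_lmod_l t x0)))
  (isd_sin (isd_scale s (isd_larg_l t x0))).
by apply: (is_derive_eq h); rewrite /dFim /Fre /Fim; field; rewrite gt_eqF.
Qed.

Lemma isd_Fre_r s x t : 0 < x -> is_derive t 1 (fun u => Fre s x u) (dFim s x t).
Proof.
move=> x0; have m0 := modsq_gt0 t x0.
have h := isd_mul (isd_exp (isd_scale (- s) (isd_lmod_r t x0)))
  (isd_cos (isd_scale s (isd_larg_r t x0))).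
by apply: (is_derive_eq h); rewrite /dFim /Fre /Fim; field; rewrite gt_eqF.
Qed.

Lemma isd_Fim_r s x t : 0 < x -> is_derive t 1 (fun u => Fim s x u) (- dFre s x t).
Proof.
move=> x0; have m0 := modsq_gt0 t x0.
have h := isd_mul (isd_exp (isd_scale (- s) (isd_lmod_r t x0)))
  (isd_sin (isd_scale s (isd_larg_r t x0))).
by apply: (is_derive_eq h); rewrite /dFre /Fre /Fim; field; rewrite gt_eqF.
Qed.

Lemma cos_lt1 a : 0 < a < 1 -> cos (2 * pi * a) < 1.
Proof.
move=> /andP[a0 a1]; have -> : 2 * pi * a = (pi * a) *+ 2 by rewrite mulr2n; ring.
have sp : 0 < sin (pi * a).
  by apply: sin_gt0_pi; rewrite mulr_gt0 ?pi_gt0//= -ltr_pdivlMl ?pi_gt0// mulVf ?gt_eqF ?pi_gt0.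
have := cos2Dsin2 (pi * a); have : 0 < sin (pi * a) ^+ 2 by rewrite exprn_gt0.
by rewrite cos_mulr2n; lra.
Qed.

Lemma cosh_ge1 y : 1 <= (expR y + expR (- y)) / 2.
Proof.
rewrite ler_pdivlMr// mul1r; have e0 := expR_gt0 y.
have : 0 <= (expR y - 1) ^+ 2 by exact: sqr_ge0.
have -> : expR y + expR (- y) = ((expR y - 1) ^+ 2 + 2 * expR y) / expR y.
  by rewrite expRN; field; rewrite gt_eqF.
by move=> h; rewrite ler_pdivlMr//; lra.
Qed.

Lemma Gden_gt0 a t : 0 < a < 1 -> 0 < Gden a t.
Proof. by move=> /cos_lt1; have := cosh_ge1 (2 * pi * t); rewrite /Gden; lra. Qed.

Lemma isd_lin x (c : R) : is_derive x 1 (fun u => c * u) c.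
Proof. by apply: is_derive_eq (isd_scale c (isd_id x)) _; rewrite mulr1. Qed.

Lemma isd_Gden_l a t : is_derive a 1 (fun u => Gden u t) (2 * pi * sin (2 * pi * a)).
Proof.
have h := isd_sub (isd_cst a ((expR (2 * pi * t) + expR (- (2 * pi * t))) / 2))
  (isd_cos (isd_lin a (2 * pi))).
by apply: (is_derive_eq h); ring.
Qed.

Lemma isd_expl t (c : R) : is_derive t 1 (fun u => expR (c * u)) (expR (c * t) * c).
Proof. exact: isd_exp (isd_lin t c). Qed.

Lemma isd_explN t : is_derive t 1 (fun u => expR (- (2 * pi * u))) (- (2 * pi) * expR (- (2 * pi * t))).
Proof.
apply: (is_derive_eq (isd_eq _ (isd_expl t (- (2 * pi))))) => [u|]; first by rewrite mulNr.
by rewrite mulNr mulrC mulNr.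
Qed.

Lemma isd_Gden_r a t : is_derive t 1 (fun u => Gden a u) (2 * pi * Gsh t).
Proof.
have h := isd_sub (isd_mul (isd_add (isd_expl t (2 * pi)) (isd_explN t)) (isd_cst t 2^-1))
  (isd_cst t (cos (2 * pi * a))).
by apply: (is_derive_eq h); rewrite /Gsh; field.
Qed.

Lemma Gden_sh a t : Gden a t = Gsh t + expR (- (2 * pi * t)) - cos (2 * pi * a).
Proof. by rewrite /Gden /Gsh; field. Qed.

Lemma isd_Gre_l a t : 0 < a < 1 -> is_derive a 1 (fun u => Gre u t) (dGre a t).
Proof.
move=> a01; have D0 := Gden_gt0 t a01; have D0' := lt0r_neq0 D0.
have h := isd_mul (isd_sub (isd_cos (isd_lin a (2 * pi))) (isd_cst a (expR (- (2 * pi * t)))))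
  (isd_inv (f := fun u => Gden u t) D0' (isd_Gden_l a t)).
apply: (is_derive_eq h); rewrite /dGre.
have -> : Gsh t = Gden a t - expR (- (2 * pi * t)) + cos (2 * pi * a) by rewrite Gden_sh; ring.
by field.
Qed.

Lemma isd_Gim_l a t : 0 < a < 1 -> is_derive a 1 (fun u => Gim u t) (dGim a t).
Proof.
move=> a01; have D0 := Gden_gt0 t a01; have D0' := lt0r_neq0 D0.
have h := isd_mul (isd_sin (isd_lin a (2 * pi))) (isd_inv (f := fun u => Gden u t) D0' (isd_Gden_l a t)).
by apply: (is_derive_eq h); rewrite /dGim; field.
Qed.

Lemma isd_Gre_r a t : 0 < a < 1 -> is_derive t 1 (fun u => Gre a u) (- dGim a t).
Proof.
move=> a01; have D0 := Gden_gt0 t a01; have D0' := lt0r_neq0 D0.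
have h := isd_mul (isd_sub (isd_cst t (cos (2 * pi * a))) (isd_explN t))
  (isd_inv D0' (isd_Gden_r a t)).
apply: (is_derive_eq h); rewrite /dGim sin2cos2.
(* With [p = exp (2 pi t)] and [m = exp (- 2 pi t)] one has [p = 2 D - m + 2 c] and [p m = 1], which
   turn the claim into a polynomial identity. *)
have E : Gden a t * 2 = expR (2 * pi * t) + expR (- (2 * pi * t)) - 2 * cos (2 * pi * a).
  by rewrite /Gden; field.
have E2 : expR (2 * pi * t) * expR (- (2 * pi * t)) = 1 by rewrite expRxMexpNx_1.
rewrite /Gsh; move: E E2 D0'; set p := expR (2 * pi * t); set m := expR (- (2 * pi * t)).
set c := cos _; set D := Gden a t => E E2 D0'.
apply: (mulIf (expf_neq0 2 D0')).
have -> : (0 - - (2 * pi) * m) * D^-1 + (c - m) * (- (2 * pi * ((p - m) / 2)) / D ^+ 2) =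
  (2 * pi * m * D - (c - m) * (pi * (p - m))) / D ^+ 2 by field.
have -> : - (2 * pi * (c * D - (1 - c ^+ 2)) / D ^+ 2) = (- (2 * pi * (c * D - (1 - c ^+ 2)))) / D ^+ 2 by field.
rewrite !divfK ?expf_neq0//.
have -> : p = D * 2 - m + 2 * c by rewrite E; ring.
have E3 : (D * 2 - m + 2 * c) * m = 1 by rewrite E -E2; ring.
have -> : 1 - c ^+ 2 = (D * 2 - m + 2 * c) * m - c ^+ 2 by rewrite E3.
ring.
Qed.

Lemma isd_Gim_r a t : 0 < a < 1 -> is_derive t 1 (fun u => Gim a u) (dGre a t).
Proof.
move=> a01; have D0 := Gden_gt0 t a01; have D0' := lt0r_neq0 D0.
have h := isd_scale (sin (2 * pi * a)) (isd_inv D0' (isd_Gden_r a t)).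
by apply: (is_derive_eq h); rewrite /dGre; field.
Qed.

End RealCalculus.

(** * Integrals over the half-line *)

Section Integration.
Variable R : realType.
Local Notation mu := (@lebesgue_measure R).
Local Notation H := (`]0%R, +oo[%classic : set R).
Implicit Types (D : set R).

Lemma isd_continuous (f : R -> R) (x d : R) : is_derive x 1 f d -> {for x, continuous f}.
Proof. by move=> [fd _]; apply/differentiable_continuous/derivable1_diffP. Qed.

Lemma measurable_continuous (f : R -> R) : (forall t : R, 0 < t -> {for t, continuous f}) ->
  measurable_fun H f.
Proof.
move=> cf; apply: open_continuous_measurable_fun => //.
by move=> t; rewrite inE /= in_itv /= andbT; exact: cf.
Qed.

Lemma measurable_isd (f df : R -> R) : (forall t : R, 0 < t -> is_derive t 1 f (df t)) ->
  measurable_fun H f.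
Proof. by move=> fd; apply: measurable_continuous => t /fd; exact: isd_continuous. Qed.

Lemma Rintegrable_le D (f G : R -> R) : measurable D -> measurable_fun D f ->
  mu.-integrable D (EFin \o G) -> (forall t, D t -> `|f t| <= G t) ->
  mu.-integrable D (EFin \o f).
Proof.
move=> mD mf iG fG; apply: (@le_integrable _ _ _ mu D mD (EFin \o f) (EFin \o G)) => //; first exact/measurable_EFinP.
by move=> t Dt /=; rewrite lee_fin (le_trans (fG t Dt))// ler_norm.
Qed.

Lemma Rintegral_le_abs D (f G : R -> R) : measurable D -> measurable_fun D f ->
  mu.-integrable D (EFin \o G) -> (forall t, D t -> `|f t| <= G t) ->
  `|\int[mu]_(t in D) f t| <= \int[mu]_(t in D) G t.
Proof.
move=> mD mf iG fG; have iF := Rintegrable_le mD mf iG fG.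
apply: (le_trans (@le_normr_Rintegral _ _ _ mu D f mD iF)).
apply: (@le_Rintegral _ _ _ mu D (fun t => `|f t|) G) => //.
apply: (@Rintegrable_le D (fun t => `|f t|) G) => // [|t Dt]; last by rewrite normr_id fG.
exact: measurableT_comp.
Qed.

Lemma Rdominated_cvg D (f_ : nat -> R -> R) (f G : R -> R) : measurable D ->
  (forall n, measurable_fun D (f_ n)) ->
  (forall t, D t -> f_ n t @[n --> \oo] --> f t) ->
  mu.-integrable D (EFin \o G) -> (forall n t, D t -> `|f_ n t| <= G t) ->
  mu.-integrable D (EFin \o f) /\
  \int[mu]_(t in D) f_ n t @[n --> \oo] --> \int[mu]_(t in D) f t.
Proof.
move=> mD mf_ ff iG fG.
have ff' t : D t -> (f_ n t)%:E @[n --> \oo] --> (f t)%:E.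
  by move=> Dt; apply: cvg_EFin; [exact: nearW|exact: ff].
have mf_' n : measurable_fun D (fun t => (f_ n t)%:E) by exact/measurable_EFinP.
have mf : measurable_fun D (fun t => (f t)%:E).
  exact: (emeasurable_fun_cvg (fun n t => (f_ n t)%:E)).
have fG' t n : D t -> (`|(f_ n t)%:E| <= (EFin \o G) t)%E by move=> Dt; rewrite lee_fin fG.
have [i1 _ i3] := @dominated_convergence _ _ _ mu _ mD (fun n t => (f_ n t)%:E) _
  (EFin \o G) mf_' mf (aeW mu ff') iG (aeW mu fG').
split => //; apply: fine_cvg; rewrite fineK//; exact: integrable_fin_num.
Qed.

Lemma Rintegral_sum D n (f : nat -> R -> R) : measurable D ->
  (forall k, mu.-integrable D (EFin \o f k)) ->
  mu.-integrable D (EFin \o (fun t => \sum_(0 <= k < n) f k t)) /\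
  \int[mu]_(t in D) (\sum_(0 <= k < n) f k t) = \sum_(0 <= k < n) \int[mu]_(t in D) f k t.
Proof.
move=> mD iF; elim: n => [|n [i1 i2]].
  rewrite big_geq//; have -> : (fun t => \sum_(0 <= k < 0) f k t) = cst 0.
    by apply/funext => t; rewrite big_geq.
  by split; [exact: integrable0|rewrite Rintegral_cst// mul0r].
have -> : (fun t => \sum_(0 <= k < n.+1) f k t) = (fun t => \sum_(0 <= k < n) f k t + f n t).
  by apply/funext => t; rewrite big_nat_recr.
split; first exact: (@integrableD _ _ _ mu D mD (EFin \o (fun t => \sum_(0 <= k < n) f k t)) (EFin \o f n)).
by rewrite RintegralD// i2 big_nat_recr.
Qed.

Definition cmeasurable D (f : R -> R[i]) :=
  measurable_fun D (fun t => complex.Re (f t)) /\ measurable_fun D (fun t => complex.Im (f t)).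

Lemma cmeasurable_mul D (f g : R -> R[i]) : cmeasurable D f -> cmeasurable D g ->
  cmeasurable D (fun t => f t * g t).
Proof.
move=> [fr fi] [gr gi]; split.
  have -> : (fun t => complex.Re (f t * g t)) = (fun t => complex.Re (f t) * complex.Re (g t) - complex.Im (f t) * complex.Im (g t)).
    by apply/funext => t; rewrite ReM.
  by apply: measurable_funB; exact: measurable_funM.
have -> : (fun t => complex.Im (f t * g t)) = (fun t => complex.Re (f t) * complex.Im (g t) + complex.Im (f t) * complex.Re (g t)).
  by apply/funext => t; rewrite ImM.
by apply: measurable_funD; exact: measurable_funM.
Qed.

Lemma cmeasurable_cst D (c : R[i]) : cmeasurable D (fun=> c).
Proof. by split; exact: measurable_cst. Qed.

Lemma cmeasurable_exp D (f : R -> R[i]) n : cmeasurable D f -> cmeasurable D (fun t => f t ^+ n).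
Proof.
move=> mf; elim: n => [|n ih].
  by under eq_fun do rewrite expr0; exact: cmeasurable_cst.
by under eq_fun do rewrite exprS; exact: cmeasurable_mul.
Qed.

(** Taylor coefficient at [s = 0] of the integral of [Im (exp (s * la t) * g t)]. It serves for [V],
    with [la = - log (x - i t)], and for the Gamma integral, with [la = ln t]. *)
Definition laplace_coef D (la g : R -> R[i]) k : R :=
  \int[mu]_(t in D) complex.Im (la t ^+ k / k`!%:R * g t).

Section Laplace.
Variables (D : set R) (la g : R -> R[i]) (G : R -> R) (rho : R).
Hypotheses (mD : measurable D) (rho0 : 0 < rho)
  (mla : cmeasurable D la) (mg : cmeasurable D g)
  (iG : mu.-integrable D (EFin \o G))
  (laG : forall t, D t -> expR (rho * cabs (la t)) * cabs (g t) <= G t).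

Let term k t := complex.Im (la t ^+ k / k`!%:R * g t).

Let mterm k : measurable_fun D (term k).
Proof.
by apply: (cmeasurable_mul (cmeasurable_mul (cmeasurable_exp k mla) (cmeasurable_cst D _)) mg).2.
Qed.

Let term_le k t : D t -> `|term k t * rho ^+ k| <= G t.
Proof.
move=> Dt; apply: le_trans (laG Dt); rewrite normrM (ger0_norm (exprn_ge0 _ (ltW rho0))).
apply: (@le_trans _ _ (cabs (la t ^+ k / k`!%:R * g t) * rho ^+ k)).
  by rewrite ler_wpM2r ?ler_Im_cabs// exprn_ge0// ltW.
rewrite cabsM mulrAC ler_wpM2r ?cabs_ge0// cabs_fact_term mulrAC -exprMn mulrC [cabs _ * _]mulrC.
by rewrite mulrC exp_term_le// mulr_ge0 ?cabs_ge0// ltW.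
Qed.

Let iterm k : mu.-integrable D (EFin \o term k).
Proof.
apply: (@Rintegrable_le D (term k) (fun t => G t / rho ^+ k)) => // [|t Dt].
  exact: (@integrableZr _ _ _ mu D mD (rho ^+ k)^-1 (EFin \o G)).
have rk : 0 < rho ^+ k by rewrite exprn_gt0.
by rewrite ler_pdivlMr// -(ger0_norm (ltW rk)) -normrM; exact: term_le.
Qed.

(** A single term of the series of [exp (rho * |la|)] is at most the whole, so the majorant [G] also
    bounds the coefficients. *)
Lemma laplace_coef_bound k : `|laplace_coef D la g k| * rho ^+ k <= \int[mu]_(t in D) G t.
Proof.
have rk : 0 < rho ^+ k by rewrite exprn_gt0.
rewrite -ler_pdivlMr// -RintegralZr//.
apply: (@Rintegral_le_abs D (term k) (fun t => G t / rho ^+ k)) => //.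
  exact: (@integrableZr _ _ _ mu D mD (rho ^+ k)^-1 (EFin \o G)).
move=> t Dt; rewrite ler_pdivlMr// -(ger0_norm (ltW rk)) -normrM.
exact: term_le.
Qed.

(** Dominated convergence: the partial sums of the exponential series are bounded by
    [exp (rho * |la|)]. *)
Lemma laplace_cvg (s : R) : `|s| <= rho ->
  series (fun k => laplace_coef D la g k * s ^+ k) @ \oo -->
  \int[mu]_(t in D) complex.Im (cexp (s%:C * la t) * g t).
Proof.
move=> srho.
have iterms k : mu.-integrable D (EFin \o (fun t => term k t * s ^+ k)).
  exact: (@integrableZr _ _ _ mu D mD (s ^+ k) (EFin \o term k)).
have E n : series (fun k => laplace_coef D la g k * s ^+ k) n =
    \int[mu]_(t in D) (\sum_(0 <= k < n) term k t * s ^+ k).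
  by rewrite (Rintegral_sum n mD iterms).2; apply: eq_bigr => k _; rewrite RintegralZr.
rewrite (eq_cvg _ _ E).
have psumE n t : \sum_(0 <= k < n) term k t * s ^+ k =
    complex.Im (series (fun k => (s%:C * la t) ^+ k / k`!%:R) n * g t).
  rewrite /series /= mulr_suml Im_sum; apply: eq_bigr => k _.
  rewrite exprMn -!mulrA /term -rmorphXn [RHS]ImM/= mul0r addr0 mulrC.
  by rewrite mulrA.
have [|||_] := @Rdominated_cvg D (fun n t => \sum_(0 <= k < n) term k t * s ^+ k)
  (fun t => complex.Im (cexp (s%:C * la t) * g t)) G mD _ _ iG _; last exact.
- by move=> n; apply: measurable_sum => k; apply: measurable_funM => //; exact: measurable_cst.
- move=> t Dt; under eq_fun do rewrite psumE.
  have := cvgC_mul (cexp_cvg (s%:C * la t)) (cvgC_cst (g t)).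
  by move/cvgC_ReIm => [].
- move=> n t Dt; rewrite psumE (le_trans (ler_Im_cabs _))// cabsM (le_trans _ (laG Dt))// ler_wpM2r ?cabs_ge0//.
  apply: le_trans (cabs_sum _ _ _) _; under eq_bigr do rewrite cabs_fact_term.
  apply: le_trans (exp_series_le _ (cabs_ge0 _)) _.
  by rewrite ler_expR cabsM cabs_real ler_wpM2r ?cabs_ge0.
Qed.

End Laplace.

Lemma integral_expRN (a : R) :
  (\int[mu]_(t in `[a, +oo[) (expR (- t))%:E = (expR (- a))%:E)%E.
Proof.
have fd0 (t : R) : is_derive t 1 (fun u => expR (- u)) (- expR (- t)).
  have h := isd_exp (isd_lin t (-1)).
  have h' := isd_eq (g := fun u => expR (- u)) (fun u => congr1 (@expR R) (mulN1r _)) h.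
  by apply: (is_derive_eq h'); rewrite mulrN1 mulN1r.
have fd (t : R) : is_derive t 1 (fun u => - expR (- u)) (expR (- t)).
  have h := isd_eq (g := fun u => - expR (- u)) (fun u => mulN1r _) (isd_scale (-1) (fd0 t)).
  by apply: (is_derive_eq h); rewrite mulN1r opprK.
rewrite (ge0_continuous_FTC2y (F := fun u => - expR (- u)) (l := 0)).
- by rewrite sub0e -EFinN opprK.
- by move=> t _; exact: expR_ge0.
- by apply: continuous_subspaceT => t; exact: (isd_continuous (fd0 t)).
- by rewrite -[X in _ --> X]oppr0; apply: cvgN; exact: cvgr_expR.
- by move=> t _; case: (fd t).
- by apply: cvg_at_right_filter; apply: isd_continuous (fd a).
- by move=> t _; rewrite derive1E; case: (fd t).
Qed.

Let Hsub (a : R) : 0 <= a -> (`]a, +oo[%classic : set R) `<=` `[a, +oo[%classic.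
Proof. by move=> a0 t /=; rewrite !in_itv /= !andbT; exact: ltW. Qed.

Lemma integrable_expRN : mu.-integrable H (EFin \o (fun t => expR (- t))).
Proof.
apply: (@integrableS _ _ _ mu `[0%R, +oo[%classic) => //; first exact: Hsub.
apply/integrableP; split.
  have cm : measurable_fun [set: R] (fun t : R => expR (- t)).
    apply: continuous_measurable_fun => t.
    have h := isd_eq (g := fun u => expR (- u)) (fun u => congr1 (@expR R) (mulN1r _)) (isd_exp (isd_lin t (-1))).
    exact: isd_continuous h.
  by apply/measurable_EFinP; exact: measurable_funTS.
under eq_integral => t _ do rewrite /= ger0_norm ?expR_ge0//.
by rewrite integral_expRN ltry.
Qed.

(** The decay [exp (- 2 pi t)] of [g] absorbs polynomial growth and still leaves [exp (- t)]; this
    one majorant gives integrability, bounds and limits. *)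
Definition expdom (f : R -> R) (M : R) :=
  measurable_fun H f /\ forall t, 0 < t -> `|f t| <= M * expR (- t).

Let integrable_Mexp (M : R) : mu.-integrable H (EFin \o (fun t => M * expR (- t))).
Proof. exact: (@integrableZl _ _ _ mu H (measurable_itv _) M _ integrable_expRN). Qed.

Lemma expdom_integrable f M : expdom f M -> mu.-integrable H (EFin \o f).
Proof.
move=> [mf fM]; apply: (@Rintegrable_le H f (fun t => M * expR (- t))) => //.
by move=> t; rewrite /= in_itv /= andbT; exact: fM.
Qed.

Lemma Rintegral_expRN (a : R) : 0 <= a -> \int[mu]_(t in `]a, +oo[) expR (- t) = expR (- a).
Proof.
move=> a0; rewrite Rintegral_itv_obnd_cbnd; first by rewrite /Rintegral integral_expRN.
apply: (@integrableS _ _ _ mu H) => //; last exact: integrable_expRN.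
by move=> t /=; rewrite !in_itv /= !andbT; exact: le_lt_trans.
Qed.

Lemma expdom_le f M : expdom f M -> `|\int[mu]_(t in H) f t| <= M.
Proof.
move=> [mf fM]; apply: (@le_trans _ _ (\int[mu]_(t in H) (M * expR (- t)))).
  apply: (@Rintegral_le_abs H f (fun t => M * expR (- t))) => //.
  by move=> t; rewrite /= in_itv /= andbT; exact: fM.
rewrite RintegralZl//; last exact: integrable_expRN.
by rewrite Rintegral_expRN// oppr0 expR0 mulr1.
Qed.

Lemma expdom_cvg (f_ : nat -> R -> R) f M : (forall n, expdom (f_ n) M) ->
  (forall t, 0 < t -> f_ n t @[n --> \oo] --> f t) ->
  \int[mu]_(t in H) f_ n t @[n --> \oo] --> \int[mu]_(t in H) f t.
Proof.
move=> fM ff; have [|||||_] := @Rdominated_cvg H f_ f (fun t => M * expR (- t)); last exact.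
- exact: measurable_itv.
- by move=> n; case: (fM n).
- by move=> t; rewrite /= in_itv /= andbT; exact: ff.
- exact: integrable_Mexp.
- by move=> n t; rewrite /= in_itv /= andbT; case: (fM n) => _; apply.
Qed.

(** Reduces integrals over the half-line to compact intervals, where the fundamental theorem of
    calculus applies. *)
Lemma expdom_truncate f M : expdom f M ->
  \int[mu]_(t in `[0, n%:R]) f t @[n --> \oo] --> \int[mu]_(t in H) f t.
Proof.
move=> fM; have [mf fle] := fM.
have E n : \int[mu]_(t in `[0, n%:R]) f t = \int[mu]_(t in H) (f \_ `]-oo, n%:R]) t.
  rewrite -Rintegral_mkcondr -Rintegral_itv_obnd_cbnd.
    congr (Rintegral _ _ _); apply/seteqP; split => t /=; rewrite !in_itv /= !andbT.
      by move=> /andP[].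
    by move=> [-> ->].
  apply: (@integrableS _ _ _ mu H) => //; last exact: expdom_integrable fM.
  by move=> t /=; rewrite !in_itv /= !andbT => /andP[].
under eq_fun do rewrite E; apply: (@expdom_cvg _ _ M) => [n|t t0].
  split; first by apply/measurable_restrict => //; apply: measurable_funS mf => // t [].
  move=> t t0; rewrite patchE; case: ifPn => _; first exact: fle.
  by rewrite normr0 (le_trans _ (fle t t0)).
apply: cvg_near_cst; near=> n; rewrite patchE mem_set//= in_itv /=.
by near: n; exact: nbhs_infty_ger.
Unshelve. all: by end_near. Qed.

End Integration.

(** * Bounds for the kernel, uniform in the phase *)

Section Kernel.
Variable R : realType.
Local Notation mu := (@lebesgue_measure R).
Local Notation H := (`]0%R, +oo[%classic : set R).
Implicit Types (x y t s a m r : R).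

Lemma lmod_ge x t : 0 < x -> ln x <= lmod x t.
Proof.
move=> x0; rewrite /lmod ler_pdivlMr// mulr_natr -lnXn//.
by rewrite ler_ln ?posrE ?modsq_gt0 ?exprn_gt0// lerDl sqr_ge0.
Qed.

Lemma exp_Nlmod_le s x t : 0 < x -> 0 <= s -> expR (- s * lmod x t) <= x `^ (- s).
Proof.
by move=> x0 s0; rewrite /powR gt_eqF// ler_expR !mulNr lerN2 ler_wpM2l// lmod_ge.
Qed.

Lemma Fre_abs s x t : `|Fre s x t| <= expR (- s * lmod x t).
Proof. by rewrite normrM ger0_norm ?expR_ge0// ler_piMr ?expR_ge0 ?cos_max. Qed.

Lemma Fim_abs s x t : `|Fim s x t| <= expR (- s * lmod x t).
Proof. by rewrite normrM ger0_norm ?expR_ge0// ler_piMr ?expR_ge0 ?sin_max. Qed.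

(* The polynomial growth of the modulus is absorbed by one exponential. *)
Definition modbound (n : nat) (c : R) : R := n`!%:R * expR (1 + c).

(** [b^n <= n! exp b] for [b = 1 + c + t], and [t - 2 pi t <= - t] since [pi >= 2]. *)
Lemma poly_exp_le n c t : 0 <= c -> 0 <= t ->
  (1 + c + t) ^+ n * expR (- (2 * pi * t)) <= modbound n c * expR (- t).
Proof.
move=> c0 t0; have b0 : 0 <= 1 + c + t by lra.
have f0 : 0 < n`!%:R :> R by rewrite ltr0n fact_gt0.
have := exp_term_le n b0; rewrite ler_pdivrMr// => h.
apply: (@le_trans _ _ (expR (1 + c + t) * n`!%:R * expR (- (2 * pi * t)))).
  by rewrite ler_wpM2r// expR_ge0.
have -> : expR (1 + c + t) * n`!%:R * expR (- (2 * pi * t)) = n`!%:R * expR (1 + c + t - 2 * pi * t).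
  by rewrite [expR (1 + c + t - _)]expRD; ring.
have -> : modbound n c * expR (- t) = n`!%:R * expR (1 + c - t) by rewrite /modbound [expR (1 + c - t)]expRD; ring.
rewrite ler_wpM2l ?(ltW f0)// ler_expR; have := @pi_ge2 R.
have : 0 <= (pi - 2) * t by rewrite mulr_ge0// subr_ge0 pi_ge2.
by nra.
Qed.

(** [P = 1 + x + 1 / x + t] bounds both the modulus of [x - i t] and its inverse, so the logarithm
    of the modulus is at most [ln P] in absolute value. *)
Lemma exp_lmod_le r x t n : 0 < x -> 0 <= t -> 0 <= r <= n%:R ->
  expR (r * `|lmod x t|) <= (1 + (x + x^-1) + t) ^+ n.
Proof.
move=> x0 t0 /andP[r0 rn]; have xi : 0 < x^-1 by rewrite invr_gt0.
set P := 1 + (x + x^-1) + t.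
have P1 : 1 <= P by rewrite /P; lra.
have P0 : 0 < P by lra.
have lP : `|lmod x t| <= ln P.
  rewrite ler_norml; apply/andP; split.
    apply: le_trans (lmod_ge t x0); rewrite lerNl -lnV ?posrE// ler_ln ?posrE//.
    by rewrite /P; lra.
  rewrite /lmod ler_pdivrMr// mulr_natr -lnXn// ler_ln ?posrE ?modsq_gt0 ?exprn_gt0//.
  rewrite /P; have : 0 <= x * t by rewrite mulr_ge0// ltW.
  by nra.
rewrite -powR_mulrn ?(ltW P0)// /powR gt_eqF// ler_expR.
by apply: ler_pM => //; rewrite ln_ge0.
Qed.

(** [cosh - cos >= cosh - 1 + m >= m cosh], because [m <= 1 <= cosh]. *)
Lemma Gden_lower m a t : 0 < m <= 1 -> cos (2 * pi * a) <= 1 - m ->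
  m * expR (2 * pi * t) / 2 <= Gden a t.
Proof.
move=> /andP[m0 m1] cm; rewrite /Gden; have := cosh_ge1 (2 * pi * t).
have := expR_gt0 (2 * pi * t); have := expR_gt0 (- (2 * pi * t)).
set p := expR (2 * pi * t); set q := expR (- _) => q0 p0 h.
have : 0 <= (1 - m) * ((p + q) / 2 - 1) by rewrite mulr_ge0 ?subr_ge0//.
have : 0 <= m * q by rewrite mulr_ge0// ltW.
lra.
Qed.

Section Bounds.
Variables (m a : R).
Hypotheses (m01 : 0 < m <= 1) (am : cos (2 * pi * a) <= 1 - m).

Let m0 : 0 < m. Proof. by case/andP: m01. Qed.

Lemma Gden_gt0' t : 0 < Gden a t.
Proof. by apply: lt_le_trans (Gden_lower t m01 am); rewrite divr_gt0 ?mulr_gt0 ?expR_gt0. Qed.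

Lemma Gden_inv_le t : (Gden a t)^-1 <= 2 / m * expR (- (2 * pi * t)).
Proof.
have h := Gden_lower t m01 am.
rewrite expRN -[leRHS]invrK lef_pV2 ?posrE ?Gden_gt0' ?invr_gt0 ?mulr_gt0 ?invr_gt0 ?expR_gt0//.
by apply: le_trans h; rewrite le_eqVlt; apply/orP; left; apply/eqP; field; rewrite ?gt_eqF ?expR_gt0.
Qed.

Lemma expRN_le1 t : 0 <= t -> 0 <= expR (- (2 * pi * t)) <= 1.
Proof. by move=> t0; rewrite expR_ge0 expR_le1 oppr_le0 !mulr_ge0 ?pi_ge0. Qed.

Lemma Gim_le t : `|Gim a t| <= 2 / m * expR (- (2 * pi * t)).
Proof.
rewrite normrM normfV (gtr0_norm (Gden_gt0' t)); apply: le_trans (Gden_inv_le t).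
by rewrite ler_piMl ?invr_ge0 ?sin_max ?(ltW (Gden_gt0' t)).
Qed.

Lemma Gre_le t : 0 <= t -> `|Gre a t| <= 4 / m * expR (- (2 * pi * t)).
Proof.
move=> t0; rewrite normrM normfV (gtr0_norm (Gden_gt0' t)).
have -> : 4 / m * expR (- (2 * pi * t)) = 2 * (2 / m * expR (- (2 * pi * t))) by ring.
apply: ler_pM (Gden_inv_le t) => //; first by rewrite invr_ge0 ltW// Gden_gt0'.
have /andP[e0 e1] := expRN_le1 t0.
by rewrite (le_trans (ler_normB _ _))// (ger0_norm e0); have := cos_max (2 * pi * a); lra.
Qed.

End Bounds.

(** The maximum of the cosine on a compact subinterval of [(0, 1)] is below 1. The resulting [m]
    bounds [g] uniformly in the phase, as differentiation in [a] and the limit [x -> 0] require. *)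
Lemma cos_gap u v : 0 < u -> u <= v -> v < 1 ->
  exists2 m : R, 0 < m <= 1 & forall a, u <= a <= v -> cos (2 * pi * a) <= 1 - m.
Proof.
move=> u0 uv v1.
have cf : {within `[u, v], continuous (fun a : R => cos (2 * pi * a))}.
  by apply: continuous_subspaceT => a; exact: (isd_continuous (isd_cos (isd_lin a (2 * pi)))).
have [c cuv cmax] := EVT_max uv cf.
exists (Num.min 1 (1 - cos (2 * pi * c))).
  rewrite lt_min ltr01 ge_min lexx /= andbT subr_gt0 cos_lt1//.
  by move: cuv; rewrite in_itv /= => /andP[uc cv]; rewrite (lt_le_trans u0 uc) (le_lt_trans cv v1).
move=> a auv; have /cmax h : a \in `[u, v] by rewrite in_itv.
apply: le_trans h _.
have : Num.min 1 (1 - cos (2 * pi * c)) <= 1 - cos (2 * pi * c) by rewrite ge_min lexx orbT.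
lra.
Qed.

(** Imaginary and real part of [(x - i t)^(- s) g (t, a)]. *)
Definition Wfun s x a t : R := Fre s x t * Gim a t + Fim s x t * Gre a t.
Definition Qfun s x a t : R := Fre s x t * Gre a t - Fim s x t * Gim a t.

(* The derivative of [Wfun s (y - a) a t] in [a], and minus that of [Qfun s (y - a) a t] in [t]. *)
Definition dWfun s x a t : R :=
  - dFre s x t * Gim a t + Fre s x t * dGim a t - dFim s x t * Gre a t + Fim s x t * dGre a t.

Lemma isd_Wfun s y a t : 0 < a < 1 -> a < y ->
  is_derive a 1 (fun b => Wfun s (y - b) b t) (dWfun s (y - a) a t).
Proof.
move=> a01 ay; have x0 : 0 < y - a by rewrite subr_gt0.
have h0 : is_derive a 1 (fun b : R => y - b) (-1).
  by apply: is_derive_eq (isd_sub (isd_cst a y) (isd_id a)) _; rewrite sub0r.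
have h1 := isd_comp (g := fun b => y - b) (isd_Fre_l s t x0) h0.
have h2 := isd_comp (g := fun b => y - b) (isd_Fim_l s t x0) h0.
have h := isd_add (isd_mul h1 (isd_Gim_l t a01)) (isd_mul h2 (isd_Gre_l t a01)).
by apply: (is_derive_eq h); rewrite /dWfun; ring.
Qed.

Lemma isd_Qfun s x a t : 0 < a < 1 -> 0 < x ->
  is_derive t 1 (fun u => Qfun s x a u) (- dWfun s x a t).
Proof.
move=> a01 x0.
have h := isd_sub (isd_mul (isd_Fre_r s t x0) (isd_Gre_r t a01)) (isd_mul (isd_Fim_r s t x0) (isd_Gim_r t a01)).
by apply: (is_derive_eq h); rewrite /dWfun; ring.
Qed.

Lemma isd_Wfun_r s x a t : 0 < a < 1 -> 0 < x ->
  is_derive t 1 (fun u => Wfun s x a u) (dFim s x t * Gim a t + Fre s x t * dGre a t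
    + (- dFre s x t * Gre a t + Fim s x t * - dGim a t)).
Proof.
move=> a01 x0.
exact: isd_add (isd_mul (isd_Fre_r s t x0) (isd_Gim_r t a01)) (isd_mul (isd_Fim_r s t x0) (isd_Gre_r t a01)).
Qed.

Lemma W_measurable s x a : 0 < a < 1 -> 0 < x -> measurable_fun H (Wfun s x a).
Proof. by move=> a01 x0; apply: measurable_isd => t _; exact: isd_Wfun_r. Qed.

Lemma W_le s x a m t (K : R) : 0 < m <= 1 -> cos (2 * pi * a) <= 1 - m -> 0 <= t ->
  expR (- s * lmod x t) <= K ->
  `|Wfun s x a t| <= K * (6 / m) * expR (- (2 * pi * t)).
Proof.
move=> m01 am t0 K0; rewrite /Wfun (le_trans (ler_normD _ _))// normrM [X in _ + X]normrM.
have K0' : 0 <= K by rewrite (le_trans _ K0)// expR_ge0.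
have h1 : `|Fre s x t| * `|Gim a t| <= K * (2 / m * expR (- (2 * pi * t))).
  by apply: ler_pM => //; [exact: le_trans (Fre_abs s x t) K0 | exact: Gim_le].
have h2 : `|Fim s x t| * `|Gre a t| <= K * (4 / m * expR (- (2 * pi * t))).
  by apply: ler_pM => //; [exact: le_trans (Fim_abs s x t) K0 | exact: Gre_le].
apply: le_trans (lerD h1 h2) _; rewrite le_eqVlt; apply/orP; left; apply/eqP; ring.
Qed.

Lemma expR_2pi_le t : 0 <= t -> expR (- (2 * pi * t)) <= expR (- t).
Proof.
move=> t0; rewrite ler_expR lerN2; have : 0 <= (pi - 2) * t by rewrite mulr_ge0// subr_ge0 pi_ge2.
by nra.
Qed.

Definition Vfun s x a : R := \int[mu]_(t in H) Wfun s x a t.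

End Kernel.

(** * The integral of the derivative in the phase *)

Section Constancy.
Variable R : realType.
Local Notation mu := (@lebesgue_measure R).
Local Notation H := (`]0%R, +oo[%classic : set R).
Implicit Types (x y t s a m r : R).

Lemma ler_norm2 (a b A B : R) : `|a| <= A -> `|b| <= B -> `|a * b| <= A * B.
Proof. by move=> h1 h2; rewrite normrM; apply: ler_pM. Qed.

(** [x0 (x + t) <= x^2 + x t <= 2 (x^2 + t^2)]. *)
Lemma mod_ratio_le x0 x t : 0 < x0 <= x -> 0 <= t -> (x + t) / (x ^+ 2 + t ^+ 2) <= 2 / x0.
Proof.
move=> /andP[x00 xx] t0; have x1 : 0 < x by exact: lt_le_trans xx.
rewrite ler_pdivrMr ?modsq_gt0// mulrAC ler_pdivlMr//.
have : 0 <= (x - x0) * (x + t) by rewrite mulr_ge0 ?subr_ge0// addr_ge0// ltW.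
have : 0 <= (x - t) ^+ 2 by exact: sqr_ge0.
nra.
Qed.

Section Estimates.
Variables (s x0 x t K : R).
Hypotheses (s0 : 0 <= s) (xx : 0 < x0 <= x) (t0 : 0 <= t) (EK : expR (- s * lmod x t) <= K).

Let x00 : 0 < x0. Proof. by case/andP: xx. Qed.
Let x1 : 0 < x. Proof. by case/andP: xx => h1; exact: lt_le_trans. Qed.
Let K0 : 0 <= K. Proof. by rewrite (le_trans _ EK)// expR_ge0. Qed.

Lemma Fre_le : `|Fre s x t| <= K. Proof. exact: le_trans (Fre_abs _ _ _) EK. Qed.
Lemma Fim_le : `|Fim s x t| <= K. Proof. exact: le_trans (Fim_abs _ _ _) EK. Qed.

Let dF_le (p q : R) : `|p| <= K -> `|q| <= K ->
  `|- s * (x * p + t * q) / (x ^+ 2 + t ^+ 2)| <= 2 * s / x0 * K.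
Proof.
move=> pK qK; rewrite -mulrA normrM normrN (ger0_norm s0).
have -> : 2 * s / x0 * K = s * (K * (2 / x0)) by ring.
rewrite ler_wpM2l// normrM normfV (gtr0_norm (modsq_gt0 t x1)).
apply: (@le_trans _ _ (K * (x + t) / (x ^+ 2 + t ^+ 2))).
  rewrite ler_wpM2r ?invr_ge0 ?(ltW (modsq_gt0 _ x1))//.
  apply: le_trans (ler_normD _ _) _; rewrite mulrDr; apply: lerD; rewrite mulrC.
    by apply: ler_norm2 => //; rewrite ger0_norm// ltW.
  by apply: ler_norm2 => //; rewrite ger0_norm.
by rewrite -mulrA ler_wpM2l//; exact: mod_ratio_le.
Qed.

Lemma dFre_le : `|dFre s x t| <= 2 * s / x0 * K.
Proof. by rewrite /dFre -mulrN; apply: dF_le; rewrite ?normrN ?Fre_le ?Fim_le. Qed.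

Lemma dFim_le : `|dFim s x t| <= 2 * s / x0 * K.
Proof. by apply: dF_le; rewrite ?Fre_le ?Fim_le. Qed.

Variables (m a : R).
Hypotheses (m01 : 0 < m <= 1) (am : cos (2 * pi * a) <= 1 - m).
(** One constant for [g] and its derivatives: [quot_le] yields [2 c / m^2] with [c <= 25], the
    largest case being [c = 24] in [dGim_le]. *)
Let A : R := 50 / m ^+ 2.
Let e : R := expR (- (2 * pi * t)).
Let m0 : 0 < m. Proof. by case/andP: m01. Qed.
Let m1 : m <= 1. Proof. by case/andP: m01. Qed.
Let e0 : 0 < e. Proof. exact: expR_gt0. Qed.
Let D0 : 0 < Gden a t. Proof. exact: Gden_gt0' m01 am t. Qed.

Let cm (c : R) : 0 <= c <= 50 -> c / m <= A.
Proof.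
move=> /andP[c0 c50]; rewrite /A expr2 invfM mulrA ler_wpM2r ?invr_ge0 ?(ltW m0)//.
rewrite ler_pdivlMr//; have : 0 <= c * (1 - m) by rewrite mulr_ge0 ?subr_ge0.
nra.
Qed.

Lemma Gim_leA : `|Gim a t| <= A * e.
Proof. by apply: le_trans (Gim_le m01 am t) _; rewrite ler_wpM2r ?(ltW e0)//; apply: cm; lra. Qed.

Lemma Gre_leA : `|Gre a t| <= A * e.
Proof. by apply: le_trans (Gre_le m01 am t0) _; rewrite ler_wpM2r ?(ltW e0)//; apply: cm; lra. Qed.

Let quot_le (c p : R) : 0 <= c <= 25 -> `|p| <= c / m * Gden a t -> `|p / Gden a t ^+ 2| <= A * e.
Proof.
move=> /andP[c0 c25] pc; rewrite normrM normfV (gtr0_norm (exprn_gt0 2 D0)).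
apply: (@le_trans _ _ (c / m * (Gden a t)^-1)).
  by rewrite ler_pdivrMr ?exprn_gt0// expr2 !mulrA mulfVK// gt_eqF.
apply: (@le_trans _ _ (c / m * (2 / m * e))).
  by rewrite ler_wpM2l ?divr_ge0 ?(ltW m0)//; exact: Gden_inv_le m01 am t.
have -> : c / m * (2 / m * e) = (2 * c) / m ^+ 2 * e by field; rewrite gt_eqF.
by rewrite /A !ler_wpM2r ?invr_ge0 ?exprn_ge0 ?(ltW e0) ?(ltW m0)//; lra.
Qed.

Let p4 : 0 <= (pi : R) <= 4.
Proof. by rewrite pi_ge0 /=; have := @pihalf_lt2 R; lra. Qed.

Let twopi (c : R) : `|c| <= 1 -> `|2 * pi * c| <= 8.
Proof.
move=> c1; rewrite normrM ger0_norm ?mulr_ge0 ?pi_ge0//; have /andP[pi0 pi4] := p4.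
by apply: (@le_trans _ _ (2 * pi * 1)); [rewrite ler_wpM2l// mulr_ge0|lra].
Qed.

Let ep : expR (2 * pi * t) <= 2 / m * Gden a t.
Proof.
have := Gden_lower t m01 am; rewrite -[2 / m * _]mulrA => h.
by rewrite [m^-1 * _]mulrC mulrA ler_pdivlMr//; lra.
Qed.

Lemma dGre_le : `|dGre a t| <= A * e.
Proof.
rewrite /dGre; apply: (@quot_le 8); first lra.
rewrite normrN; have h1 : `|2 * pi * sin (2 * pi * a)| <= 8 * 1.
  by rewrite mulr1 twopi// sin_max.
have h2 : `|Gsh t| <= Gden a t / m.
  rewrite ger0_norm /Gsh; last first.
    rewrite divr_ge0// subr_ge0 ler_expR.
    have : 0 <= 2 * pi * t by rewrite !mulr_ge0// pi_ge0.
    lra.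
  have := ep; have : 2 / m * Gden a t = 2 * (Gden a t / m) by ring.
  by have := expR_gt0 (- (2 * pi * t)); lra.
by apply: le_trans (ler_norm2 h1 h2) _; rewrite mulr1 -mulrA [_ / m]mulrC.
Qed.

Lemma dGim_le : `|dGim a t| <= A * e.
Proof.
rewrite /dGim; apply: (@quot_le 24); first lra.
have -> : 24 / m * Gden a t = 8 * (3 / m * Gden a t) by ring.
apply: ler_norm2; first by rewrite -[2 * pi]mulr1 twopi// normr1.
apply: le_trans (ler_normB _ _) _.
have h1 : `|cos (2 * pi * a) * Gden a t| <= Gden a t.
  by rewrite normrM (gtr0_norm D0) ler_piMl ?(ltW D0) ?cos_max.
have h2 : `|sin (2 * pi * a) ^+ 2| <= 1 by rewrite normrX exprn_ile1 ?sin_max.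
have h3 : 1 <= 2 / m * Gden a t.
  by apply: le_trans ep; rewrite -expR0 ler_expR !mulr_ge0// pi_ge0.
have h4 : Gden a t <= Gden a t / m by rewrite ler_pdivlMr// ler_piMr// ltW.
have -> : 3 / m * Gden a t = Gden a t / m + 2 / m * Gden a t by ring.
lra.
Qed.

Lemma dWfun_le : `|dWfun s x a t| <= (2 * (1 + 2 * s / x0) * K * A) * e.
Proof.
have a1 := ler_norm2 dFre_le Gim_leA; have a2 := ler_norm2 Fre_le dGim_le.
have a3 := ler_norm2 dFim_le Gre_leA; have a4 := ler_norm2 Fim_le dGre_le.
rewrite /dWfun; apply: le_trans (ler_normD _ _) _; apply: le_trans (lerD (ler_normB _ _) (lexx _)) _.
apply: le_trans (lerD (lerD (ler_normD _ _) (lexx _)) (lexx _)) _.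
rewrite mulNr normrN.
apply: le_trans (lerD (lerD (lerD a1 a2) a3) a4) _.
by rewrite le_eqVlt; apply/orP; left; apply/eqP; ring.
Qed.

Lemma Wfun_le : `|Wfun s x a t| <= 2 * K * A * e.
Proof.
have a1 := ler_norm2 Fre_le Gim_leA; have a2 := ler_norm2 Fim_le Gre_leA.
apply: le_trans (ler_normD _ _) _; apply: le_trans (lerD a1 a2) _.
by rewrite le_eqVlt; apply/orP; left; apply/eqP; ring.
Qed.

Lemma Qfun_le : `|Qfun s x a t| <= 2 * K * A * e.
Proof.
have a1 := ler_norm2 Fre_le Gre_leA; have a2 := ler_norm2 Fim_le Gim_leA.
apply: le_trans (ler_normB _ _) _; apply: le_trans (lerD a1 a2) _.
by rewrite le_eqVlt; apply/orP; left; apply/eqP; ring.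
Qed.

End Estimates.

Lemma Fre0 s x : 0 < x -> Fre s x 0 = x `^ (- s).
Proof.
move=> x0; rewrite /Fre /larg mul0r atan0 mulr0 cos0 mulr1 /lmod expr0n addr0.
rewrite lnXn// /powR gt_eqF//; by congr expR; rewrite -[ln x *+ 2]mulr_natr mulfK ?pnatr_eq0.
Qed.

Lemma Fim0 s x : Fim s x 0 = 0.
Proof. by rewrite /Fim /larg mul0r atan0 mulr0 sin0 mulr0. Qed.

Lemma Gre0 a : 0 < a < 1 -> Gre a 0 = -1.
Proof.
move=> /cos_lt1 c1; rewrite /Gre /Gden !mulr0 oppr0 expR0; field.
by have : 1 - cos (2 * pi * a) != 0 by rewrite subr_eq0 gt_eqF.
Qed.

Lemma Qfun0 s x a : 0 < a < 1 -> 0 < x -> Qfun s x a 0 = - x `^ (- s).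
Proof. by move=> a01 x0; rewrite /Qfun Fre0// Fim0 mul0r subr0 Gre0// mulrN1. Qed.

Lemma dWfun_continuous s x a : 0 < a < 1 -> 0 < x -> continuous (dWfun s x a).
Proof.
move=> a01 x0 t.
have D0 := Gden_gt0 t a01; have D0' := lt0r_neq0 D0.
have m0 := modsq_gt0 t x0.
have h1 := isd_Fre_r s t x0; have h2 := isd_Fim_r s t x0.
have h3 := isd_Gre_r t a01; have h4 := isd_Gim_r t a01; have h5 := isd_Gden_r a t.
have h6 := isd_mul (isd_sub (isd_expl t (2 * pi)) (isd_explN t)) (isd_cst t 2^-1).
have hm := isd_inv (f := fun u => x ^+ 2 + u ^+ 2) (lt0r_neq0 m0)
  (isd_add (isd_cst t (x ^+ 2)) (isd_eq (fun u => esym (expr2 u)) (isd_mul (isd_id t) (isd_id t)))).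
have hd := isd_inv (f := fun u => Gden a u ^+ 2) (expf_neq0 2 D0')
  (isd_eq (fun u => esym (expr2 (Gden a u))) (isd_mul h5 h5)).
have dFr := isd_mul (isd_scale (- s) (isd_sub (isd_scale x h1) (isd_mul (isd_id t) h2))) hm.
have dFi := isd_mul (isd_scale (- s) (isd_add (isd_scale x h2) (isd_mul (isd_id t) h1))) hm.
have dGr := isd_mul (isd_scale (-1) (isd_scale (2 * pi * sin (2 * pi * a)) h6)) hd.
have dGi := isd_mul (isd_scale (2 * pi) (isd_sub (isd_scale (cos (2 * pi * a)) h5) (isd_cst t (sin (2 * pi * a) ^+ 2)))) hd.
have h := isd_add (isd_sub (isd_add (isd_mul (isd_scale (-1) dFr) h4) (isd_mul h1 dGi)) (isd_mul dFi h3)) (isd_mul h2 dGr).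
apply: isd_continuous (isd_eq _ h) => u.
by rewrite /dWfun /dFre /dFim /dGre /dGim /Gsh !mulN1r.
Qed.

(** By the Cauchy-Riemann equations [- Qfun] is a primitive in [t]. It vanishes at infinity, and at
    [t = 0] it equals [x^(- s)], since there the real part of [g] is [-1] for every phase. *)
Lemma integral_dWfun s x a : 0 <= s -> 0 < x -> 0 < a < 1 ->
  \int[mu]_(t in H) dWfun s x a t = - x `^ (- s).
Proof.
move=> s0 x0 /[dup] a01 /andP[a0 a1].
have [m m01 /(_ a)] := cos_gap a0 (lexx a) a1; rewrite lexx => /(_ isT) am.
have xx : 0 < x <= x by rewrite x0 lexx.
have EK t : expR (- s * lmod x t) <= x `^ (- s) by exact: exp_Nlmod_le.
pose C := 2 * (1 + 2 * s / x) * x `^ (- s) * (50 / m ^+ 2).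
have K0 : 0 <= x `^ (- s) by exact: powR_ge0.
have C0 : 0 <= C.
  by rewrite /C !mulr_ge0 ?invr_ge0 ?sqr_ge0// addr_ge0// !mulr_ge0// invr_ge0 ltW.
have dom : expdom (dWfun s x a) C.
  split; first by apply: measurable_continuous => t _; exact: dWfun_continuous.
  move=> t t0; apply: le_trans (dWfun_le s0 xx (ltW t0) (EK t) m01 am) _.
  by rewrite ler_wpM2l// expR_2pi_le// ltW.
apply: (cvg_unique (@norm_hausdorff _ _) (expdom_truncate dom)).
have cz : 2 * x `^ (- s) * (50 / m ^+ 2) * expR (- n%:R) @[n --> \oo] --> 0.
  rewrite -[X in _ --> X](mulr0 (2 * x `^ (- s) * (50 / m ^+ 2))).
  apply: cvgM; first exact: cvg_cst.
  by apply: cvg_comp (@cvgr_expR R); exact: cvgr_idn.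
have Q0 : Qfun s x a n%:R @[n --> \oo] --> 0.
  apply/cvgr0Pnorm_le => e e0; near=> n.
  apply: le_trans (Qfun_le (ler0n R n) (EK _) m01 am) _.
  apply: (@le_trans _ _ (2 * x `^ (- s) * (50 / m ^+ 2) * expR (- n%:R))).
    by rewrite ler_wpM2l ?expR_2pi_le// !mulr_ge0 ?invr_ge0 ?sqr_ge0.
  by near: n; exact: cvgr_le cz _ e0.
have E n : (0 < n)%N -> \int[mu]_(t in `[0, n%:R]) dWfun s x a t = - x `^ (- s) - Qfun s x a n%:R.
  move=> n0; rewrite /Rintegral.
  have cQ := fun t => isd_continuous (isd_Qfun s t a01 x0).
  have h t : is_derive t 1 (fun u => - Qfun s x a u) (dWfun s x a t).
    have h := isd_eq (g := fun u => - Qfun s x a u) (fun u => mulN1r _) (isd_scale (-1) (isd_Qfun s t a01 x0)).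
    by apply: (is_derive_eq h); rewrite mulN1r opprK.
  rewrite (continuous_FTC2 (F := fun u => - Qfun s x a u)) ?ltr0n//.
  - by rewrite -EFinB /= Qfun0// opprK addrC.
  - by apply: continuous_subspaceT; exact: dWfun_continuous.
  - split.
    + by move=> t _; case: (h t).
    + by apply: cvg_at_right_filter; exact: isd_continuous (h 0).
    + by apply: cvg_at_left_filter; exact: isd_continuous (h n%:R).
  - by move=> t _; rewrite derive1E; case: (h t).
have : - x `^ (- s) - Qfun s x a n%:R @[n --> \oo] --> - x `^ (- s).
  by rewrite -[X in _ --> X]subr0; apply: cvgB => //; exact: cvg_cst.
apply: cvg_trans; apply: near_eq_cvg; near=> n; rewrite E//.
by near: n; exists 1%N.
Unshelve. all: by end_near. Qed.

Lemma isd_powR x (p : R) : 0 < x -> is_derive x 1 (fun u => u `^ p) (p * x `^ (p - 1)).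
Proof.
move=> x0; have h := isd_exp (isd_scale p (isd_ln (isd_id x) x0)).
have h' : is_derive x 1 (fun u => u `^ p) (expR (p * ln x) * (p * (x^-1 * 1))).
  have [d e] := h; have ee : \forall u \near x, expR (p * ln u) = u `^ p.
    near=> u; have u0 : 0 < u by near: u; exact: lt_nbhsr.
    by rewrite /powR gt_eqF.
  split; first by apply: near_eq_derivable ee d; rewrite oner_neq0.
  by rewrite -e; apply/esym; apply: near_eq_derive => //; rewrite oner_neq0.
apply: (is_derive_eq h').
have -> : x `^ (p - 1) = x `^ p * x^-1.
  by rewrite powRB ?(gt_eqF x0) ?implybT// powRr1// ltW.
by rewrite mulr1 /powR gt_eqF//; ring.
Unshelve. all: by end_near. Qed.

End Constancy.

(** * The difference equation *)

Section Psi.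
Variable R : realType.
Local Notation mu := (@lebesgue_measure R).
Local Notation H := (`]0%R, +oo[%classic : set R).
Implicit Types (x y t s a m r : R).

Definition Rfun s x a : R := x `^ (1 - s) / (s - 1) + Vfun s x a.

Lemma Wfun_dom s x0 x a m : 0 <= s -> 0 < x0 <= x -> 0 < m <= 1 -> 0 < a < 1 ->
  cos (2 * pi * a) <= 1 - m ->
  expdom (Wfun s x a) (2 * x0 `^ (- s) * (50 / m ^+ 2)).
Proof.
move=> s0 /andP[x00 xx] m01 a01 am; have x1 : 0 < x by exact: lt_le_trans xx.
split=> [|t t0]; first exact: W_measurable.
have EK : expR (- s * lmod x t) <= x0 `^ (- s).
  apply: le_trans (exp_Nlmod_le t x1 s0) _.
  by rewrite !powRN lef_pV2 ?posrE ?powR_gt0// ge0_ler_powR// ?nnegrE ltW.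
apply: le_trans (Wfun_le (ltW t0) EK m01 am) _.
by apply: ler_wpM2l; [rewrite !mulr_ge0 ?powR_ge0 ?invr_ge0 ?sqr_ge0|exact: expR_2pi_le (ltW t0)].
Qed.

Lemma isd_Vfun s y a : 0 <= s -> 0 < a < 1 -> a < y ->
  is_derive a 1 (fun b => Vfun s (y - b) b) (- (y - a) `^ (- s)).
Proof.
move=> s0 /[dup] a01 /andP[a0 a1] ay.
(* On []lo, hi[] the phase stays away from [0] and [1], and [x = y - b] stays above [x0 > 0], so one
   majorant serves for differentiation under the integral sign. *)
pose lo := a / 2; pose hi := (a + Num.min 1 y) / 2.
have amin : a < Num.min 1 y by rewrite lt_min a1.
have [h1 h2] : Num.min 1 y <= 1 /\ Num.min 1 y <= y by rewrite !ge_min !lexx orbT.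
have lo0 : 0 < lo by rewrite /lo; lra.
have loa : lo < a by rewrite /lo; lra.
have ahi : a < hi by rewrite /hi; lra.
have hi1 : hi < 1 by rewrite /hi; lra.
have hiy : hi < y by rewrite /hi; lra.
have [m m01 mP] := cos_gap lo0 (ltW (lt_trans loa ahi)) hi1.
pose x0 := y - hi; have x00 : 0 < x0 by rewrite subr_gt0.
have side b : b \in `]lo, hi[ -> [/\ 0 < b < 1, b < y, 0 < x0 <= y - b & cos (2 * pi * b) <= 1 - m].
  rewrite in_itv /= => /andP[b1 b2]; split.
  - by rewrite (lt_trans lo0 b1) (lt_trans b2 hi1).
  - exact: lt_trans b2 hiy.
  - by rewrite x00 /x0 lerB// ltW.
  - by apply: mP; rewrite !ltW.
have Ia : (`]lo, hi[%classic : set R) a by rewrite /= in_itv /= loa ahi.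
pose C := 2 * (1 + 2 * s / x0) * x0 `^ (- s) * (50 / m ^+ 2).
have C0 : 0 <= C.
  by rewrite /C !mulr_ge0 ?powR_ge0 ?invr_ge0 ?sqr_ge0// addr_ge0// !mulr_ge0// invr_ge0 ltW.
pose f b t := Wfun s (y - b) b t.
have intf b : (`]lo, hi[%classic : set R) b -> mu.-integrable H (EFin \o f b).
  by move=> /side[b01 by_ xx bm]; exact: expdom_integrable (Wfun_dom s0 xx m01 b01 bm).
have isdf b t : (`]lo, hi[%classic : set R) b -> is_derive b 1 (f ^~ t) (dWfun s (y - b) b t).
  by move=> /side[b01 by_ _ _]; exact: isd_Wfun.
have derf b t : (`]lo, hi[%classic : set R) b -> H t -> derivable (f ^~ t) b 1.
  by move=> Ib _; case: (isdf b t Ib).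
have G0 t : 0 <= C * expR (- t) by rewrite mulr_ge0// expR_ge0.
have iG : mu.-integrable H (EFin \o (fun t => C * expR (- t))).
  exact: (@integrableZl _ _ _ mu H (measurable_itv _) C _ (@integrable_expRN R)).
have d1E b t : (`]lo, hi[%classic : set R) b -> partial1of2 f b t = dWfun s (y - b) b t.
  by move=> Ib; rewrite partial1of2E; case: (isdf b t Ib).
have Gub b t : (`]lo, hi[%classic : set R) b -> H t -> `|partial1of2 f b t| <= C * expR (- t).
  move=> Ib; rewrite [X in X -> _]/= in_itv /= andbT => t0; rewrite d1E//.
  have [b01 by_ xx bm] := side b Ib; have x1 : 0 < y - b by rewrite subr_gt0.
  have EK : expR (- s * lmod (y - b) t) <= x0 `^ (- s).
    apply: le_trans (exp_Nlmod_le t x1 s0) _; have /andP[_ xx'] := xx.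
    by rewrite !powRN lef_pV2 ?posrE ?powR_gt0// ge0_ler_powR// ?nnegrE ltW.
  apply: le_trans (dWfun_le s0 xx (ltW t0) EK m01 bm) _.
  by rewrite ler_wpM2l// expR_2pi_le// ltW.
change (is_derive a 1 (fun b => \int[mu]_(t in H) f b t) (- (y - a) `^ (- s))); split.
  have dU := derivable_under_integral (mu := mu) (measurable_itv _) Ia intf derf G0 iG Gub.
  exact: dU.
rewrite -derive1E (differentiation_under_integral (mu := mu) (measurable_itv _) Ia intf derf G0 iG Gub).
have -> : (fun t => partial1of2 f a t) = dWfun s (y - a) a by apply/funext => t; exact: d1E.
by apply: integral_dWfun => //; rewrite subr_gt0.
Qed.

(** The derivative [(y - a)^(- s)] of the elementary term cancels the one given by [isd_Vfun]. *)
Lemma isd_Rfun s y a : 0 <= s -> s != 1 -> 0 < a < 1 -> a < y ->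
  is_derive a 1 (fun b => Rfun s (y - b) b) 0.
Proof.
move=> s0 s1 a01 ay; have x0 : 0 < y - a by rewrite subr_gt0.
have h0 : is_derive a 1 (fun b : R => y - b) (-1).
  by apply: is_derive_eq (isd_sub (isd_cst a y) (isd_id a)) _; rewrite sub0r.
have h1 := isd_comp (g := fun b => y - b) (isd_powR (1 - s) x0) h0.
have h := isd_add (isd_mul h1 (isd_cst a (s - 1)^-1)) (isd_Vfun s0 a01 ay).
apply: (is_derive_eq h); have -> : 1 - s - 1 = - s by ring.
by field; rewrite subr_eq0.
Qed.

Lemma Rfun_cst s y a b : 0 <= s -> s != 1 -> 0 < a < 1 -> a < y -> 0 < b < 1 -> b < y ->
  Rfun s (y - a) a = Rfun s (y - b) b.
Proof.
move=> s0 s1.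
wlog ab : a b / a <= b => [hw|].
  by move=> h1 h2 h3 h4; case/orP: (le_total a b) => ab; [exact: hw|apply/esym; exact: hw].
move=> a01 ay b01 by_.
have isd c : c \in `[a, b] -> is_derive c 1 (fun b => Rfun s (y - b) b) 0.
  rewrite in_itv /= => /andP[ac cb]; apply: isd_Rfun => //; last exact: le_lt_trans cb _.
  by case/andP: a01 b01 => a0 a1 /andP[b0 b1]; rewrite (lt_le_trans a0) ?(le_lt_trans cb).
have isd' (c : R) : c \in `]a, b[ -> is_derive c 1 (fun b : R => Rfun s (y - b) b) ((fun=> 0) c).
  by move=> cab; apply: isd; exact: subset_itv_oo_cc cab.
have cR : {within `[a, b], continuous (fun b : R => Rfun s (y - b) b)}.
  by apply: derivable_within_continuous => c cab; case: (isd c cab).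
have [c _] := MVT_segment ab isd' cR.
by rewrite mul0r => /eqP; rewrite subr_eq0 => /eqP.
Qed.

(** The common value of all [Rfun s (y - a) a]; [min 1 y / 2] is one admissible phase. *)
Definition Psi s y : R := let a := Num.min 1 y / 2 in Rfun s (y - a) a.

Lemma PsiE s y a : 0 <= s -> s != 1 -> 0 < y -> 0 < a < 1 -> a < y -> Psi s y = Rfun s (y - a) a.
Proof.
move=> s0 s1 y0 a01 ay; have m0 : 0 < Num.min 1 y by rewrite lt_min ltr01.
have [h1 h2] : Num.min 1 y <= 1 /\ Num.min 1 y <= y by rewrite !ge_min !lexx orbT.
by apply: Rfun_cst => //; [apply/andP; split|]; lra.
Qed.

Lemma Gden_double a t : Gden a t * Gden (a + 2^-1) t = Gden (2 * a) (2 * t) / 2.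
Proof.
rewrite /Gden.
have -> : 2 * pi * (a + 2^-1) = 2 * pi * a + pi by field.
have -> : 2 * pi * (2 * a) = (2 * pi * a) *+ 2 by rewrite mulr2n; ring.
have -> : 2 * pi * (2 * t) = 2 * pi * t + 2 * pi * t by ring.
rewrite cosDpi cos_mulr2n opprD !expRD.
have := expRxMexpNx_1 (2 * pi * t); set p := expR (2 * pi * t); set q := expR (- _) => pq.
apply: (mulIf (x := 4)) => //.
have -> : ((p + q) / 2 - cos (2 * pi * a)) * ((p + q) / 2 - - cos (2 * pi * a)) * 4 = p * p + 2 * (p * q) + q * q - 4 * cos (2 * pi * a) ^+ 2 by field.
by rewrite pq; field.
Qed.

(** Replacing [a] by [a + 1/2] changes [q] into [- q], and [2 q / (1 - q) - 2 q / (1 + q) = 4 q^2 /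
    (1 - q^2)], which is [2 g] at [(2 t, 2 a)]. This and [Gre_double] are the two parts of that
    identity. *)
Lemma Gim_double a t : 0 < a < 2^-1 -> Gim a t + Gim (a + 2^-1) t = 2 * Gim (2 * a) (2 * t).
Proof.
move=> a01; have D1 : Gden a t != 0 by rewrite gt_eqF// Gden_gt0//; lra.
have D2 : Gden (a + 2^-1) t != 0 by rewrite gt_eqF// Gden_gt0//; lra.
have D3 : Gden (2 * a) (2 * t) = 2 * (Gden a t * Gden (a + 2^-1) t) by rewrite Gden_double; field.
rewrite /Gim D3.
have -> : 2 * pi * (a + 2^-1) = 2 * pi * a + pi by field.
have -> : 2 * pi * (2 * a) = (2 * pi * a) *+ 2 by rewrite mulr2n; ring.
rewrite sinDpi sin_mulr2n.
have -> : sin (2 * pi * a) / Gden a t + - sin (2 * pi * a) / Gden (a + 2^-1) t =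
  sin (2 * pi * a) * (Gden (a + 2^-1) t - Gden a t) / (Gden a t * Gden (a + 2^-1) t) by field; rewrite D1 D2.
have -> : Gden (a + 2^-1) t - Gden a t = 2 * cos (2 * pi * a).
  rewrite /Gden; have -> : 2 * pi * (a + 2^-1) = 2 * pi * a + pi by field.
  by rewrite cosDpi; ring.
by field; rewrite ?D1 ?D2.
Qed.

Lemma Gre_double a t : 0 < a < 2^-1 -> Gre a t + Gre (a + 2^-1) t = 2 * Gre (2 * a) (2 * t).
Proof.
move=> a01; have D1 : Gden a t != 0 by rewrite gt_eqF// Gden_gt0//; lra.
have D2 : Gden (a + 2^-1) t != 0 by rewrite gt_eqF// Gden_gt0//; lra.
have D3 : Gden (2 * a) (2 * t) = 2 * (Gden a t * Gden (a + 2^-1) t) by rewrite Gden_double; field.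
rewrite /Gre D3.
have e1 : 2 * pi * (a + 2^-1) = 2 * pi * a + pi by field.
have -> : 2 * pi * (2 * a) = (2 * pi * a) *+ 2 by rewrite mulr2n; ring.
have -> : 2 * pi * (2 * t) = 2 * pi * t + 2 * pi * t by ring.
rewrite e1 cosDpi cos_mulr2n opprD expRD.
have E1 : Gden (a + 2^-1) t = Gden a t + 2 * cos (2 * pi * a) by rewrite /Gden e1 cosDpi; ring.
have E2 : Gden a t * 2 * expR (- (2 * pi * t)) = 1 + expR (- (2 * pi * t)) ^+ 2 - 2 * cos (2 * pi * a) * expR (- (2 * pi * t)).
  rewrite /Gden; have := expRxMexpNx_1 (2 * pi * t).
  set p := expR (2 * pi * t); set q := expR (- _); set c := cos _ => pq.
  have -> : ((p + q) / 2 - c) * 2 * q = p * q + q ^+ 2 - 2 * c * q by field.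
  by rewrite pq.
rewrite E1 in D2 *; set D := Gden a t in D1 D2 E2 *; set c := cos _ in D2 E2 *; set e := expR _ in E2 *.
have -> : (c - e) / D + (- c - e) / (D + 2 * c) = (2 * c ^+ 2 - 2 * e * c - D * 2 * e) / (D * (D + 2 * c)).
  by field; rewrite D1 D2.
by rewrite E2; field; rewrite D1 D2.
Qed.

(** Midpoints of the dyadic intervals: they stay inside [(0, 1)], a pair [a], [a + 1/2] of level
    [k + 1] doubles to one midpoint of level [k], and the last one, [1/2], makes [Gim] vanish. *)
Definition dyad k (j : nat) : R := (j%:R + 2^-1) / 2 ^+ k.

Lemma dyad_bounds k j : (j < 2 ^ k)%N -> 0 < dyad k j < 1.
Proof.
move=> jk; have k0 : 0 < 2 ^+ k :> R by rewrite exprn_gt0.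
rewrite divr_gt0//= ?ltr_wpDl ?invr_gt0//; rewrite ltr_pdivrMr// mul1r.
have : (j.+1)%:R <= 2 ^+ k :> R by rewrite -natrX ler_nat.
by rewrite -natr1; lra.
Qed.

Lemma dyad_sum (g : R -> R -> R) t k :
  (forall a t, 0 < a < 2^-1 -> g a t + g (a + 2^-1) t = 2 * g (2 * a) (2 * t)) ->
  \sum_(0 <= j < 2 ^ k) g (dyad k j) t = 2 ^+ k * g 2^-1 (2 ^+ k * t).
Proof.
move=> gE; elim: k t => [|k ih] t.
  by rewrite big_nat1 /dyad expr0 divr1 add0r !mul1r.
rewrite expnS mul2n -addnn (big_cat_nat _ (n := (2 ^ k)%N)) ?leq_addr//=.
rewrite -{2}[(2 ^ k)%N]add0n big_addn addnK -big_split /=.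
have k0 : 2 ^+ k != 0 :> R by rewrite expf_neq0.
have E j : (0 <= j < 2 ^ k)%N -> g (dyad k.+1 j) t + g (dyad k.+1 (j + 2 ^ k)) t = 2 * g (dyad k j) (2 * t).
  move=> /andP[_ jk]; have d2 : dyad k j = 2 * dyad k.+1 j by rewrite /dyad exprS; field.
  have -> : dyad k.+1 (j + 2 ^ k) = dyad k.+1 j + 2^-1.
    by rewrite /dyad natrD natrX exprS; field.
  by rewrite gE ?d2//; have := dyad_bounds jk; rewrite d2; lra.
rewrite (eq_big_nat _ _ E) -mulr_sumr ih !mulrA -exprS; congr (_ * g _ _).
by rewrite exprS; ring.
Qed.

End Psi.

(** * Averaging over dyadic phases and the Dirichlet series for real s > 1 *)

Section PsiSum.
Variable R : realType.
Local Notation mu := (@lebesgue_measure R).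
Local Notation H := (`]0%R, +oo[%classic : set R).
Implicit Types (x y t s a m r : R).
Variable s : R.
Hypothesis s1 : 1 < s.
Let s0 : 0 <= s. Proof. by rewrite ltW// (lt_trans ltr01). Qed.
Let sn1 : s != 1. Proof. by rewrite gt_eqF. Qed.

Lemma Gim_half t : Gim 2^-1 t = 0.
Proof. by rewrite /Gim mulrAC mulfV ?pnatr_eq0// mul1r sinpi mul0r. Qed.

Lemma Gre_half t : 0 <= t -> `|Gre 2^-1 t| <= 4 * expR (- (2 * pi * t)).
Proof.
move=> t0; have := @Gre_le _ 1 2^-1 _ _ t t0; rewrite divr1; apply; first by rewrite ltr01 lexx.
by rewrite subrr mulrAC mulfV ?pnatr_eq0// mul1r cospi lerN10.
Qed.

(** Mean value theorem in [x]; it controls the integral in [Psi_dyad_shift] for the increment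
    [h = 2^-k]. *)
Lemma Fim_Lipschitz y h t : 0 < y -> 0 <= h -> 0 <= t ->
  `|Fim s (y + h) t - Fim s y t| <= 2 * s / y * y `^ (- s) * h.
Proof.
move=> y0 h0 t0; have yh : y <= y + h by rewrite lerDl.
have pos c : y <= c -> 0 < c by exact: lt_le_trans.
have isd (c : R) : c \in `]y, (y + h)[ -> is_derive c 1 (fun u : R => Fim s u t) (dFim s c t).
  by rewrite in_itv /= => /andP[yc _]; apply: isd_Fim_l; apply: pos; exact: ltW.
have cF : {within `[y, (y + h)], continuous (fun u : R => Fim s u t)}.
  apply: derivable_within_continuous => c; rewrite in_itv /= => /andP[yc _].
  by case: (isd_Fim_l s t (pos c yc)).
have [c] := MVT_segment yh isd cF; rewrite in_itv /= => /andP[yc _] ->.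
rewrite [y + h]addrC addrK normrM (ger0_norm h0) ler_wpM2r//.
apply: dFim_le => //; first by rewrite y0 yc.
apply: le_trans (exp_Nlmod_le t (pos c yc) s0) _.
by rewrite !powRN lef_pV2 ?posrE ?powR_gt0 ?pos// ge0_ler_powR// ?nnegrE ltW// pos.
Qed.

Lemma expdom_measurable (f : R -> R) M : expdom f M -> measurable_fun H f.
Proof. by case. Qed.

Let dyad_term y k (j : nat) : 0 < y -> (j < 2 ^ k)%N ->
  mu.-integrable H (EFin \o Wfun s y (dyad R k j)).
Proof.
move=> y0 jk; have a01 := dyad_bounds R jk; have /andP[a0 a1] := a01.
have [m m01 /(_ (dyad R k j))] := cos_gap a0 (lexx _) a1; rewrite lexx => /(_ isT) am.
have yy : 0 < y <= y by rewrite y0 lexx.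
exact: expdom_integrable (Wfun_dom s0 yy m01 a01 am).
Qed.

(** [y + dyad R k j] is split with phase [dyad R k j], so that [x = y] is the same for all [j] and
    only the phase is averaged; at the surviving phase [1/2] the term with [Fre] drops out. *)
Lemma dyad_Psi y k : 0 < y ->
  expdom (fun t => Fim s y t * Gre 2^-1 (2 ^+ k * t)) (4 * y `^ (- s)) /\
  \sum_(0 <= j < 2 ^ k) Psi s (y + dyad R k j) = 2 ^+ k * (y `^ (1 - s) / (s - 1)
    + \int[mu]_(t in H) (Fim s y t * Gre 2^-1 (2 ^+ k * t))).
Proof.
move=> y0; have k1 : 1 <= 2 ^+ k :> R by rewrite exprn_ege1// ler1n.
have h01 : 0 < (2^-1 : R) < 1 by apply/andP; split; lra.
have dom : expdom (fun t => Fim s y t * Gre 2^-1 (2 ^+ k * t)) (4 * y `^ (- s)).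
  split.
    have h t : 0 < t -> is_derive t 1 (fun u => Fim s y u * Gre 2^-1 (2 ^+ k * u))
        (- dFre s y t * Gre 2^-1 (2 ^+ k * t) + Fim s y t * (- dGim 2^-1 (2 ^+ k * t) * 2 ^+ k)).
      move=> t0; apply: isd_mul; first exact: isd_Fim_r.
      exact: (isd_comp (g := fun u => 2 ^+ k * u) (isd_Gre_r (2 ^+ k * t) h01) (isd_lin t _)).
    exact: measurable_isd h.
  move=> t t0; have kt : 0 <= 2 ^+ k * t by rewrite mulr_ge0 ?ltW// exprn_gt0.
  have -> : 4 * y `^ (- s) * expR (- t) = y `^ (- s) * (4 * expR (- t)) by ring.
  apply: ler_norm2; first by apply: Fim_le; exact: exp_Nlmod_le.
  apply: le_trans (Gre_half kt) _; rewrite ler_wpM2l//.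
  apply: le_trans (expR_2pi_le kt) _; by rewrite ler_expR lerN2 ler_peMl// ltW.
split=> //.
have E j : (0 <= j < 2 ^ k)%N -> Psi s (y + dyad R k j) = y `^ (1 - s) / (s - 1) + Vfun s y (dyad R k j).
  move=> /andP[_ jk]; have a01 := dyad_bounds R jk; have /andP[a0 a1] := a01.
  have a2 : dyad R k j < y + dyad R k j by rewrite ltrDr.
  by rewrite (PsiE (a := dyad R k j)) ?addr_gt0// addrK.
rewrite (eq_big_nat _ _ E) big_split /= mulrDr; congr (_ + _).
  by rewrite sumr_const_nat subn0 -natrX mulr_natl.
(* Extension by zero for [j >= 2^k], since [Rintegral_sum] asks for integrability at every index. *)
pose g j t := if (j < 2 ^ k)%N then Wfun s y (dyad R k j) t else 0.
have ig j : mu.-integrable H (EFin \o g j).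
  case: (ltnP j (2 ^ k)) => jk.
    have -> : g j = Wfun s y (dyad R k j) by apply/funext => t; rewrite /g jk.
    exact: dyad_term.
  have -> : g j = cst 0 by apply/funext => t; rewrite /g ltnNge jk.
  exact: integrable0.
have E2 j : (0 <= j < 2 ^ k)%N -> Vfun s y (dyad R k j) = \int[mu]_(t in H) g j t.
  by move=> /andP[_ jk]; rewrite /Vfun; congr (Rintegral _ _ _); apply/funext => t; rewrite /g jk.
rewrite (eq_big_nat _ _ E2) -(Rintegral_sum _ (measurable_itv _) ig).2 -RintegralZl//.
  congr (Rintegral _ _ _); apply/funext => t.
  have E3 j : (0 <= j < 2 ^ k)%N -> g j t = Fim s y t * Gre (dyad R k j) t + Fre s y t * Gim (dyad R k j) t.
    by move=> /andP[_ jk]; rewrite /g jk addrC.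
  rewrite (eq_big_nat _ _ E3) big_split /= -!mulr_sumr.
  rewrite (dyad_sum t k (@Gre_double R)) (dyad_sum t k (@Gim_double R)) Gim_half; ring.
exact: expdom_integrable dom.
Qed.

(** Moving [x] by [2^-k] moves the midpoints by one place, so the difference of the two sums of
    [dyad_Psi] telescopes to its end terms, whose arguments differ by 1. *)
Lemma Psi_dyad_shift y k : 0 < y ->
  Psi s (y + 1 + 2^-1 / 2 ^+ k) - Psi s (y + 2^-1 / 2 ^+ k) =
  2 ^+ k * (((y + 2 ^- k) `^ (1 - s) - y `^ (1 - s)) / (s - 1)
    + \int[mu]_(t in H) ((Fim s (y + 2 ^- k) t - Fim s y t) * Gre 2^-1 (2 ^+ k * t))).
Proof.
move=> y0; have k0 : 0 < 2 ^- k :> R by rewrite invr_gt0 exprn_gt0.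
have yk0 : 0 < y + 2 ^- k by rewrite addr_gt0.
have [d1 e1] := dyad_Psi k y0; have [d2 e2] := dyad_Psi k yk0.
have -> : \int[mu]_(t in H) ((Fim s (y + 2 ^- k) t - Fim s y t) * Gre 2^-1 (2 ^+ k * t)) =
   \int[mu]_(t in H) (Fim s (y + 2 ^- k) t * Gre 2^-1 (2 ^+ k * t)) - \int[mu]_(t in H) (Fim s y t * Gre 2^-1 (2 ^+ k * t)).
  rewrite -RintegralB//; [|exact: expdom_integrable d2|exact: expdom_integrable d1].
  by congr (Rintegral _ _ _); apply/funext => t; rewrite mulrBl.
have -> : forall A B C D E : R, E * ((A - B) / (s - 1) + (C - D)) = E * (A / (s - 1) + C) - E * (B / (s - 1) + D).
  by move=> *; ring.
rewrite -e1 -e2.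
have E j : Psi s (y + 2 ^- k + dyad R k j) = Psi s (y + dyad R k j.+1).
  by congr Psi; rewrite /dyad -natr1; ring.
rewrite (eq_bigr _ (fun j _ => E j)) -sumrB telescope_sumr//.
congr (Psi s _ - Psi s _); rewrite /dyad ?add0r//.
by rewrite natrX; field; rewrite expf_neq0.
Qed.

Lemma cvg_pow2V : (2 ^- k : R) @[k --> \oo] --> 0.
Proof.
have h : (geometric 1 (2^-1 : R)) @ \oo --> 0.
  by apply: cvg_geometric; rewrite ger0_norm ?invr_ge0// invf_lt1 ?ltr1n.
by apply: cvg_trans h; apply: near_eq_cvg; near=> k; rewrite /geometric /= mul1r exprVn.
Unshelve. all: by end_near. Qed.

Lemma isd_quot (f : R -> R) y d (u : nat -> R) : is_derive y 1 f d -> (forall n, u n != 0) ->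
  u n @[n --> \oo] --> 0 -> (f (y + u n) - f y) / u n @[n --> \oo] --> d.
Proof.
move=> [fd <-] u0 uc.
have /cvgr_dnbhsP := fd.
move=> /(_ _ (conj u0 uc)).
apply: cvg_trans; apply: near_eq_cvg; near=> n.
by rewrite /GRing.scale /= mulr1 mulrC [u n + y]addrC.
Unshelve. all: by end_near. Qed.

(** The first part is a difference quotient, tending to the derivative [- y^(- s)]. In the second
    the factor [2^k] is compensated by the increment [2^-k] of [Fim], while [Gre 2^-1 (2^k t)] is at
    most [4 exp (- 2^k t)]. *)
Lemma Psi_shift_cvg y : 0 < y ->
  (Psi s (y + 1 + 2^-1 / 2 ^+ k) - Psi s (y + 2^-1 / 2 ^+ k)) @[k --> \oo] --> - y `^ (- s).
Proof.
move=> y0; under eq_fun do rewrite Psi_dyad_shift// mulrDr.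
rewrite -[X in nbhs X](addr0 (- y `^ (- s))); apply: cvgD.
  have h := isd_mul (isd_powR (1 - s) y0) (isd_cst y (s - 1)^-1).
  have p0 k : 2 ^- k != 0 :> R by rewrite invr_eq0 expf_neq0.
  have := isd_quot h p0 cvg_pow2V.
  have -> : (1 - s) * y `^ (1 - s - 1) * (s - 1)^-1 + y `^ (1 - s) * 0 = - y `^ (- s).
    have -> : 1 - s - 1 = - s by ring.
    by field; rewrite subr_eq0.
  apply: cvg_trans; apply: near_eq_cvg; near=> k.
  by rewrite -mulrBl mulrC invrK.
(* [8 = 2 * 4], with [2] from [Fim_Lipschitz] and [4] from [Gre_half]. *)
pose C := 8 * s / y * y `^ (- s).
have C0 : 0 <= C by rewrite /C !mulr_ge0 ?powR_ge0 ?invr_ge0 ?(ltW y0).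
pose f k t := 2 ^+ k * ((Fim s (y + 2 ^- k) t - Fim s y t) * Gre 2^-1 (2 ^+ k * t)).
have k1 k : 1 <= 2 ^+ k :> R by rewrite exprn_ege1// ler1n.
have k0 k : 0 < 2 ^+ k :> R by rewrite exprn_gt0.
have fle k t : 0 < t -> `|f k t| <= C * expR (- (2 ^+ k * t)).
  move=> t0; have kt : 0 <= 2 ^+ k * t by rewrite mulr_ge0 ?ltW.
  have ik0 : 0 <= 2 ^- k :> R by rewrite invr_ge0 ltW.
  have h1 := Fim_Lipschitz y0 ik0 (ltW t0).
  have h2 := le_trans (Gre_half kt) (ler_wpM2l (ler0n R 4) (expR_2pi_le kt)).
  rewrite /f normrM (ger0_norm (ltW (k0 k))).
  apply: le_trans (ler_wpM2l (ltW (k0 k)) (ler_norm2 h1 h2)) _.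
  by rewrite le_eqVlt; apply/orP; left; apply/eqP; rewrite /C; field; rewrite !gt_eqF ?y0 ?k0.
have dom k : expdom (f k) C.
  have yk : 0 < y + 2 ^- k by rewrite addr_gt0 ?invr_gt0.
  split; last first.
    move=> t t0; apply: le_trans (fle k t t0) _.
    by rewrite ler_wpM2l// ler_expR lerN2 ler_peMl// ltW.
  have m1 := expdom_measurable (dyad_Psi k yk).1; have m2 := expdom_measurable (dyad_Psi k y0).1.
  have -> : f k = fun t => 2 ^+ k * (Fim s (y + 2 ^- k) t * Gre 2^-1 (2 ^+ k * t) - Fim s y t * Gre 2^-1 (2 ^+ k * t)).
    by apply/funext => t; rewrite /f mulrBl.
  by apply: measurable_funM; [exact: measurable_cst | exact: measurable_funB].
have E k : 2 ^+ k * \int[mu]_(t in H) ((Fim s (y + 2 ^- k) t - Fim s y t) * Gre 2^-1 (2 ^+ k * t)) = \int[mu]_(t in H) f k t.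
  rewrite -RintegralZl//; have := @integrableZl _ _ _ mu H (measurable_itv _) (2 ^- k) _ (expdom_integrable (dom k)).
  by congr (_.-integrable _ _); apply/funext => t; rewrite /= /f -EFinM mulKf// gt_eqF.
under eq_fun do rewrite E.
suff : \int[mu]_(t in H) f k t @[k --> \oo] --> \int[mu]_(t in H) (cst 0 t).
  by rewrite (@Rintegral_cst _ _ _ mu H (measurable_itv _)) mul0r.
apply: (expdom_cvg dom) => t t0.
apply/cvgr0Pnorm_le => e e0; have h : C / t * 2 ^- k @[k --> \oo] --> 0.
  rewrite -[X in _ --> X](mulr0 (C / t)); apply: cvgM; [exact: cvg_cst|exact: cvg_pow2V].
near=> k; apply: (@le_trans _ _ (C / t * 2 ^- k)); last by near: k; exact: cvgr_le h _ e0.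
apply: le_trans (fle k t t0) _; rewrite -mulrA ler_wpM2l// expRN -invfM lef_pV2 ?posrE ?expR_gt0 ?mulr_gt0//.
by rewrite mulrC; apply: le_trans (expR_ge1Dx _); rewrite lerDr.
Unshelve. all: by end_near. Qed.

(** At phase [1/2] the cosine is [-1] and the gap may be taken [m = 1], whence [100 = 2 * 50]. *)
Lemma Vfun_half_le x : 0 < x -> `|Vfun s x 2^-1| <= 100 * x `^ (- s).
Proof.
move=> x0; have h01 : 0 < (2^-1 : R) < 1 by apply/andP; split; lra.
have -> : 100 * x `^ (- s) = 2 * x `^ (- s) * (50 / 1 ^+ 2) by rewrite expr1n divr1; ring.
apply: expdom_le; apply: Wfun_dom => //; [by rewrite x0 lexx|by rewrite ltr01 lexx|].
by rewrite subrr mulrAC mulfV ?pnatr_eq0// mul1r cospi lerN10.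
Qed.

Lemma powRN_small (p e : R) : 0 < p -> 0 < e -> exists A : R, forall z, 0 < z -> A <= z -> z `^ (- p) <= e.
Proof.
move=> p0 e0; exists (e^-1 `^ p^-1) => z z0 Az; rewrite powRN -[leRHS]invrK.
rewrite lef_pV2 ?posrE ?powR_gt0 ?invr_gt0//.
have -> : e^-1 = (e^-1 `^ p^-1) `^ p by rewrite -powRrM mulVf ?gt_eqF// powRr1// invr_ge0 ltW.
by apply: ge0_ler_powR => //; rewrite ?nnegrE ?powR_ge0 ?(ltW p0) ?(ltW z0).
Qed.

(** With phase [1/2], both parts of [Rfun] are at most a multiple of [x^(1 - s)] for [x >= 1], and
    [s > 1]. *)
Lemma Psi_cvg0 y : 0 < y -> Psi s (y + n%:R) @[n --> \oo] --> 0.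
Proof.
move=> y0; have h01 : 0 < (2^-1 : R) < 1 by apply/andP; split; lra.
pose K := (s - 1)^-1 + 100; have K0 : 0 < K by rewrite ltr_wpDl ?invr_ge0 ?subr_ge0// ltW.
have bd z : 1 <= z -> `|Psi s (z + 2^-1)| <= K * z `^ (- (s - 1)).
  move=> z1; have z0 : 0 < z by exact: lt_le_trans z1.
  have zh : 2^-1 < z + 2^-1 by rewrite ltrDr.
  have zp : 0 < z + 2^-1 by rewrite addr_gt0// invr_gt0.
  rewrite (PsiE s0 sn1 zp h01 zh) addrK /Rfun mulrDl.
  apply: le_trans (ler_normD _ _) _; apply: lerD.
    by rewrite ger0_norm ?divr_ge0 ?powR_ge0 ?subr_ge0 ?(ltW s1)// opprB mulrC.
  apply: le_trans (Vfun_half_le z0) _; rewrite ler_wpM2l// opprB.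
  by rewrite ler_powR//; lra.
have q0 : 0 < s - 1 by rewrite subr_gt0.
apply/cvgr0Pnorm_le => e e0; have eK : 0 < e / K by rewrite divr_gt0.
have [A AP] := powRN_small q0 eK.
near=> n; have -> : y + n%:R = (y + n%:R - 2^-1) + 2^-1 by rewrite subrK.
have nA : Num.max 2 (A + 1) <= n%:R by near: n; exact: nbhs_infty_ger.
move: nA; rewrite ge_max => /andP[n2 nA].
have z1 : 1 <= y + n%:R - 2^-1 by lra.
apply: le_trans (bd _ z1) _; rewrite mulrC -ler_pdivlMr//; apply: AP; lra.
Unshelve. all: by end_near. Qed.

Lemma Vfun_continuous x a (u : nat -> R) : 0 < x -> 0 < a < 1 -> (forall n, 0 <= u n) ->
  u n @[n --> \oo] --> 0 -> Vfun s (x + u n) a @[n --> \oo] --> Vfun s x a.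
Proof.
move=> x0 a01 u0 uc; have /andP[a0 a1] := a01.
have [m m01 /(_ a)] := cos_gap a0 (lexx _) a1; rewrite lexx => /(_ isT) am.
have xu n : 0 < x <= x + u n by rewrite x0 lerDl u0.
have ax n : 0 < x + u n by case/andP: (xu n) => h1; exact: lt_le_trans.
have ux : x + u n @[n --> \oo] --> x.
  by rewrite -[X in _ --> X](addr0 x); apply: cvgD => //; exact: cvg_cst.
apply: expdom_cvg => [n|t t0]; first exact: (Wfun_dom s0 (xu n) m01 a01 am).
apply: cvgD; apply: cvgM; try exact: cvg_cst.
  exact: (cvg_comp _ _ ux (isd_continuous (isd_Fre_l s t x0))).
exact: (cvg_comp _ _ ux (isd_continuous (isd_Fim_l s t x0))).
Qed.

(** One phase [a] is admissible for [y] and for all [y + u n], so only [x] varies. *)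
Lemma Psi_continuous y (u : nat -> R) : 0 < y -> (forall n, 0 <= u n) ->
  u n @[n --> \oo] --> 0 -> Psi s (y + u n) @[n --> \oo] --> Psi s y.
Proof.
move=> y0 u0 uc; pose a := Num.min 1 y / 2.
have m0 : 0 < Num.min 1 y by rewrite lt_min ltr01.
have [h1 h2] : Num.min 1 y <= 1 /\ Num.min 1 y <= y by rewrite !ge_min !lexx orbT.
have a01 : 0 < a < 1 by apply/andP; split; rewrite /a; lra.
have ay : a < y by rewrite /a; lra.
have x0 : 0 < y - a by rewrite subr_gt0.
rewrite (PsiE s0 sn1 y0 a01 ay).
have E n : Psi s (y + u n) = Rfun s (y - a + u n) a.
  have yu0 : 0 < y + u n by rewrite ltr_wpDr.
  have ayu : a < y + u n by rewrite ltr_wpDr.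
  rewrite (PsiE s0 sn1 yu0 a01 ayu).
  by rewrite addrAC.
under eq_fun do rewrite E.
have ux : y - a + u n @[n --> \oo] --> y - a.
  by rewrite -[X in _ --> X](addr0 (y - a)); apply: cvgD => //; exact: cvg_cst.
apply: cvgD; last exact: Vfun_continuous.
apply: cvgM; last exact: cvg_cst.
exact: (cvg_comp _ _ ux (isd_continuous (isd_powR (1 - s) x0))).
Qed.

Lemma Psi_shift y : 0 < y -> Psi s y = y `^ (- s) + Psi s (y + 1).
Proof.
move=> y0; pose u k : R := 2^-1 / 2 ^+ k.
have u0 k : 0 <= u k by rewrite /u divr_ge0 ?invr_ge0// exprn_ge0.
have uc : u k @[k --> \oo] --> 0.
  by rewrite -[X in _ --> X](mulr0 2^-1); apply: cvgM; [exact: cvg_cst|exact: cvg_pow2V].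
have h1 := Psi_continuous (addr_gt0 y0 ltr01) u0 uc.
have h2 := Psi_continuous y0 u0 uc.
have E : Psi s (y + 1) - Psi s y = - y `^ (- s).
  exact: (cvg_unique (@norm_hausdorff _ _) (cvgB h1 h2) (Psi_shift_cvg y0)).
lra.
Qed.

(** Telescoping of [Psi_shift]; the remainder [Psi s (y + n%:R)] tends to [0]. *)
Lemma Psi_series y : 0 < y -> series (fun n => (y + n%:R) `^ (- s)) @ \oo --> Psi s y.
Proof.
move=> y0.
have E n : series (fun n => (y + n%:R) `^ (- s)) n = Psi s y - Psi s (y + n%:R).
  elim: n => [|n ih]; first by rewrite /series /= big_geq// addr0 subrr.
  rewrite /series /= big_nat_recr//=; rewrite /series /= in ih; rewrite ih.
  have yn : 0 < y + n%:R by rewrite ltr_wpDr.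
  have -> : y + n.+1%:R = y + n%:R + 1 by rewrite -natr1 addrA.
  by rewrite (Psi_shift yn); ring.
have c : Psi s y - Psi s (y + n%:R) @[n --> \oo] --> Psi s y.
  by rewrite -[X in _ --> X](subr0 (Psi s y)); apply: cvgB; [exact: cvg_cst|exact: Psi_cvg0].
by rewrite (eq_cvg _ _ E).
Qed.

End PsiSum.

(** * Continuation of the Hurwitz zeta function *)

Section HurwitzSeries.
Variable R : realType.
Local Notation mu := (@lebesgue_measure R).
Local Notation H := (`]0%R, +oo[%classic : set R).
Implicit Types (x y t s a m : R) (z h : R[i]).

Lemma measurable_isd0 (f df : R -> R) : (forall t : R, is_derive t 1 f (df t)) -> measurable_fun H f.
Proof. by move=> fd; apply: measurable_isd => t _; exact: fd. Qed.

(** [- log (x - i t)], so that [exp (s * Lla x t)] is [(x - i t)^(- s)]. *)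
Definition Lla x t : R[i] := (- lmod x t) +i* larg x t.
Definition Gfun a t : R[i] := Gre a t +i* Gim a t.

Lemma Lla_measurable x : 0 < x -> cmeasurable H (Lla x).
Proof.
move=> x0; split; last by apply: (measurable_isd0 (f := fun t => larg x t)) => t; exact: isd_larg_r.
apply: measurableT_comp => //.
by apply: (measurable_isd0 (f := fun t => lmod x t)) => t; exact: isd_lmod_r.
Qed.

Lemma Gfun_measurable a : 0 < a < 1 -> cmeasurable H (Gfun a).
Proof.
move=> a01; split.
  exact: (measurable_isd0 (f := fun t => Gre a t) (fun t => isd_Gre_r t a01)).
exact: (measurable_isd0 (f := fun t => Gim a t) (fun t => isd_Gim_r t a01)).
Qed.

Lemma Wfun_cexp s x a t : complex.Im (cexp (s%:C * Lla x t) * Gfun a t) = Wfun s x a t.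
Proof.
have hr : complex.Re (s%:C * Lla x t) = - s * lmod x t by rewrite /=; ring.
have hi : complex.Im (s%:C * Lla x t) = s * larg x t by rewrite /=; ring.
by rewrite /cexp hr hi /Wfun /Fre /Fim /=; ring.
Qed.

Definition Vcoef x a k : R := laplace_coef H (Lla x) (Gfun a) k.

(** For every [rho] the factor [exp (rho * |log (x - i t)|)] grows polynomially in [t]; hence the
    Taylor series of [V] converges everywhere. *)
Lemma Vcoef_dom x a (rho : R) : 0 < x -> 0 < a < 1 -> 0 < rho -> exists2 G : R -> R,
  mu.-integrable H (EFin \o G) &
  forall t, H t -> expR (rho * cabs (Lla x t)) * cabs (Gfun a t) <= G t.
Proof.
move=> x0 a01 r0; have /andP[a0 a1] := a01.
have [m m01 /(_ a)] := cos_gap a0 (lexx _) a1; rewrite lexx => /(_ isT) am.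
have [n rn] : exists n : nat, rho <= n%:R.
  by exists (Num.truncn rho).+1; rewrite ltW// truncnS_gt.
pose c := x + x^-1; have c0 : 0 <= c by rewrite /c addr_ge0 ?invr_ge0 ?(ltW x0).
pose K := expR (rho * (pi / 2)) * (6 / m) * modbound n c.
exists (fun t => K * expR (- t)).
  exact: (@integrableZl _ _ _ mu H (measurable_itv _) K _ (@integrable_expRN R)).
move=> t; rewrite /= in_itv /= andbT => t0.
have m0 : 0 < m by case/andP: m01.
have hg : cabs (Gfun a t) <= 6 / m * expR (- (2 * pi * t)).
  apply: le_trans (cabs_le_ReIm _) _; have := Gre_le m01 am (ltW t0); have := Gim_le m01 am t.
  have -> : 6 / m * expR (- (2 * pi * t)) = 2 / m * expR (- (2 * pi * t)) + 4 / m * expR (- (2 * pi * t)) by ring.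
  by rewrite /Gfun /=; lra.
have hl : expR (rho * cabs (Lla x t)) <= expR (rho * (pi / 2)) * (1 + c + t) ^+ n.
  apply: (@le_trans _ _ (expR (rho * (pi / 2)) * expR (rho * `|lmod x t|))).
    rewrite -expRD ler_expR -mulrDr ler_wpM2l ?(ltW r0)//.
    apply: le_trans (cabs_le_ReIm _) _; rewrite /Lla /= normrN addrC lerD2r.
    by rewrite ler_norml !ltW ?atan_gtNpi2 ?atan_ltpi2.
  rewrite ler_wpM2l ?expR_ge0//; apply: exp_lmod_le => //; first exact: ltW.
  by rewrite ltW.
apply: le_trans (ler_pM (expR_ge0 _) (cabs_ge0 _) hl hg) _.
have := poly_exp_le n c0 (ltW t0); set P := (1 + c + t) ^+ n; set e := expR (- (2 * pi * t)) => h.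
have -> : expR (rho * (pi / 2)) * P * (6 / m * e) = expR (rho * (pi / 2)) * (6 / m) * (P * e) by ring.
by rewrite /K -[leRHS]mulrA ler_wpM2l// mulr_ge0 ?expR_ge0// divr_ge0// ltW.
Qed.

Lemma Vcoef_bound x a rho : 0 < x -> 0 < a < 1 -> 0 < rho ->
  exists M, forall k, `|Vcoef x a k| * rho ^+ k <= M.
Proof.
move=> x0 a01 r0; have [G iG Gle] := Vcoef_dom x0 a01 r0.
exists (\int[mu]_(t in H) G t) => k.
exact: (laplace_coef_bound (measurable_itv _) r0 (Lla_measurable x0) (Gfun_measurable a01) iG Gle).
Qed.

Lemma Vcoef_cvg x a s : 0 < x -> 0 < a < 1 ->
  series (fun k => Vcoef x a k * s ^+ k) @ \oo --> Vfun s x a.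
Proof.
move=> x0 a01; have r0 : 0 < `|s| + 1 by rewrite ltr_wpDl.
have [G iG Gle] := Vcoef_dom x0 a01 r0.
have sr : `|s| <= `|s| + 1 by rewrite lerDl.
have := laplace_cvg (measurable_itv _) r0 (Lla_measurable x0) (Gfun_measurable a01) iG Gle sr.
by under eq_Rintegral => t _ do rewrite Wfun_cexp.
Qed.

Definition Vent x a z : R[i] := xget 0 [set l | cvgC (series (fun k => (Vcoef x a k)%:C * z ^+ k)) l].

Lemma PS_Vent x a r : 0 < x -> 0 < a < 1 -> 0 < r -> PS (Vent x a) 0 (fun k => (Vcoef x a k)%:C) r.
Proof.
move=> x0 a01 r0; split=> //.
  by have [M MP] := Vcoef_bound x0 a01 r0; exists M => k; rewrite cabs_real.
move=> h hr; rewrite add0r.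
have [M MP] := Vcoef_bound x0 a01 r0.
have MP' k : cabs (Vcoef x a k)%:C * r ^+ k <= M by rewrite cabs_real.
have hh : 0 <= cabs h < r by rewrite cabs_ge0.
have [B BP] := geometric_coef_bound r0 hh MP'.
have [|l hl _] := @abs_seriesC R (fun k => (Vcoef x a k)%:C * h ^+ k) B.
  by move=> n; apply: le_trans (BP n); rewrite le_eqVlt; apply/orP; left; apply/eqP;
     apply: eq_bigr => k _; rewrite cabsM cabsX.
by rewrite /Vent; case: xgetP => [l' _ //|/(_ l)].
Qed.

Lemma Vent_real x a s : 0 < x -> 0 < a < 1 -> Vent x a s%:C = (Vfun s x a)%:C.
Proof.
move=> x0 a01; have r0 : 0 < `|s| + 1 by rewrite ltr_wpDl.
have [_ _ /(_ s%:C)] := PS_Vent x0 a01 r0; rewrite cabs_real ltrDl ltr01 => /(_ isT).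
rewrite add0r => h; apply: cvgC_unique h _.
have := cvgC_real (@Vcoef_cvg x a s x0 a01); congr cvgC; apply/funext => n.
by rewrite /series /= rmorph_sum; apply: eq_bigr => k _; rewrite rmorphM rmorphXn.
Qed.

Lemma PS_Vent_at x a z r : 0 < x -> 0 < a < 1 -> 0 < r -> exists b, PS (Vent x a) z b r.
Proof.
move=> x0 a01 r0; have R0 : 0 < cabs z + r + 1 by rewrite addr_gt0// ltr_wpDl ?cabs_ge0.
have dr : cabs z + r < cabs z + r + 1 by rewrite ltrDl.
have [b _] := PS_recenter (PS_Vent x0 a01 R0) r0 dr.
by rewrite add0r; exists b.
Qed.

(** The continued [R] times [z - 1]. Identities between zeta functions are proved for such entire
    functions by [entire_eq], before division by [z - 1]. *)
Definition Ehur x a z : R[i] := cpow x (1 - z) + (z - 1) * Vent x a z.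

Lemma PS_Ehur x a z r : 0 < x -> 0 < a < 1 -> 0 < r -> exists b, PS (Ehur x a) z b r.
Proof.
move=> x0 a01 r0; have r1 : 0 < r + 1 by rewrite ltr_wpDl// ltW.
have [b hb] := PS_Vent_at z x0 a01 r1.
have rr : 0 < r < r + 1 by rewrite r0 ltrDl ltr01.
have h1 := PS_add (PS_cpowN x z r0) (PS_cst 0 z r0).
have h2 := PS_mul rr (PS_add (PS_id z r1) (PS_cst (-1) z r1)) hb.
have h3 := PS_add (PS_scale (x%:C) (PS_cpowN x z r0)) h2.
eexists; apply: (PS_ext _ h3) => h _ /=.
by rewrite /Ehur cpowD -[1]/(1%:R) cpow_nat// expr1.
Qed.

Lemma Ehur1 x a : Ehur x a 1 = 1.
Proof. by rewrite /Ehur subrr mul0r addr0 cpow0. Qed.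

Lemma Ehur_real x a s : 0 < x -> 0 < a < 1 -> s != 1 -> Ehur x a s%:C / (s%:C - 1) = (Rfun s x a)%:C.
Proof.
move=> x0 a01 s1; rewrite /Ehur Vent_real//.
have -> : 1 - s%:C = (1 - s)%:C :> R[i] by rewrite rmorphB rmorph1.
have E : s%:C - 1 = (s - 1)%:C :> R[i] by rewrite rmorphB rmorph1.
rewrite cpow_real// E -fmorphV -!rmorphM -rmorphD -rmorphM; congr (_%:C).
by rewrite /Rfun mulrDl mulrAC mulfV ?subr_eq0// mul1r.
Qed.

Definition Zhur x a z : R[i] := Ehur x a z / (z - 1).

Lemma Zhur_PS x a z : 0 < x -> 0 < a < 1 -> z != 1 ->
  forall r, 0 < r < cabs (1 - z) -> exists b, PS (Zhur x a) z b r.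
Proof.
move=> x0 a01 z1 r /andP[r0 rz]; have z0 : 0 < cabs (1 - z) by exact: lt_trans rz.
have [b hb] := PS_Ehur z x0 a01 z0.
have rr : 0 < r < cabs (1 - z) by rewrite r0.
have n1 : 1 != z by rewrite eq_sym.
by eexists; exact: (PS_mul rr hb (PS_inv n1)).
Qed.

Lemma Zhur_meromorphic x a : 0 < x -> 0 < a < 1 -> meromorphic (Zhur x a).
Proof.
move=> x0 a01 z; have [->|z1] := eqVneq z 1.
  right; exists 1%N, (Ehur x a); split => //.
  - by apply/analytic_PS; have [b hb] := PS_Ehur 1 x0 a01 ltr01; exists b, 1.
  - by rewrite Ehur1 oner_neq0.
  - by apply/dnearCP; exists 1 => // h _ _; rewrite expr1.
left; apply/analytic_PS; have z0 : 0 < cabs (1 - z) by rewrite cabs_gt0 subr_eq0 eq_sym.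
have [|b hb] := @Zhur_PS x a z x0 a01 z1 (cabs (1 - z) / 2).
  by apply/andP; split; lra.
by exists b, (cabs (1 - z) / 2).
Qed.

End HurwitzSeries.

(** * The Dirichlet series at complex arguments *)

Section Dirichlet.
Variable R : realType.
Implicit Types (x y t s a c : R) (z h : R[i]).

Lemma Rfun_series s y a : 1 < s -> 0 < y -> 0 < a < 1 -> a < y ->
  series (fun n => (y + n%:R) `^ (- s)) @ \oo --> Rfun s (y - a) a.
Proof.
move=> s1 y0 a01 ay; rewrite -PsiE ?gt_eqF//; first exact: Psi_series.
by rewrite ltW// (lt_trans ltr01).
Qed.

Lemma Rfun_partial_le s y a n : 1 < s -> 0 < y -> 0 < a < 1 -> a < y ->
  series (fun n => (y + n%:R) `^ (- s)) n <= Rfun s (y - a) a.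
Proof.
move=> s1 y0 a01 ay; have h := Rfun_series s1 y0 a01 ay.
rewrite -(cvg_lim (@norm_hausdorff _ _) h); apply: nondecreasing_cvgn_le; last by apply/cvg_ex; eexists; exact: h.
apply/nondecreasing_seqP => k; rewrite /series /= big_nat_recr//= lerDl powR_ge0.
by [].
Qed.

(** The [k]-th term in the Taylor expansion of [(n + y)^(- s)] at [s = c], for the increment [h]. *)
Definition dterm c y (h : R[i]) n k : R[i] :=
  cpow (n%:R + y) (- c%:C) * ((- (ln (n%:R + y))%:C * h) ^+ k / k`!%:R).

Lemma dterm_cvg c y h n : series (dterm c y h n) ~> cpow (n%:R + y) (- (c%:C + h)).
Proof.
have := series_scale (cpow (n%:R + y) (- c%:C)) (cexp_cvg (- (ln (n%:R + y))%:C * h)).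
have -> // : cpow (n%:R + y) (- c%:C) * cexp (- (ln (n%:R + y))%:C * h) = cpow (n%:R + y) (- (c%:C + h)).
by rewrite opprD cpowD /cpow; congr (_ * cexp _); ring.
Qed.

(** [|ln u|] is [ln u] or [- ln u]. The double series of [dterm] is thereby bounded by the sums of
    the Dirichlet series at [c - rho] and [c + rho]. *)
Lemma powR_exp_abs_le (u c rho : R) : 0 < u -> 0 <= rho ->
  u `^ (- c) * expR (rho * `|ln u|) <= u `^ (- (c - rho)) + u `^ (- (c + rho)).
Proof.
move=> u0 r0; rewrite /powR gt_eqF// -expRD.
case: (lerP 0 (ln u)) => hl.
  apply: ler_wpDr; first exact: expR_ge0.
  by rewrite le_eqVlt ger0_norm//; apply/orP; left; apply/eqP; congr expR; ring.
apply: ler_wpDl; first exact: expR_ge0.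
by rewrite le_eqVlt ltr0_norm//; apply/orP; left; apply/eqP; congr expR; ring.
Qed.

Lemma dterm_bound c y rho : 0 < y -> 0 <= rho -> 1 < c - rho ->
  exists B, forall h, cabs h <= rho -> forall n m,
    \sum_(0 <= i < n) \sum_(0 <= j < m) cabs (dterm c y h i j) <= B.
Proof.
move=> y0 r0 cr; have cr' : 1 < c + rho by lra.
pose a : R := Num.min 1 y / 2.
have m0 : 0 < Num.min 1 y by rewrite lt_min ltr01.
have [h1 h2] : Num.min 1 y <= 1 /\ Num.min 1 y <= y by rewrite !ge_min !lexx orbT.
have a01 : 0 < a < 1 by apply/andP; split; rewrite /a; lra.
have ay : a < y by rewrite /a; lra.
exists (Rfun (c - rho) (y - a) a + Rfun (c + rho) (y - a) a) => h hr n m.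
have b1 := Rfun_partial_le n cr y0 a01 ay; have b2 := Rfun_partial_le n cr' y0 a01 ay.
apply: le_trans (lerD b1 b2); rewrite /series /= -big_split /=; apply: ler_sum => i _.
have u0 : 0 < y + i%:R by rewrite ltr_wpDr.
apply: le_trans (powR_exp_abs_le c u0 r0); rewrite /dterm.
under eq_bigr do rewrite cabsM cabs_fact_term; rewrite -mulr_sumr [i%:R + y]addrC.
rewrite cabs_cpow// ReN /= ler_wpM2l ?powR_ge0//.
apply: le_trans (exp_series_le _ (cabs_ge0 _)) _.
by rewrite ler_expR cabsM cabsN cabs_real mulrC ler_wpM2r.
Qed.

Lemma sqr_cabs z : cabs z ^+ 2 = complex.Re z ^+ 2 + complex.Im z ^+ 2.
Proof. by case: z => u v; rewrite /cabs /= sqr_sqrtr// addr_ge0 ?sqr_ge0. Qed.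

(** Around a large real [c] both sides are power series in discs that contain [z], and they agree at
    the real points to the right of [c] by [Rfun_series]. *)
Lemma Zhur_series y a z : 0 < y -> 0 < a < 1 -> a < y -> 1 < complex.Re z ->
  series (fun n => cpow (n%:R + y) (- z)) ~> Zhur (y - a) a z.
Proof.
move=> y0 a01 ay z1; have x0 : 0 < y - a by rewrite subr_gt0.
pose s := complex.Re z; pose t := complex.Im z.
(* [|z - c| < c - 1] amounts to [s^2 + t^2 - 1 < 2 c (s - 1)], which holds for this [c]. *)
pose c := (s ^+ 2 + t ^+ 2) / (2 * (s - 1)) + 1.
have s1 : 0 < s - 1 by rewrite subr_gt0.
have c1 : 1 < c.
  rewrite /c ltrDr divr_gt0 ?mulr_gt0// ltr_wpDr ?sqr_ge0// exprn_gt0//.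
  by rewrite (lt_trans ltr01).
pose h := z - c%:C.
have hc : cabs h < c - 1.
  rewrite -(@ltr_pXn2r _ 2) ?nnegrE ?cabs_ge0 ?subr_ge0 ?(ltW c1)// sqr_cabs.
  have -> : complex.Re h = s - c by rewrite /h ReD ReN.
  have -> : complex.Im h = t by rewrite /h ImD ImN /= oppr0 addr0.
  have : 2 * c * (s - 1) = s ^+ 2 + t ^+ 2 + 2 * (s - 1) by rewrite /c; field; rewrite gt_eqF.
  nra.
pose base n k : R[i] := cpow (n%:R + y) (- c%:C) * ((- (ln (n%:R + y))%:C) ^+ k / k`!%:R).
have dE g n k : dterm c y g n k = base n k * g ^+ k.
  by rewrite /dterm /base exprMn; ring.
have dser g : cabs g < c - 1 -> exists r col l, [/\ forall n, series (dterm c y g n) ~> r n,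
    forall k, series (fun n => dterm c y g n k) ~> col k, series r ~> l & series col ~> l].
  move=> gc; have g1 : 1 < c - cabs g by lra.
  have [B BP] := dterm_bound y0 (cabs_ge0 g) g1.
  exact: double_series (BP g (lexx _)).
have r1 : 0 < (c - 1) / 2 by rewrite divr_gt0// subr_gt0.
(* A single nonzero increment yields the coefficients [A k]: column sums at [g0], divided by
   [g0^k]. *)
pose g0 : R[i] := ((c - 1) / 2)%:C.
have g0n : g0 != 0 by rewrite -cabs_gt0 cabs_real ger0_norm ?ltW.
have [|r0 [col0 [_ [_ col0P _ _]]]] := dser g0; first by rewrite cabs_real ger0_norm ?ltW//; lra.
pose A k := col0 k / g0 ^+ k.
have AP k : series (base ^~ k) ~> A k.
  have := series_scale (g0 ^+ k)^-1 (col0P k); rewrite mulrC; congr cvgC; apply/funext => n.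
  by apply: eq_bigr => i _; rewrite dE mulrC mulfK// expf_neq0.
have key g : cabs g < c - 1 -> exists2 l, series (fun n => cpow (n%:R + y) (- (c%:C + g))) ~> l &
    series (fun k => A k * g ^+ k) ~> l.
  move=> gc; have [r [col [l [rP colP rl cl]]]] := dser g gc; exists l.
    have <- // : r = fun n => cpow (n%:R + y) (- (c%:C + g)).
    by apply/funext => n; apply: cvgC_unique (rP n) (dterm_cvg c y g n).
  have <- // : col = fun k => A k * g ^+ k.
  apply/funext => k; apply: cvgC_unique (colP k) _; rewrite mulrC.
  have := series_scale (g ^+ k) (AP k); congr cvgC; apply/funext => n.
  by apply: eq_bigr => i _; rewrite dE mulrC.
pose F w : R[i] := xget 0 [set l | series (fun n => cpow (n%:R + y) (- w)) ~> l].
have FP w l : series (fun n => cpow (n%:R + y) (- w)) ~> l -> F w = l.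
  move=> wl; rewrite /F; case: xgetP => [l' _ hl|/(_ l)//]; exact: cvgC_unique hl wl.
have cm1 : 0 < c - 1 by rewrite subr_gt0.
have PF : PS F c%:C A ((c - 1) / 2).
  apply: PS_of_cvg => // g /key [l lP Al]; by rewrite (FP _ _ lP).
have cn1 : c%:C != 1 :> R[i] by apply/eqP => /(congr1 (@complex.Re R)) /= E; move: c1; rewrite E ltxx.
have c1E : cabs (1 - c%:C) = c - 1.
  by rewrite -(rmorph1 (real_complex R)) -rmorphB cabs_real ltr0_norm ?subr_lt0// opprB.
pose rho := (cabs h + (c - 1)) / 2.
have hr : cabs h < rho by rewrite /rho; lra.
have [|b hb] := @Zhur_PS R (y - a) a c%:C x0 a01 cn1 rho.
  by rewrite c1E /rho; apply/andP; split; have := cabs_ge0 h; lra.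
have AB : A = b.
  apply: (PS_unique PF hb cm1) => u /andP[u0 _].
  have cu : 1 < c + u by lra.
  have := cvgC_real (Rfun_series cu y0 a01 ay).
  rewrite -rmorphD /Zhur Ehur_real ?gt_eqF// => hs; apply: FP; move: hs; congr cvgC; apply/funext => n.
  rewrite /series /= rmorph_sum; apply: eq_bigr => k _; rewrite -rmorphN cpow_real ?[y + _]addrC//.
  by rewrite ltr_wpDl.
have [l lP Al] := key h hc; have zE : c%:C + h = z by rewrite /h addrC subrK.
rewrite zE in lP; have [_ _ /(_ h hr)] := hb; rewrite -AB zE => hz.
by rewrite (cvgC_unique hz Al).
Qed.

(** The centre [2] lies to the right of the pole, so that the points of [(2, 3)], where the
    functions are compared, belong to the domain of the Dirichlet series; all radii being allowed,
    equality reaches every [z]. *)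
Lemma entire_eq (f g : R[i] -> R[i]) z :
  (forall r : R, 0 < r -> exists b, PS f 2%:C b r) ->
  (forall r : R, 0 < r -> exists b, PS g 2%:C b r) ->
  (forall u : R, 0 < u < 1 -> f (2 + u)%:C = g (2 + u)%:C) -> f z = g z.
Proof.
move=> hf hg fg; pose r : R := cabs (z - 2%:C) + 1; have r0 : 0 < r by rewrite ltr_wpDl ?cabs_ge0.
have [A hA] := hf r r0; have [B hB] := hg r r0.
have AB : A = B.
  apply: (PS_unique hA hB ltr01) => u u01.
  have -> : 2%:C + u%:C = (2 + u)%:C by exact: (esym (rmorphD (real_complex R) 2 u)).
  exact: fg.
have zr : cabs (z - 2%:C) < r by rewrite /r ltrDl.
have [_ _ /(_ _ zr)] := hA; have [_ _ /(_ _ zr)] := hB; rewrite AB [2%:C + _]addrC subrK.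
by move=> h1 h2; exact: cvgC_unique h2 h1.
Qed.

(** [Rfun_cst] concerns [0 <= s]; continuation extends the independence of the phase to the plane,
    in particular to the negative [s] of the reflection formula. *)
Lemma Ehur_indep y a b z : 0 < y -> 0 < a < 1 -> a < y -> 0 < b < 1 -> b < y ->
  Ehur (y - a) a z = Ehur (y - b) b z.
Proof.
move=> y0 a01 ay b01 by_; have xa : 0 < y - a by rewrite subr_gt0.
have xb : 0 < y - b by rewrite subr_gt0.
apply: entire_eq => [r r0|r r0|u /andP[u0 _]]; [exact: PS_Ehur|exact: PS_Ehur|].
have un : 2 + u != 1 by rewrite gt_eqF//; lra.
have uz : (2 + u)%:C - 1 != 0 :> R[i] by rewrite -(rmorph1 (real_complex R)) -rmorphB fmorph_eq0 subr_eq0.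
have s0 : 0 <= 2 + u by lra.
have RR : Rfun (2 + u) (y - a) a = Rfun (2 + u) (y - b) b.
  exact: etrans (esym (PsiE s0 un y0 a01 ay)) (PsiE s0 un y0 b01 by_).
have E := etrans (Ehur_real xa a01 un) (etrans (congr1 (real_complex R) RR) (esym (Ehur_real xb b01 un))).
exact: (mulIf (invr_neq0 uz) E).
Qed.

Lemma half_min y (a := Num.min 1 y / 2) : 0 < y -> 0 < a < 1 /\ a < y.
Proof.
move=> y0; have m0 : 0 < Num.min 1 y by rewrite lt_min ltr01.
have [h1 h2] : Num.min 1 y <= 1 /\ Num.min 1 y <= y by rewrite !ge_min !lexx orbT.
by split; first (apply/andP; split); rewrite /a; lra.
Qed.

(* The entire function (s - 1) zeta(s, y). *)
Definition Eh y z : R[i] := let a := Num.min 1 y / 2 in Ehur (y - a) a z.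
Definition Zh y z : R[i] := Eh y z / (z - 1).

Lemma PS_Eh y z r : 0 < y -> 0 < r -> exists b, PS (Eh y) z b r.
Proof. by move=> y0 r0; have [a01 ay] := half_min y0; apply: PS_Ehur => //; rewrite subr_gt0. Qed.

Lemma Eh1 y : Eh y 1 = 1. Proof. exact: Ehur1. Qed.

Lemma Zh_real y a s : 0 < y -> 0 < a < 1 -> a < y -> s != 1 -> Zh y s%:C = (Rfun s (y - a) a)%:C.
Proof.
move=> y0 a01 ay s1; have [b01 by_] := half_min y0.
by rewrite /Zh /Eh (Ehur_indep _ y0 b01 by_ a01 ay) Ehur_real// subr_gt0.
Qed.

Lemma Zh_series y z : 0 < y -> 1 < complex.Re z -> series (fun n => cpow (n%:R + y) (- z)) ~> Zh y z.
Proof. by move=> y0 z1; have [a01 ay] := half_min y0; exact: Zhur_series. Qed.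

Lemma Zh_PS y z r : 0 < y -> z != 1 -> 0 < r < cabs (1 - z) -> exists b, PS (Zh y) z b r.
Proof. by move=> y0 z1 r0; have [a01 ay] := half_min y0; apply: Zhur_PS => //; rewrite subr_gt0. Qed.

Lemma Zh_meromorphic y : 0 < y -> meromorphic (Zh y).
Proof. by move=> y0; have [a01 ay] := half_min y0; apply: Zhur_meromorphic => //; rewrite subr_gt0. Qed.

Lemma hurwitz_PS y z b r : 0 < y -> PS (Zh y) z b r -> exists r', PS (hurwitz_zeta y) z b r'.
Proof.
by move=> y0 h; apply: continuation_PS h; [exact: Zh_meromorphic|move=> s; exact: Zh_series].
Qed.

Lemma hurwitzE y z : 0 < y -> z != 1 -> hurwitz_zeta y z = Zh y z.
Proof.
move=> y0 z1; have c0 : 0 < cabs (1 - z) by rewrite cabs_gt0 subr_eq0 eq_sym.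
have [|b hb] := @Zh_PS y z (cabs (1 - z) / 2) y0 z1; first by apply/andP; split; lra.
by have [r' hr'] := hurwitz_PS y0 hb; rewrite (PS_val hb) (PS_val hr').
Qed.

End Dirichlet.

(** * Hurwitz's formula *)

Section Reflection.
Variable R : realType.
Local Notation mu := (@lebesgue_measure R).
Local Notation H := (`]0%R, +oo[%classic : set R).
Implicit Types (x y t a m p sg : R) (z : R[i]).

Lemma cvg_yn y : 0 < y -> (y / n.+2%:R) @[n --> \oo] --> (0 : R).
Proof.
move=> y0; apply/cvgRP => e e0; exists (Num.truncn (y / e)) => n hn.
rewrite subr0 ger0_norm ?divr_ge0 ?(ltW y0)// ltr_pdivrMr// mulrC -ltr_pdivrMr//.
by rewrite (lt_le_trans (truncnS_gt _))// ler_nat (leq_trans _ (leqnSn _)).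
Qed.

Lemma lmod_le_ln x t : 0 < x <= 1 -> 0 <= t -> lmod x t <= ln (1 + t).
Proof.
move=> /andP[x0 x1] t0; have t1 : 0 < 1 + t by lra.
rewrite /lmod ler_pdivrMr// mulr_natr -lnXn// ler_ln ?posrE ?modsq_gt0 ?exprn_gt0//.
have : x ^+ 2 <= 1 by rewrite exprn_ile1// ltW.
nra.
Qed.

Lemma exp_lmod_small x t p n : 0 < x <= 1 -> 0 <= t -> 0 <= p <= n%:R ->
  expR (p * lmod x t) <= (1 + 0 + t) ^+ n.
Proof.
move=> x1 t0 /andP[p0 pn]; rewrite addr0; have t1 : 0 < 1 + t by lra.
rewrite -powR_mulrn ?(ltW t1)// /powR gt_eqF// ler_expR.
apply: (@le_trans _ _ (p * ln (1 + t))); first by rewrite ler_wpM2l// lmod_le_ln.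
by rewrite ler_wpM2r// ln_ge0; lra.
Qed.

(** The limit of [Wfun (1 - sg) x (y - x) t] as [x -> 0], where the argument of [x - i t] tends to
    [- pi / 2]. *)
Definition Sfun sg y t : R := t `^ (sg - 1) *
  (cos (pi * (1 - sg) / 2) * Gim y t + sin (pi * (1 - sg) / 2) * Gre y t).

Lemma lmod_cvg (t : R) (u : nat -> R) : 0 < t -> u n @[n --> \oo] --> 0 ->
  lmod (u n) t @[n --> \oo] --> ln t.
Proof.
move=> t0 u0; under eq_fun do rewrite lmodC.
have <- : lmod t 0 = ln t by rewrite /lmod expr0n addr0 lnXn// -[ln t *+ 2]mulr_natr mulfK ?pnatr_eq0.
exact: (cvg_comp _ _ u0 (isd_continuous (isd_lmod_r 0 t0))).
Qed.

Lemma larg_cvg y t : 0 < y -> 0 < t -> larg (y / n.+2%:R) t @[n --> \oo] --> pi / 2.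
Proof.
move=> y0 t0; suff h : t / (y / n.+2%:R) @[n --> \oo] --> +oo by exact: (cvg_comp _ _ h (@cvgy_atan R)).
apply/cvgryPge => A; near=> n.
have -> : t / (y / n.+2%:R) = n.+2%:R * (t / y) by field; rewrite gt_eqF//= pnatr_eq0.
rewrite -ler_pdivrMr ?divr_gt0//.
by rewrite (@le_trans _ _ n%:R) ?ler_nat ?(leq_trans (leqnSn n))//; near: n; exact: nbhs_infty_ger.
Unshelve. all: by end_near. Qed.

Lemma reflection_integral sg y : 1 < sg -> 0 < y < 1 ->
  exists2 M, expdom (Sfun sg y) M & Zh y (1 - sg%:C) = (\int[mu]_(t in H) Sfun sg y t)%:C.
Proof.
move=> sg1 y01; have /andP[y0 y1] := y01.
pose s := 1 - sg; have s0 : s < 0 by rewrite subr_lt0.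
have sn1 : s != 1 by rewrite lt_eqF// (lt_trans s0).
(* [n.+2] keeps the phase [y - u n] in [[y / 2, y]], where [y < 1] gives a uniform gap, while
   [x = u n] tends to [0]. *)
pose u n := y / n.+2%:R.
have u0 n : 0 < u n by rewrite divr_gt0.
have uy2 n : u n <= y / 2 by rewrite ler_pM2l// lef_pV2 ?posrE// ler_nat.
have y20 : 0 < y / 2 by lra.
have y2y : y / 2 <= y by lra.
have [m m01 mP] := cos_gap y20 y2y y1.
have aP n : [/\ 0 < y - u n < 1, y - u n < y & cos (2 * pi * (y - u n)) <= 1 - m].
  have := uy2 n; have := u0 n => h1 h2; split; [by apply/andP; split; lra|lra|].
  by apply: mP; apply/andP; split; lra.
have u1 n : 0 < u n <= 1 by rewrite u0 /=; have := uy2 n; lra.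
have [k pk] : exists k : nat, - s <= k%:R.
  by exists (Num.truncn (- s)).+1; rewrite ltW// truncnS_gt.
have pk' : 0 <= - s <= k%:R by rewrite oppr_ge0 (ltW s0).
pose M := 6 / m * modbound k 0 : R.
have m0 : 0 < m by case/andP: m01.
have domW n : expdom (Wfun s (u n) (y - u n)) M.
  have [a01 ay am] := aP n; split; first exact: W_measurable.
  move=> t t0; apply: le_trans (W_le m01 am (ltW t0) (exp_lmod_small (u1 n) (ltW t0) pk')) _.
  have := @poly_exp_le R k 0 t (lexx _) (ltW t0).
  set A := _ ^+ k; set e := expR _ => h; have -> : A * (6 / m) * e = 6 / m * (A * e) by ring.
  by rewrite /M -[leRHS]mulrA ler_wpM2l// divr_ge0// ltW.
have cW t : 0 < t -> Wfun s (u n) (y - u n) t @[n --> \oo] --> Sfun sg y t.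
  move=> t0; have uc : u n @[n --> \oo] --> 0 by exact: cvg_yn.
  have yc : y - u n @[n --> \oo] --> y.
    by rewrite -[X in _ --> X](subr0 y); apply: cvgB => //; exact: cvg_cst.
  have lc := lmod_cvg t0 uc; have ac := larg_cvg y0 t0.
  have ec : expR (- s * lmod (u n) t) @[n --> \oo] --> t `^ (sg - 1).
    have -> : t `^ (sg - 1) = expR (- s * ln t) by rewrite /powR gt_eqF// /s opprB.
    have lc' : - s * lmod (u n) t @[n --> \oo] --> - s * ln t by apply: cvgM => //; exact: cvg_cst.
    exact: (cvg_comp _ _ lc' (@continuous_expR R _)).
  have sc : s * larg (u n) t @[n --> \oo] --> pi * s / 2.
    have -> : pi * s / 2 = s * (pi / 2) by ring.
    by apply: cvgM => //; exact: cvg_cst.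
  have cc : cos (s * larg (u n) t) @[n --> \oo] --> cos (pi * s / 2).
    exact: (cvg_comp _ _ sc (@continuous_cos R _)).
  have ss : sin (s * larg (u n) t) @[n --> \oo] --> sin (pi * s / 2).
    exact: (cvg_comp _ _ sc (@continuous_sin R _)).
  have gi : Gim (y - u n) t @[n --> \oo] --> Gim y t.
    exact: (cvg_comp (fun n => y - u n) (fun b => Gim b t) yc (isd_continuous (isd_Gim_l t y01))).
  have gr : Gre (y - u n) t @[n --> \oo] --> Gre y t.
    exact: (cvg_comp (fun n => y - u n) (fun b => Gre b t) yc (isd_continuous (isd_Gre_l t y01))).
  rewrite /Sfun mulrDr.
  have WE : (fun n => Wfun s (u n) (y - u n) t) = (fun n =>
     expR (- s * lmod (u n) t) * (cos (s * larg (u n) t) * Gim (y - u n) t)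
     + expR (- s * lmod (u n) t) * (sin (s * larg (u n) t) * Gre (y - u n) t)).
    by apply/funext => n; rewrite /Wfun /Fre /Fim !mulrA.
  rewrite WE.
  by apply: cvgD; (apply: cvgM; [exact: ec|apply: cvgM; [|by []]]).
have cI := expdom_cvg domW cW.
have mS : measurable_fun H (Sfun sg y).
  apply: measurable_funM.
    have h : forall t : R, 0 < t -> is_derive t 1 (fun t => t `^ (sg - 1)) ((sg - 1) * t `^ (sg - 1 - 1)).
      by move=> t t0; exact: isd_powR.
    exact: measurable_isd h.
  have h : forall t : R, is_derive t 1 (fun t => cos (pi * (1 - sg) / 2) * Gim y t + sin (pi * (1 - sg) / 2) * Gre y t)
      (cos (pi * (1 - sg) / 2) * dGre y t + sin (pi * (1 - sg) / 2) * - dGim y t).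
    move=> t; exact: (isd_add (isd_scale (cos (pi * (1 - sg) / 2)) (isd_Gim_r t y01)) (isd_scale (sin (pi * (1 - sg) / 2)) (isd_Gre_r t y01))).
  exact: measurable_isd0 h.
exists M.
  split=> // t t0; have cn : `|Wfun s (u n) (y - u n) t| @[n --> \oo] --> `|Sfun sg y t| by apply: cvg_norm; exact: cW.
  rewrite -(cvg_lim (@norm_hausdorff _ _) cn); apply: limr_le; first exact: cvgP cn.
  by near=> n; apply: (domW n).2.
(* Here [1 - s = sg > 1], so the elementary term of [Rfun] vanishes in the limit and only the
   integral remains. *)
have u0' : (u n) `^ (1 - s) / (s - 1) @[n --> \oo] --> 0.
  rewrite -[X in _ --> X](mul0r (s - 1)^-1); apply: cvgM; last exact: cvg_cst.
  apply/cvgr0Pnorm_le => e e0; near=> n.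
  rewrite ger0_norm ?powR_ge0//; apply: (@le_trans _ _ (u n)); last first.
    by near: n; exact: cvgr_le (cvg_yn y0) _ e0.
  have /andP[un0 un1] := u1 n; rewrite /powR gt_eqF// -[leRHS](lnK (x := u n)) ?posrE//.
  by rewrite ler_expR; have := ln_le0 un1; nra.
have rc : Rfun s (u n) (y - u n) @[n --> \oo] --> \int[mu]_(t in H) Sfun sg y t.
  by rewrite -[X in _ --> X]add0r; apply: cvgD.
have E n : Zh y (1 - sg%:C) = (Rfun s (u n) (y - u n))%:C.
  have [a01 ay _] := aP n; have -> : 1 - sg%:C = s%:C :> R[i] by rewrite rmorphB rmorph1.
  by rewrite (Zh_real y0 a01 ay sn1) opprB addrCA subrr addr0.
rewrite (E 0%N); congr (_%:C).
have Ec n : Rfun s (u n) (y - u n) = Rfun s (u 0%N) (y - u 0%N).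
  by have := etrans (esym (E n)) (E 0%N) => /(congr1 (@complex.Re R)).
by rewrite (eq_cvg _ _ Ec) in rc; exact: (cvg_unique (@norm_hausdorff _ _) (cvg_cst _) rc).
Unshelve. all: by end_near. Qed.

Lemma isd_expN t : is_derive t 1 (fun u : R => expR (- u)) (- expR (- t)).
Proof.
have h := isd_eq (g := fun u : R => expR (- u)) (fun u => congr1 (@expR R) (mulN1r u)) (isd_expl t (-1)).
by apply: (is_derive_eq h); rewrite mulrN1 mulN1r.
Qed.

Lemma gamma_scale sg c : 1 < sg -> 0 < c ->
  \int[mu]_(t in H) (t `^ (sg - 1) * expR (- (c * t))) = c `^ (- sg) * Gamma sg.
Proof.
move=> sg1 c0.
pose G t : R := t `^ (sg - 1) * expR (- t).
have G0 t : 0 <= G t by rewrite mulr_ge0 ?powR_ge0 ?expR_ge0.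
have q0 : 0 < sg - 1 by rewrite subr_gt0.
have contG t : 0 < t -> {for t, continuous G}.
  by move=> t0; exact: isd_continuous (isd_mul (isd_powR (sg - 1) t0) (isd_expN t)).
have G00 : G 0 = 0 by rewrite /G powR0 ?mul0r// gt_eqF.
have cG : {within `[0, +oo[, continuous G}.
  apply/continuous_within_itvcyP; split.
    by move=> t; rewrite in_itv /= andbT; exact: contG.
  rewrite G00 -[X in _ --> X](mul0r (expR (- 0))); apply: cvgM; first exact: powR_cvg0.
  by apply: cvg_at_right_filter; exact: (isd_continuous (isd_expN 0)).
have mG : measurable_fun H G by exact: measurable_continuous.
pose F : R -> R := fun t => c * t.
have F' (t : R) : is_derive t 1 F c by exact: isd_lin.
have F'E : derive1 F = cst c by apply/funext => t; rewrite derive1E; case: (F' t).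
have F0 : F 0 = 0 by rewrite /F mulr0.
have subst : (\int[mu]_(x in `[0%R, +oo[) (G x)%:E = \int[mu]_(x in `[0%R, +oo[) (G (c * x) * c)%:E)%E.
  have := @increasing_ge0_integration_by_substitutiony R F G 0.
  rewrite F'E F0; apply => //.
  - by move=> x y _ _ xy; rewrite /F ltr_pM2l.
  - by move=> x _; exact: cvg_cst.
  - exact: is_cvg_cst.
  - exact: is_cvg_cst.
  - split; first by move=> x _; case: (F' x).
    by apply: cvg_at_right_filter; exact: (isd_continuous (F' 0)).
  - by apply: gt0_cvgMry => //; exact: cvg_id.
pose h t : R := t `^ (sg - 1) * expR (- (c * t)).
have conth t : 0 < t -> {for t, continuous h}.
  move=> t0; have ie := isd_comp (g := fun u => c * u) (isd_expN (c * t)) (isd_lin t c).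
  exact: isd_continuous (isd_mul (isd_powR (sg - 1) t0) ie).
have mh : measurable_fun H h by exact: measurable_continuous.
have Ec t : 0 < t -> G (c * t) * c = c `^ sg * h t.
  move=> t0; rewrite /G powRM ?(ltW c0) ?(ltW t0)//.
  have -> : c `^ sg = c `^ (sg - 1) * c by rewrite mulrC mulr_powRB1 ?ltW// (lt_trans ltr01).
  by rewrite /h; ring.
have mGc : measurable_fun H (fun t => G (c * t) * c).
  apply: (eq_measurable_fun (fun t => c `^ sg * h t)).
    by move=> t; rewrite inE /= in_itv /= andbT => /Ec.
  by apply: measurable_funM => //; exact: measurable_cst.
rewrite -!integral_itv_obnd_cbnd in subst; [|exact/measurable_EFinP|exact/measurable_EFinP].
have K0 : 0 < c `^ sg by rewrite powR_gt0.
have E : (\int[mu]_(x in H) (G (c * x) * c)%:E = (c `^ sg)%:E * \int[mu]_(x in H) (h x)%:E)%E.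
  rewrite -ge0_integralZl_EFin//; last 2 first.
  - exact/measurable_EFinP.
  - by rewrite ltW.
  - by apply: eq_integral => t; rewrite inE /= in_itv /= andbT => /Ec ->; rewrite EFinM.
  - by move=> t _; rewrite lee_fin mulr_ge0 ?powR_ge0 ?expR_ge0.
have -> : Gamma sg = fine (\int[mu]_(x in H) (G x)%:E) by [].
rewrite subst E powRN /Rintegral.
have : (0 <= \int[mu]_(x in H) (h x)%:E)%E.
  by apply: integral_ge0 => t _; rewrite lee_fin mulr_ge0 ?powR_ge0 ?expR_ge0.
(* An infinite integral would give [0] on both sides, since [fine] sends it to [0]. *)
rewrite /h; case: (\int[mu]_(x in H) _)%E => [r _||//] /=; first by rewrite mulKf// gt_eqF.
by rewrite gt0_muley ?lte_fin//= mulr0.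
Qed.

End Reflection.

(** * Expansion in powers of q *)

Section ReflectionSeries.
Variable R : realType.
Local Notation mu := (@lebesgue_measure R).
Local Notation H := (`]0%R, +oo[%classic : set R).
Implicit Types (x y t a m p sg : R) (z : R[i]).

Definition qfun y t : R[i] := cexp ((- (2 * pi * t)) +i* (2 * pi * y)).

Lemma Gden_expN a t : Gden a t * 2 * expR (- (2 * pi * t)) =
  1 + expR (- (2 * pi * t)) ^+ 2 - 2 * cos (2 * pi * a) * expR (- (2 * pi * t)).
Proof.
rewrite /Gden; have := expRxMexpNx_1 (2 * pi * t).
set p := expR (2 * pi * t); set q := expR (- _); set c := cos _ => pq.
have -> : ((p + q) / 2 - c) * 2 * q = p * q + q ^+ 2 - 2 * c * q by field.
by rewrite pq.
Qed.

Lemma Gfun_q y t : 0 < y < 1 -> Gfun y t * (1 - qfun y t) = 2 * qfun y t.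
Proof.
move=> y01; have D0 : Gden y t != 0 by rewrite gt_eqF// Gden_gt0.
have := Gden_expN y t; have := cos2Dsin2 (2 * pi * y).
rewrite /Gfun /Gre /Gim /qfun /cexp /=; move: D0.
set D := Gden y t; set e := expR _; set c := cos _; set s := sin _ => D0 cs De.
have s2 : s * s = 1 - c ^+ 2 by rewrite -cs; ring.
apply/eqP; rewrite eq_complex; apply/andP; split; apply/eqP => /=.
  have -> : (c - e) / D * (1 - (e * c - 0 * s)) - s / D * (0 - (e * s + 0 * c)) =
     ((c - e) * (1 - e * c) + e * (s * s)) / D by field.
  rewrite s2; have -> : (c - e) * (1 - e * c) + e * (1 - c ^+ 2) = c * (1 + e ^+ 2 - 2 * c * e) by ring.
  by rewrite -De; field.
have -> : (c - e) / D * (0 - (e * s + 0 * c)) + s / D * (1 - (e * c - 0 * s)) =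
   s * (1 + e ^+ 2 - 2 * c * e) / D by field.
by rewrite -De; field.
Qed.

Lemma cabs_qfun y t : cabs (qfun y t) = expR (- (2 * pi * t)).
Proof. by rewrite /qfun cabs_cexp. Qed.

Lemma qfun_lt1 y t : 0 < t -> cabs (qfun y t) < 1.
Proof. by move=> t0; rewrite cabs_qfun expR_lt1 oppr_lt0 !mulr_gt0// pi_gt0. Qed.

Lemma qfunX y t n : qfun y t ^+ n = cexp ((- (2 * pi * t * n%:R)) +i* (2 * pi * n%:R * y)).
Proof.
elim: n => [|n ih].
  have -> : (- (2 * pi * t * 0%:R)) +i* (2 * pi * 0%:R * y) = 0 :> R[i].
    by apply/eqP; rewrite eq_complex /= !mulr0 mul0r oppr0 !eqxx.
  by rewrite expr0 cexp0.
rewrite exprS ih /qfun -cexpD; congr cexp.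
by apply/eqP; rewrite eq_complex /=; apply/andP; split; apply/eqP; rewrite -natr1; ring.
Qed.

(** [exp (i pi (1 - sg) / 2)], the limit of the phase of [(x - i t)^(sg - 1)] as [x -> 0]. *)
Definition rphase sg : R[i] := cos (pi * (1 - sg) / 2) +i* sin (pi * (1 - sg) / 2).

Definition rterm sg y k t : R :=
  2 * cos (pi * sg / 2 - 2 * pi * k.+1%:R * y) * (t `^ (sg - 1) * expR (- (2 * pi * k.+1%:R * t))).

Lemma rterm_Im sg y k t :
  rterm sg y k t = t `^ (sg - 1) * complex.Im (rphase sg * (2 * qfun y t ^+ k.+1)).
Proof.
rewrite qfunX /rterm /rphase /cexp /=.
have -> : 2 * pi * k.+1%:R * t = 2 * pi * t * k.+1%:R by ring.
have -> : pi * (1 - sg) / 2 = pi / 2 - pi * sg / 2 by field.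
rewrite cosB sinB cosB cos_pihalf sin_pihalf; set X := 2 * pi * _ * y.
set Y := pi * sg / 2; set e := expR _; ring.
Qed.

(** As [g (1 - q) = 2 q], the partial geometric sum is [g (1 - q^N)], of modulus at most [2 |g|] for
    every [N]. *)
Lemma rterm_sum sg y t N : 0 < y < 1 -> 0 < t ->
  \sum_(0 <= k < N) rterm sg y k t =
  t `^ (sg - 1) * complex.Im (rphase sg * (Gfun y t * (1 - qfun y t ^+ N))).
Proof.
move=> y01 t0; under eq_bigr do rewrite rterm_Im; rewrite -mulr_sumr -Im_sum -!mulr_sumr.
congr (_ * complex.Im (_ * _)).
have q1 : 1 - qfun y t != 0.
  by rewrite subr_eq0; apply/eqP => E; have := qfun_lt1 y t0; rewrite -E cabs1 ltxx.
elim: N => [|N ih]; first by rewrite big_geq// expr0 subrr !mulr0.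
rewrite big_nat_recr//= mulrDr ih exprS.
have -> : 2 * (qfun y t * qfun y t ^+ N) = 2 * qfun y t * qfun y t ^+ N by rewrite mulrA.
by rewrite -(Gfun_q t y01); ring.
Qed.

Lemma Sfun_Im sg y t : Sfun sg y t = t `^ (sg - 1) * complex.Im (rphase sg * Gfun y t).
Proof. by []. Qed.

Lemma cabs_rphase sg : cabs (rphase sg) = 1.
Proof.
have := sqr_cabs (rphase sg); rewrite /= cos2Dsin2 => /eqP.
by rewrite sqrf_eq1 => /orP[/eqP//|/eqP h]; have := cabs_ge0 (rphase sg); rewrite h; lra.
Qed.

Lemma powR_le_poly t p n : 0 < t -> 0 <= p <= n%:R -> t `^ p <= (1 + 0 + t) ^+ n.
Proof.
move=> t0 /andP[p0 pn]; have t1 : 0 <= 1 + 0 + t by lra.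
rewrite -powR_mulrn//; apply: (@le_trans _ _ ((1 + 0 + t) `^ p)).
  by apply: ge0_ler_powR; rewrite ?nnegrE ?(ltW t0)//; lra.
by rewrite ler_powR//; lra.
Qed.

Lemma gamma_dom sg k : 1 < sg ->
  exists M, expdom (fun t => t `^ (sg - 1) * expR (- (2 * pi * k.+1%:R * t))) M.
Proof.
move=> sg1; have [n pn] : exists n : nat, sg - 1 <= n%:R.
  by exists (Num.truncn (sg - 1)).+1; rewrite ltW// truncnS_gt.
exists (modbound n 0); split.
  apply: measurable_continuous => t t0.
  have ie := isd_comp (g := fun u => 2 * pi * k.+1%:R * u) (isd_expN (2 * pi * k.+1%:R * t)) (isd_lin t (2 * pi * k.+1%:R)).
  exact: isd_continuous (isd_mul (isd_powR (sg - 1) t0) ie).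
move=> t t0; rewrite ger0_norm ?mulr_ge0 ?powR_ge0 ?expR_ge0//.
apply: le_trans (poly_exp_le n (lexx _) (ltW t0)).
apply: ler_pM; rewrite ?powR_ge0 ?expR_ge0//.
  by apply: powR_le_poly => //; rewrite pn andbT subr_ge0 ltW.
rewrite ler_expR lerN2 ler_wpM2r ?(ltW t0)// ler_peMr ?mulr_ge0 ?pi_ge0//.
by rewrite ler1n.
Qed.

(** Integration term by term: [rterm_sum] provides the majorant [2 |g| t^(sg - 1)] for all partial
    sums. *)
Lemma reflection_open sg y : 1 < sg -> 0 < y < 1 ->
  (fun N => (\sum_(0 <= k < N) 2 * cos (pi * sg / 2 - 2 * pi * k.+1%:R * y) *
      ((2 * pi * k.+1%:R) `^ (- sg) * Gamma sg))%:C) ~> Zh y (1 - sg%:C).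
Proof.
move=> sg1 y01; have [M domS ->] := reflection_integral sg1 y01; apply: cvgC_real.
have /andP[y0 y1] := y01.
have it k : mu.-integrable H (EFin \o rterm sg y k).
  have [M' /expdom_integrable h] := gamma_dom k sg1.
  exact: (@integrableZl _ _ _ mu H (measurable_itv _) (2 * cos (pi * sg / 2 - 2 * pi * k.+1%:R * y)) _ h).
have E N : \sum_(0 <= k < N) 2 * cos (pi * sg / 2 - 2 * pi * k.+1%:R * y) * ((2 * pi * k.+1%:R) `^ (- sg) * Gamma sg)
    = \int[mu]_(t in H) (\sum_(0 <= k < N) rterm sg y k t).
  rewrite (Rintegral_sum N (measurable_itv _) it).2; apply: eq_bigr => k _.
  rewrite RintegralZl ?gamma_scale//; first by rewrite !mulr_gt0// pi_gt0.
  by have [M' /expdom_integrable] := gamma_dom k sg1.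
under eq_fun do rewrite E.
have [m m01 /(_ y)] := cos_gap y0 (lexx _) y1; rewrite lexx => /(_ isT) ym.
have m0 : 0 < m by case/andP: m01.
have [n pn] : exists n : nat, sg - 1 <= n%:R.
  by exists (Num.truncn (sg - 1)).+1; rewrite ltW// truncnS_gt.
have pn' : 0 <= sg - 1 <= n%:R by rewrite pn andbT subr_ge0 ltW.
apply: (@expdom_cvg _ _ _ (12 / m * modbound n 0)) => [N|t t0].
  split; first by have [/integrableP[/measurable_EFinP]] := Rintegral_sum N (measurable_itv _) it.
  move=> t t0; rewrite (rterm_sum _ _ y01 t0) normrM ger0_norm ?powR_ge0//.
  have hg : cabs (Gfun y t) <= 6 / m * expR (- (2 * pi * t)).
    apply: le_trans (cabs_le_ReIm _) _; have := Gre_le m01 ym (ltW t0); have := Gim_le m01 ym t.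
    have -> : 6 / m * expR (- (2 * pi * t)) = 2 / m * expR (- (2 * pi * t)) + 4 / m * expR (- (2 * pi * t)) by ring.
    by rewrite /Gfun /=; lra.
  have hq : cabs (1 - qfun y t ^+ N) <= 2.
    apply: le_trans (cabsB _ _) _; rewrite cabs1 cabsX.
    have : cabs (qfun y t) ^+ N <= 1 by rewrite exprn_ile1 ?cabs_ge0// ltW// qfun_lt1.
    lra.
  have hI : `|complex.Im (rphase sg * (Gfun y t * (1 - qfun y t ^+ N)))| <= 12 / m * expR (- (2 * pi * t)).
    apply: le_trans (ler_Im_cabs _) _; rewrite !cabsM cabs_rphase mul1r.
    apply: le_trans (ler_pM (cabs_ge0 _) (cabs_ge0 _) hg hq) _.
    by rewrite le_eqVlt; apply/orP; left; apply/eqP; field; rewrite gt_eqF.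
  apply: le_trans (ler_pM (powR_ge0 _ _) (normr_ge0 _) (powR_le_poly t0 pn') hI) _.
  have := poly_exp_le n (lexx 0) (ltW t0); set A := _ ^+ n; set e := expR _ => h.
  have -> : A * (12 / m * e) = 12 / m * (A * e) by ring.
  by rewrite -[leRHS]mulrA ler_wpM2l// divr_ge0// ltW.
under eq_fun do rewrite (rterm_sum _ _ y01 t0).
rewrite Sfun_Im; apply: cvgM; first exact: cvg_cst.
suff : (fun N => rphase sg * (Gfun y t * (1 - qfun y t ^+ N))) ~> (rphase sg * Gfun y t).
  by move/cvgC_ReIm => [].
apply: cvgC_scale; rewrite -[X in _ ~> X]mulr1; apply: cvgC_scale.
rewrite -[X in _ ~> X]subr0; apply: cvgC_sub; first exact: cvgC_cst.
have := @cvg_geometric R 1 (cabs (qfun y t)); rewrite ger0_norm ?cabs_ge0// => /(_ (qfun_lt1 y t0)).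
move/cvgRP => h e /h [N0 hN]; exists N0 => n' /hN.
by rewrite !subr0 /geometric /= mul1r cabsX ger0_norm// exprn_ge0 ?cabs_ge0.
Qed.

End ReflectionSeries.

(** * The end point y = 1 and residue classes *)

Section ReflectionClosed.
Variable R : realType.
Implicit Types (x y t a m p sg s : R) (z : R[i]) (f : nat -> R[i]).

Lemma big_nat_blocks (V : nmodType) (f : nat -> V) v N :
  \sum_(0 <= k < v * N) f k = \sum_(0 <= n < N) \sum_(0 <= j < v) f (v * n + j)%N.
Proof.
elim: N => [|N ih]; first by rewrite muln0 !big_geq.
rewrite big_nat_recr//= -ih mulnS addnC (big_cat_nat _ (n := (v * N)%N)) ?leq_addr//=; congr (_ + _).
by rewrite -{1}[(v * N)%N]add0n big_addn addKn; apply: eq_bigr => j _; rewrite addnC.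
Qed.

Lemma cvgC_blocks f l v : (0 < v)%N -> series f ~> l ->
  (fun N => \sum_(0 <= n < N) \sum_(0 <= j < v) f (v * n + j)%N) ~> l.
Proof.
move=> v0 h e e0; have [N NP] := h e e0; exists N => n Nn.
by rewrite -big_nat_blocks; apply: NP; rewrite (leq_trans Nn)// leq_pmull.
Qed.

Lemma Zh_real_series s y : 0 < y -> 1 < s ->
  series (fun n => ((n%:R + y) `^ (- s))%:C) ~> Zh y s%:C.
Proof.
move=> y0 s1; have := Zh_series y0 (s1 : 1 < complex.Re s%:C); congr cvgC; apply/funext => n.
by apply: eq_bigr => k _; rewrite -rmorphN cpow_real// ltr_wpDl.
Qed.

Lemma powR_pair s n : (n%:R * 2 + 1 : R) `^ (- s) = 2 `^ (- s) * (n%:R + 2^-1) `^ (- s).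
Proof.
rewrite -powRM ?addr_ge0 ?invr_ge0//.
by congr (_ `^ _); field.
Qed.

Lemma powR_pair2 s n : (n%:R * 2 + 1 + 1 : R) `^ (- s) = 2 `^ (- s) * (n%:R + 1) `^ (- s).
Proof. by rewrite -powRM ?addr_ge0//; congr (_ `^ _); ring. Qed.

Lemma Zh_half s : 1 < s -> Zh 1 s%:C = (2 `^ (- s))%:C * (Zh 2^-1 s%:C + Zh 1 s%:C).
Proof.
move=> s1; have h2 : (0 : R) < 2^-1 by rewrite invr_gt0.
have a1 := Zh_real_series ltr01 s1; have a2 := Zh_real_series h2 s1.
have := cvgC_blocks (isT : (0 < 2)%N) a1 => /cvgC_unique; apply.
have := series_scale (2 `^ (- s))%:C (series_add a2 a1); congr cvgC; apply/funext => n.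
apply: eq_bigr => k _; rewrite !big_nat_recr//= big_geq// add0r addn0 addn1.
have e1 : (2 * k)%:R = k%:R * 2 :> R by rewrite natrM mulrC.
have e2 : (2 * k).+1%:R = k%:R * 2 + 1 :> R by rewrite -addn1 natrD e1.
by rewrite e2 e1 powR_pair powR_pair2 !rmorphM mulrDr.
Qed.

(** Separating even and odd terms of the Dirichlet series gives the relation for real arguments
    above [1]; it is then continued. *)
Lemma Eh_half z : Eh 2^-1 z + Eh 1 z = cpow 2 z * Eh (1 : R) z.
Proof.
have h2 : (0 : R) < 2^-1 by rewrite invr_gt0.
apply: (entire_eq (f := fun z => Eh 2^-1 z + Eh 1 z) (g := fun z => cpow 2 z * Eh 1 z)) => [r r0|r r0|u /andP[u0 _]].
- have [A hA] := PS_Eh 2%:C h2 r0; have [B hB] := PS_Eh 2%:C (ltr01 : 0 < (1 : R)) r0.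
  by eexists; exact: PS_add hA hB.
- have rr : 0 < r < r + 1 by rewrite r0 ltrDl ltr01.
  have r1 : 0 < r + 1 by rewrite addr_gt0.
  have [B hB] := PS_Eh 2%:C (ltr01 : 0 < (1 : R)) r1.
  by eexists; exact: PS_mul rr (PS_cpow 2 2%:C r1) hB.
have u1 : 1 < 2 + u by lra.
have n0 : (2 + u)%:C - 1 != 0 :> R[i].
  by rewrite -(rmorph1 (real_complex R)) -rmorphB fmorph_eq0 subr_eq0 gt_eqF.
have h := Zh_half u1; rewrite /Zh -mulrDl mulrA in h.
have {}h := mulIf (invr_neq0 n0) h; rewrite [in RHS]h.
rewrite cpow_real// mulrA -rmorphM -powRD ?pnatr_eq0 ?implybT// subrr powRr0 mul1r.
by [].
Qed.

Lemma cos_sub_2pi k (X : R) : cos (X - 2 * pi * k%:R) = cos X.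
Proof.
elim: k => [|k ih]; first by rewrite mulr0 subr0.
rewrite -[RHS]ih; have -> : X - 2 * pi * k%:R = X - 2 * pi * k.+1%:R + pi + pi.
  by rewrite -addn1 natrD; ring.
by rewrite !cosDpi opprK.
Qed.

(** [y = 1] is outside the range of [reflection_open]. The formula at [y = 1/2], whose series
    alternates, is divided by [2^(1 - sg) - 1]: this factor relates the two zeta values, by
    [Eh_half], and also the alternating series to the plain one. *)
Lemma reflection_one sg : 1 < sg ->
  (fun N => (\sum_(0 <= k < N) 2 * cos (pi * sg / 2 - 2 * pi * k.+1%:R * 1) *
      ((2 * pi * k.+1%:R) `^ (- sg) * Gamma sg))%:C) ~> Zh 1 (1 - sg%:C).
Proof.
move=> sg1; have h2 : 0 < (2^-1 : R) < 1 by apply/andP; split; lra.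
pose K : R := 2 * cos (pi * sg / 2) * (2 * pi) `^ (- sg) * Gamma sg.
have E k y : 2 * cos (pi * sg / 2 - 2 * pi * k.+1%:R * y) * ((2 * pi * k.+1%:R) `^ (- sg) * Gamma sg)
   = 2 * (2 * pi) `^ (- sg) * Gamma sg * cos (pi * sg / 2 - 2 * pi * k.+1%:R * y) * (k%:R + 1) `^ (- sg).
  have -> : k%:R + 1 = k.+1%:R :> R by rewrite -addn1 natrD.
  by rewrite powRM ?mulr_ge0 ?pi_ge0//; ring.
have cosN k X : cos (X - 2 * pi * k%:R * 1) = cos X :> R by rewrite mulr1 cos_sub_2pi.
have cosH k X : cos (X - 2 * pi * k%:R * 2^-1) = (-1) ^+ k * cos X :> R.
  elim: k => [|k ih]; first by rewrite mulr0 mul0r subr0 mul1r.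
  have -> : X - 2 * pi * k.+1%:R * 2^-1 = X - 2 * pi * k%:R * 2^-1 - pi by rewrite -addn1 natrD; field.
  by rewrite cosB cospi sinpi mulr0 addr0 mulrN1 ih exprS mulN1r mulNr.
have z1 := Zh_real_series ltr01 sg1.
have h := reflection_open sg1 h2.
have hz : Zh 1 (1 - sg%:C) * (cpow 2 (1 - sg%:C) - 1) = Zh 2^-1 (1 - sg%:C).
  rewrite /Zh -[Eh 2^-1 _](addrK (Eh 1 (1 - sg%:C))) Eh_half.
  move: (Eh 1 (1 - sg%:C)) (cpow 2 (1 - sg%:C)) ((1 - sg%:C - 1)^-1) => e1 e2 e3; ring.
pose c : R := 2 `^ (1 - sg) - 1.
have cE : cpow 2 (1 - sg%:C) - 1 = c%:C :> R[i].
  have -> : 1 - sg%:C = (1 - sg)%:C :> R[i] by rewrite rmorphB rmorph1.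
  by rewrite cpow_real// /c rmorphB rmorph1.
have cn : c%:C != 0 :> R[i].
  rewrite fmorph_eq0 /c subr_eq0 lt_eqF// -[X in _ < X](powRr0 (2 : R)).
  rewrite /powR pnatr_eq0 /= ltr_expR ltr_pM2r ?ln_gt0 ?ltr1n//; lra.
have l1 : Zh 2^-1 (1 - sg%:C) = K%:C * (c%:C * Zh 1 sg%:C).
  pose g k : R[i] := (K * ((-1) ^+ k.+1 * (k%:R + 1) `^ (- sg)))%:C.
  have hg : series g ~> Zh 2^-1 (1 - sg%:C).
    move: h; congr cvgC; apply/funext => N; rewrite rmorph_sum; apply: eq_bigr => k _.
    by rewrite E cosH /g; congr (_%:C); rewrite /K; ring.
  have z2 := cvgC_blocks (isT : (0 < 2)%N) z1.
  (* Summation in pairs: twice the even terms, which is [2^(1 - sg)] times the full series, minus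
     all terms. *)
  have := cvgC_blocks (isT : (0 < 2)%N) hg => /cvgC_unique; apply.
  have -> : c%:C * Zh 1 sg%:C = (2 `^ (1 - sg))%:C * Zh 1 sg%:C - Zh 1 sg%:C.
    by rewrite /c rmorphB rmorph1 mulrBl mul1r.
  have := cvgC_scale K%:C (cvgC_sub (series_scale (2 `^ (1 - sg))%:C z1) z2); congr cvgC; apply/funext => N.
  rewrite /series /= -sumrB mulr_sumr; apply: eq_bigr => k _.
  rewrite !big_nat_recr//= !big_geq// !add0r addn0 addn1 /g.
  have e1 : (2 * k)%:R = k%:R * 2 :> R by rewrite natrM mulrC.
  have e2 : (2 * k).+1%:R = k%:R * 2 + 1 :> R by rewrite -addn1 natrD e1.
  have cD (a b : R) : a%:C + b%:C = (a + b)%:C :> R[i] by rewrite rmorphD.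
  have cM (a b : R) : a%:C * b%:C = (a * b)%:C :> R[i] by rewrite rmorphM.
  have cB (a b : R) : a%:C - b%:C = (a - b)%:C :> R[i] by rewrite rmorphB.
  rewrite e2 e1 powR_pair powR_pair2 !(cD, cM, cB).
  congr (_%:C); have -> : (-1) ^+ (2 * k).+1 = -1 :> R by rewrite exprS exprM sqrrN !expr1n mulr1.
  have -> : (-1) ^+ (2 * k).+2 = 1 :> R by rewrite 2!exprS exprM sqrrN !expr1n mulr1 mulN1r opprK.
  have -> : 2 `^ (1 - sg) = 2 * 2 `^ (- sg) :> R by rewrite powRD ?pnatr_eq0 ?implybT// powRr1.
  ring.
have -> : Zh 1 (1 - sg%:C) = K%:C * Zh 1 sg%:C.
  by apply: (mulIf cn); rewrite -cE hz l1 cE; ring.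
have := series_scale K%:C z1; congr cvgC; apply/funext => N.
by rewrite /series /= rmorph_sum; apply: eq_bigr => k _; rewrite E cosN -rmorphM; congr (_%:C); rewrite /K; ring.
Qed.

Lemma hurwitz_reflection sg u v : 1 < sg -> (1 <= u <= v)%N ->
  Zh (u%:R / v%:R) (1 - sg%:C) = (2 * Gamma sg * (2 * pi * v%:R) `^ (- sg))%:C *
    \sum_(1 <= k < v.+1) (cos (pi / 2 * sg - 2 * pi * k%:R * u%:R / v%:R))%:C * Zh (k%:R / v%:R) sg%:C.
Proof.
move=> sg1 /andP[u1 uv]; have v0 : (0 < v)%N by exact: leq_trans uv.
have vp : 0 < v%:R :> R by rewrite ltr0n.
set y : R := u%:R / v%:R; have y0 : 0 < y by rewrite divr_gt0// ltr0n.
have h : (fun N => (\sum_(0 <= k < N) 2 * cos (pi * sg / 2 - 2 * pi * k.+1%:R * y) *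
      ((2 * pi * k.+1%:R) `^ (- sg) * Gamma sg))%:C) ~> Zh y (1 - sg%:C).
  have [y1|y1] := ltP y 1; first by apply: reflection_open => //; rewrite y0.
  have -> : y = 1.
    by apply/eqP; rewrite eq_le y1 andbT ler_pdivrMr// mul1r ler_nat.
  exact: reflection_one.
pose g k : R[i] := (2 * cos (pi * sg / 2 - 2 * pi * k.+1%:R * y) * ((2 * pi * k.+1%:R) `^ (- sg) * Gamma sg))%:C.
have hg : series g ~> Zh y (1 - sg%:C).
  by move: h; congr cvgC; apply/funext => N; rewrite rmorph_sum.
have := cvgC_blocks v0 hg => /cvgC_unique; apply.
pose c k : R[i] := (cos (pi / 2 * sg - 2 * pi * k%:R * u%:R / v%:R))%:C.
have zs j : series (fun n => (((n%:R + j.+1%:R / v%:R) `^ (- sg))%:C)) ~> Zh (j.+1%:R / v%:R) sg%:C.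
  by apply: Zh_real_series => //; rewrite divr_gt0.
rewrite big_add1 /= .
have := cvgC_scale (2 * Gamma sg * (2 * pi * v%:R) `^ (- sg))%:C
  (cvgC_sum (index_iota 0 v) xpredT (fun j => cvgC_scale (c j.+1) (zs j))).
congr cvgC; apply/funext => N; rewrite mulr_sumr exchange_big /=; apply: eq_bigr => j _.
rewrite /series /= !mulr_sumr; apply: eq_bigr => n _.
rewrite /g /c -!rmorphM; congr (_%:C).
have vn : v%:R != 0 :> R by rewrite gt_eqF.
have e1 : (v * n + j).+1%:R = v%:R * (n%:R + j.+1%:R / v%:R) :> R.
  by rewrite -addnS natrD natrM; field.
have -> : pi * sg / 2 - 2 * pi * (v * n + j).+1%:R * y = pi / 2 * sg - 2 * pi * j.+1%:R * u%:R / v%:R - 2 * pi * (n * u)%:R.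
  by rewrite e1 /y natrM; field.
have -> : (2 * pi * (v * n + j).+1%:R) `^ (- sg) = (2 * pi * v%:R) `^ (- sg) * (n%:R + j.+1%:R / v%:R) `^ (- sg).
  by rewrite -powRM ?mulr_ge0 ?pi_ge0 ?addr_ge0 ?divr_ge0// e1 mulrA.
rewrite cos_sub_2pi; ring.
Qed.

End ReflectionClosed.

(** * Derivatives along the real line *)

Section RealRestriction.
Variable R : realType.
Implicit Types (F : R[i] -> R[i]) (f : R -> R) (b : nat -> R[i]).

Lemma PS_quot F z b r : PS F z b r -> forall e : R, 0 < e ->
  exists2 d : R, 0 < d & forall h, h != 0 -> cabs h < d -> cabs ((F (z + h) - F z) / h - b 1%N) < e.
Proof.
move=> hF e e0; have [dF E] := PS_derive hF.
have c : (fun h : (R[i] : numFieldType) => h^-1 *: ((F (h + z) : (R[i] : numFieldType)) - F z)) @ 0^' --> (b 1%N : (R[i] : numFieldType)).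
  rewrite -E derive1E; move: dF; rewrite /derivable /derive.
  by under eq_fun do rewrite [_ *: 1]mulr1.
have ec : (0 : (R[i] : numFieldType)) < e%:C by rewrite ltcE /= eqxx.
move/(@cvgrPdist_lt _ (R[i] : numFieldType)): c => /(_ _ ec) /dnearCP [d d0 dP].
exists d => // h h0 hd; have := dP h h0 hd; rewrite add0r distrC normCE ltcE /= eqxx /=.
by rewrite /GRing.scale /= [h + z]addrC mulrC.
Qed.

(** Real increments give real difference quotients, so the complex derivative is real and equals the
    real one. *)
Lemma PS_real_derive F f (x : R) b r e : PS F x%:C b r -> 0 < e ->
  (forall h : R, `|h| < e -> F (x + h)%:C = (f (x + h))%:C) ->
  is_derive x 1 f (complex.Re (b 1%N)) /\ b 1%N = (complex.Re (b 1%N))%:C.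
Proof.
move=> hF e0 Ff; have key := PS_quot hF.
have quot (h : R) : h != 0 -> `|h| < e -> (F (x%:C + h%:C) - F x%:C) / h%:C = ((f (x + h) - f x) / h)%:C.
  move=> h0 he; have := Ff 0; rewrite normr0 addr0 => /(_ e0) ->.
  by rewrite -rmorphD Ff// -rmorphB -fmorphV -rmorphM.
have key' (d : R) : 0 < d -> exists2 d' : R, 0 < d' & forall h : R, h != 0 -> `|h| < d' ->
    cabs (((f (x + h) - f x) / h)%:C - b 1%N) < d.
  move=> /key [d' d0 dP]; exists (Num.min d' e); first by rewrite lt_min d0.
  move=> h h0; rewrite lt_min => /andP[hd he]; rewrite -quot//.
  by apply: dP; rewrite ?cabs_real// fmorph_eq0.
split; last first.
  apply/eqP; rewrite eq_complex /= eqxx /= -normr_le0; apply/ler_addgt0Pr => d d0; rewrite add0r.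
  have [d' d'0 /(_ (d' / 2))] := key' d d0.
  rewrite gt_eqF ?divr_gt0// ger0_norm ?divr_ge0 ?(ltW d'0)// => /(_ isT) h.
  have /h h' : d' / 2 < d' by lra.
  by apply: le_trans (ltW h'); apply: le_trans (ler_Im_cabs _); rewrite ImD ImN /= add0r normrN.
have c : (fun h => h^-1 *: (f (h *: 1 + x) - f x)) @ 0^' --> complex.Re (b 1%N).
  apply/cvgrPdist_lt => d d0; have [d' d'0 dP] := key' d d0.
  exists d' => // h /=; rewrite sub0r normrN => hd h0.
  have := dP h h0 hd => /(le_lt_trans (ler_Re_cabs _)).
  by rewrite ReD ReN /= distrC /GRing.scale /= mulr1 [h + x]addrC mulrC.
split; first by apply/cvg_ex; exists (complex.Re (b 1%N)).
exact: (cvg_lim (@norm_hausdorff _ _) c).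
Qed.

(** This connects the real derivatives of [Gamma] with Taylor coefficients. The induction carries
    agreement of the [n]-th derivatives on a whole interval around [s0]. *)
Lemma derive1n_real F f (s0 : R) a r e n : PS F s0%:C a r -> 0 < e ->
  (forall x : R, `|x - s0| < e -> F x%:C = (f x)%:C) ->
  (derive1n n f s0)%:C = n`!%:R * a n.
Proof.
move=> hF e0 Ff; rewrite -(cderiven_PS n hF).
suff [d d0 dP] : exists2 d : R, 0 < d & forall x, `|x - s0| < d -> cderiven n F x%:C = (derive1n n f x)%:C.
  by rewrite dP// subrr normr0.
elim: n => [|n [d d0 ih]]; first by exists e.
have [r' hn] := PS_deriven n hF; have [r'0 _ _] := hn.
(* The interval shrinks: [d / 2] leaves room for agreement around [x], and [r' / 4] for recentring
   the series at [x]. *)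
pose d' := Num.min (d / 2) (r' / 4).
have d'0 : 0 < d' by rewrite lt_min !divr_gt0.
have [m1 m2] : d' <= d / 2 /\ d' <= r' / 4 by rewrite !ge_min !lexx orbT.
exists d' => // x xs.
have r4 : 0 < r' / 4 by rewrite divr_gt0.
have sx : cabs ((x - s0)%:C) + r' / 4 < r' by rewrite cabs_real; lra.
have [b _] := PS_recenter hn r4 sx.
have -> : s0%:C + (x - s0)%:C = x%:C :> R[i] by rewrite rmorphB addrC subrK.
move=> hb; have d20 : 0 < d / 2 by rewrite divr_gt0.
have agree (h : R) : `|h| < d / 2 -> cderiven n F (x + h)%:C = (derive1n n f (x + h))%:C.
  move=> hd; apply: ih; have -> : x + h - s0 = (x - s0) + h by ring.
  by rewrite (le_lt_trans (ler_normD _ _))//; lra.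
have [[_ E] bE] := PS_real_derive hb d20 agree.
have [_] := PS_derive hb; rewrite /cderiven !derive1nS => ->.
by rewrite bE derive1E E.
Qed.

End RealRestriction.

(** * The Gamma function *)

Section GammaSeries.
Variable R : realType.
Local Notation mu := (@lebesgue_measure R).
Local Notation H := (`]0%R, +oo[%classic : set R).
Implicit Types (x y t a m p sg : R) (z : R[i]).

(* The derivative of [- 2 exp (- sqrt t)]. *)
Definition gdom t : R := t `^ (- 2^-1) * expR (- t `^ 2^-1).

Lemma isd_gdom t : 0 < t -> is_derive t 1 (fun u => - 2 * expR (- u `^ 2^-1)) (gdom t).
Proof.
move=> t0; have h := isd_scale (- 2) (isd_exp (isd_scale (-1) (isd_powR 2^-1 t0))).
have h' := isd_eq (g := fun u => - 2 * expR (- u `^ 2^-1)) (fun u => congr1 (fun v => - 2 * expR v) (mulN1r _)) h.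
apply: (is_derive_eq h'); rewrite /gdom mulN1r.
have -> : 2^-1 - 1 = - 2^-1 :> R by field.
by field.
Qed.

Lemma gdom_continuous t : 0 < t -> {for t, continuous gdom}.
Proof.
move=> t0; have h := isd_mul (isd_powR (- 2^-1) t0) (isd_exp (isd_scale (-1) (isd_powR 2^-1 t0))).
apply: isd_continuous (isd_eq _ h) => u; by rewrite /gdom mulN1r.
Qed.

Lemma gdom_ge0 t : 0 <= gdom t.
Proof. by rewrite mulr_ge0 ?powR_ge0 ?expR_ge0. Qed.

(** The half-line is exhausted by [[1 / (n + 1), n + 1]], away from the singularity at [0]; the
    explicit primitive bounds the integrals there, and monotone convergence concludes. *)
Lemma gdom_integrable : mu.-integrable H (EFin \o gdom).
Proof.
have mg : measurable_fun H gdom by apply: measurable_continuous => t; exact: gdom_continuous.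
apply/integrableP; split; first exact/measurable_EFinP.
under eq_integral => t _ do rewrite /= ger0_norm ?gdom_ge0//.
pose F (n : nat) : set R := `[n.+1%:R^-1, n.+1%:R]%classic.
have ni n : 0 < n.+1%:R^-1 :> R by rewrite invr_gt0.
have FH n : F n `<=` H.
  by move=> t; rewrite /F /= !in_itv /= andbT => /andP[h _]; exact: lt_le_trans h.
have UF : \bigcup_n F n = H.
  apply/seteqP; split => [t [n _ /FH]//|t]; rewrite /= in_itv /= andbT => t0.
  pose n := Num.truncn (t + t^-1); exists n => //; rewrite /F /= in_itv /=.
  have h : t + t^-1 < n.+1%:R by rewrite truncnS_gt.
  have ti : 0 < t^-1 by rewrite invr_gt0.
  apply/andP; split; last by rewrite ltW// (lt_trans _ h)// ltrDl.
  by rewrite -[leRHS]invrK lef_pV2 ?posrE// ltW// (lt_trans _ h)// ltrDr.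
have nF : nondecreasing_seq F.
  move=> n m nm; apply/subsetPset => t; rewrite /F /= !in_itv /= => /andP[h1 h2].
  apply/andP; split; last by rewrite (le_trans h2)// ler_nat.
  by rewrite (le_trans _ h1)// lef_pV2 ?posrE// ler_nat.
have c : (\int[mu]_(x in F i) (gdom x)%:E @[i --> \oo] --> \int[mu]_(x in H) (gdom x)%:E)%E.
  rewrite -UF; apply: ge0_nondecreasing_set_cvg_integral => // [n|n|n t _].
  - exact: measurable_itv.
  - by apply/measurable_EFinP; exact: measurable_funS (FH n) mg.
  - by rewrite lee_fin gdom_ge0.
apply: (@le_lt_trans _ _ 2%:E); last by rewrite ltry.
rewrite -(cvg_lim _ c)//; apply: lime_le; first by apply/cvg_ex; eexists; exact: c.
(* For [n = 0] the interval is the point [1]; otherwise the primitive takes values between [-2] and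
   [0]. *)
apply: nearW => n; have [->|n0] := posnP n.
  rewrite /F invr1 set_itv1 integral_set1// lee_fin//.
rewrite (continuous_FTC2 (F := fun u => - 2 * expR (- u `^ 2^-1))).
- rewrite -EFinB lee_fin.
  set A := expR _; set B := expR _; have A0 : 0 < A by exact: expR_gt0.
  have : B <= 1 by rewrite /B expR_le1 oppr_le0 powR_ge0.
  lra.
- have n1 : 1 < n.+1%:R :> R by rewrite ltr1n ltnS.
  by rewrite (lt_trans _ n1)// invf_lt1// (lt_trans ltr01).
- apply: continuous_in_subspaceT => t; rewrite inE /= in_itv /= => /andP[h _].
  by apply: gdom_continuous; exact: lt_le_trans h.
- split.
  + move=> t; rewrite in_itv /= => /andP[h _].
    by case: (isd_gdom (lt_trans (ni n) h)).
  + by apply: cvg_at_right_filter; exact: isd_continuous (isd_gdom (ni n)).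
  + by apply: cvg_at_left_filter; exact: isd_continuous (isd_gdom (ltr0Sn R n)).
- move=> t; rewrite in_itv /= => /andP[h _].
  by rewrite derive1E; case: (isd_gdom (lt_trans (ni n) h)).
Qed.

(** Domination for increments of size up to [1/2]: [exp (|ln t| / 2)] is [t^(-1/2)] for [t <= 1] and
    [t^(-1/2) t] for [t > 1]; the factor [t^(-1/2)] is then common to both sides. *)
Lemma gamma_le_gdom s0 t n : 1 <= s0 <= n%:R -> 0 < t ->
  expR (2^-1 * `|ln t|) * (t `^ (s0 - 1) * expR (- t)) <= 2 ^+ n * n`!%:R * expR 1 * gdom t.
Proof.
move=> /andP[s01 s0n] t0; rewrite /gdom.
have C0 : 1 <= 2 ^+ n * n`!%:R :> R.
  by rewrite -[X in X <= _](mulr1 1) ler_pM ?ler01 ?exprn_ege1 ?ler1n ?fact_gt0.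
have hp : 0 < t `^ (- 2^-1) by rewrite powR_gt0.
set r := t `^ 2^-1.
have [t1|t1] := lerP t 1.
  rewrite ler0_norm ?ln_le0//.
  have -> : expR (2^-1 * - ln t) = t `^ (- 2^-1) by rewrite /powR gt_eqF// mulrN mulNr.
  have -> : 2 ^+ n * n`!%:R * expR 1 * (t `^ (- 2^-1) * expR (- r)) =
    t `^ (- 2^-1) * (2 ^+ n * n`!%:R * expR (1 - r)) by rewrite expRD; ring.
  rewrite ler_wpM2l ?(ltW hp)//.
  have a1 : t `^ (s0 - 1) <= 1.
    rewrite /powR gt_eqF// -[X in _ <= X]expR0 ler_expR; have := ln_le0 t1.
    have : 0 <= s0 - 1 by rewrite subr_ge0.
    nra.
  have a2 : expR (- t) <= 1 by rewrite -expR0 ler_expR oppr_le0 ltW.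
  have a3 : 1 <= expR (1 - r).
    rewrite -[X in X <= _]expR0 ler_expR subr_ge0 /r /powR gt_eqF// -expR0 ler_expR.
    by rewrite mulr_ge0_le0 ?invr_ge0// ln_le0.
  apply: (@le_trans _ _ (1 * 1)); first by apply: ler_pM; rewrite ?powR_ge0 ?expR_ge0.
  by apply: ler_pM; rewrite ?ler01.
rewrite ger0_norm ?ln_ge0 ?(ltW t1)//.
have -> : expR (2^-1 * ln t) = t `^ (- 2^-1) * t.
  by rewrite /powR gt_eqF// -{3}(lnK (x := t)) ?posrE// -expRD; congr expR; field.
have rr : r * r = t.
  rewrite /r -powRD; last by rewrite gt_eqF// implybT.
  have -> : 2^-1 + 2^-1 = 1 :> R by field.
  by rewrite powRr1// ltW.
have -> : t `^ (- 2^-1) * t * (t `^ (s0 - 1) * expR (- t)) = t `^ (- 2^-1) * (t `^ s0 * expR (- t)).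
  by rewrite -(mulr_powRB1 (ltW t0) (lt_le_trans ltr01 s01)); ring.
have -> : 2 ^+ n * n`!%:R * expR 1 * (t `^ (- 2^-1) * expR (- r)) =
    t `^ (- 2^-1) * (2 ^+ n * n`!%:R * expR (1 - r)) by rewrite expRD; ring.
rewrite ler_wpM2l ?(ltW hp)//.
have b1 : t `^ s0 <= 2 ^+ n * n`!%:R * expR (t / 2).
  apply: (@le_trans _ _ (t ^+ n)).
    by rewrite -powR_mulrn ?(ltW t0)// ler_powR// ltW.
  have -> : t ^+ n = 2 ^+ n * (t / 2) ^+ n by rewrite -exprMn mulrC divfK ?pnatr_eq0.
  rewrite -mulrA ler_wpM2l ?exprn_ge0//; have t2 : 0 <= t / 2 by rewrite divr_ge0// ltW.
  by rewrite [leRHS]mulrC -ler_pdivrMr ?ltr0n ?fact_gt0//; exact: exp_term_le.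
apply: (@le_trans _ _ (2 ^+ n * n`!%:R * expR (t / 2) * expR (- t))).
  by rewrite ler_wpM2r ?expR_ge0.
rewrite -mulrA -expRD ler_wpM2l ?mulr_ge0 ?exprn_ge0// ler_expR.
(* This gives [- t / 2 <= 1 - r], as [t = r^2]. *)
have : 0 <= (r - 1) ^+ 2 by exact: sqr_ge0.
rewrite sqrrB1 expr2 rr; lra.
Qed.

(** Expansion under the integral sign of [t^(s0 + h - 1) = t^(s0 - 1) exp (h ln t)], by the same
    argument as for [V]. *)
Lemma gamma_PS s0 : 1 <= s0 -> exists f (a : nat -> R) (r : R), PS f s0%:C (fun k => (a k)%:C) r /\
  forall x, `|x - s0| < 2^-1 -> f x%:C = (Gamma x)%:C.
Proof.
move=> s01; have [n s0n] : exists n : nat, s0 <= n%:R.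
  by exists (Num.truncn s0).+1; rewrite ltW// truncnS_gt.
have s0P : 1 <= s0 <= n%:R by rewrite s01.
(* The factor [i] in [g] undoes the imaginary part taken in [laplace_coef]. *)
pose la t : R[i] := (ln t)%:C; pose g t : R[i] := 0 +i* (t `^ (s0 - 1) * expR (- t)).
pose K : R := 2 ^+ n * n`!%:R * expR 1.
pose G t := K * gdom t.
have mD : measurable H by exact: measurable_itv.
have rho0 : (0 : R) < 2^-1 by rewrite invr_gt0.
have mla : cmeasurable H la.
  split; last exact: measurable_cst.
  apply: measurable_continuous => t t0.
  exact: (isd_continuous (isd_ln (isd_id t) t0)).
have mg : cmeasurable H g.
  split; first exact: measurable_cst.
  apply: measurable_continuous => t t0.
  exact: isd_continuous (isd_mul (isd_powR (s0 - 1) t0) (isd_expN t)).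
have iG : mu.-integrable H (EFin \o G).
  exact: (@integrableZl _ _ _ mu H mD K _ gdom_integrable).
have laG t : H t -> expR (2^-1 * cabs (la t)) * cabs (g t) <= G t.
  rewrite /= in_itv /= andbT => t0; rewrite cabs_real.
  have -> : cabs (g t) = t `^ (s0 - 1) * expR (- t).
    have -> : g t = 'i * (t `^ (s0 - 1) * expR (- t))%:C.
      by apply/eqP; rewrite eq_complex /=; apply/andP; split; apply/eqP; ring.
    rewrite cabsM cabs_real ger0_norm ?mulr_ge0 ?powR_ge0 ?expR_ge0//.
    by rewrite /cabs /= expr0n expr1n add0r sqrtr1 mul1r.
  exact: gamma_le_gdom.
pose a k := laplace_coef H la g k.
have ab k : `|a k| * 2^-1 ^+ k <= \int[mu]_(t in H) G t := laplace_coef_bound mD rho0 mla mg iG laG k.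
have ac h : `|h| <= 2^-1 -> series (fun k => a k * h ^+ k) @ \oo --> Gamma (s0 + h).
  move=> hr; have := laplace_cvg mD rho0 mla mg iG laG hr.
  suff -> : \int[mu]_(t in H) complex.Im (cexp (h%:C * la t) * g t) = Gamma (s0 + h) by [].
  apply: eq_Rintegral => t; rewrite inE /= in_itv /= andbT => t0.
  rewrite !(mul0r, mulr0, subr0, addr0) cos0 mulr1 mulrA; congr (_ * _).
  rewrite /powR gt_eqF// -expRD; congr expR; ring.
have ab' k : cabs (a k)%:C * 2^-1 ^+ k <= \int[mu]_(t in H) G t by rewrite cabs_real.
pose f z : R[i] := xget 0 [set l | series (fun k => (a k)%:C * (z - s0%:C) ^+ k) ~> l].
have fP z l : series (fun k => (a k)%:C * (z - s0%:C) ^+ k) ~> l -> f z = l.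
  move=> zl; rewrite /f; case: xgetP => [l' _ hl|/(_ l)//]; exact: cvgC_unique hl zl.
exists f, a, 2^-1; split.
  split=> //; first by eexists; exact: ab'.
  move=> h hr; have hh : 0 <= cabs h < 2^-1 by rewrite cabs_ge0.
  have [B BP] := geometric_coef_bound rho0 hh ab'.
  have [|l hl _] := @abs_seriesC R (fun k => (a k)%:C * h ^+ k) B.
    by move=> m; apply: le_trans (BP m); rewrite le_eqVlt; apply/orP; left; apply/eqP;
       apply: eq_bigr => k _; rewrite cabsM cabsX.
  by rewrite (fP _ l)// addrC addKr.
move=> x xs; apply: fP; rewrite -rmorphB.
have xE : s0 + (x - s0) = x by rewrite addrC subrK.
have := cvgC_real (ac _ (ltW xs)); rewrite xE; congr cvgC; apply/funext => m.
by rewrite /series /= rmorph_sum; apply: eq_bigr => k _; rewrite rmorphM rmorphXn.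
Qed.

End GammaSeries.

(** * The function H *)

Section FunctionH.
Variable R : realType.
Implicit Types (x y t : R) (z w h : R[i]) (f g : R[i] -> R[i]).

Lemma PS_shift f z (a : nat -> R[i]) (r : R) : PS f z a r ->
  PS (fun s => if s == z then a 1%N else (f s - a 0%N) / (s - z)) z (fun k => a k.+1) r.
Proof.
move=> [r0 [M aM] H]; split => //.
  exists (M / r) => k; rewrite ler_pdivlMr// -mulrA -exprSr; exact: aM.
move=> h hr; have zh : z + h - z = h by rewrite addrC addKr.
case: eqP => [/eqP E|/eqP h0].
  have -> : h = 0 by apply/eqP; rewrite -subr_eq0 -{1}zh subr_eq0; rewrite -[X in _ == X]addr0 in E; move: E; rewrite zh -(inj_eq (addrI z)) addr0.
  have := @series_finite _ (fun k => a k.+1 * 0 ^+ k) 1%N; rewrite big_nat1 expr0 mulr1.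
  by apply; case => // k _; rewrite expr0n mulr0.
have h0' : h != 0 by apply: contra h0 => /eqP ->; rewrite addr0.
rewrite zh; have := H h hr; rewrite -(cvgC_shift _ _ 1%N) => c1.
have := cvgC_scale h^-1 (cvgC_sub c1 (cvgC_cst (a 0%N))); rewrite mulrC; congr cvgC; apply/funext => n.
rewrite /series /= addn1 big_nat_recl//= expr0 mulr1 addrC addKr mulr_sumr.
by apply: eq_bigr => k _; rewrite exprS; field.
Qed.

Lemma ccos_real x : ccos x%:C = (cos x)%:C.
Proof.
have e1 : 'i * x%:C = 0 +i* x :> R[i].
  by apply/eqP; rewrite eq_complex /=; apply/andP; split; apply/eqP; ring.
have e2 : - (0 +i* x) = 0 +i* (- x) :> R[i] by apply/eqP; rewrite eq_complex /= oppr0 !eqxx.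
rewrite /ccos e1 e2 /cexp /= expR0 !mul1r cosN sinN.
have -> : (cos x +i* sin x) + (cos x +i* - sin x) = 2 * (cos x)%:C :> R[i].
  by apply/eqP; rewrite eq_complex /=; apply/andP; split; apply/eqP; ring.
by rewrite mulrAC mulfV ?mul1r// pnatr_eq0.
Qed.

Lemma PS_ccos (c d z : R[i]) (r : R) : 0 < r -> exists b, PS (fun s => ccos (c * s - d)) z b r.
Proof.
move=> r0; have h1 := PS_cexp ('i * c) z r0; have h2 := PS_cexp (- ('i * c)) z r0.
have h := PS_add (PS_scale (cexp (- ('i * d)) / 2) h1) (PS_scale (cexp ('i * d) / 2) h2).
eexists; apply: (PS_ext _ h) => s _ /=.
have -> : cexp (- ('i * d)) / 2 * cexp ('i * c * (z + s)) = cexp ('i * (c * (z + s) - d)) / 2.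
  by rewrite mulrAC -cexpD; congr (cexp _ / 2); ring.
have -> : cexp ('i * d) / 2 * cexp (- ('i * c) * (z + s)) = cexp (- ('i * (c * (z + s) - d))) / 2.
  by rewrite mulrAC -cexpD; congr (cexp _ / 2); ring.
by rewrite -mulrDl.
Qed.

Lemma sin_sub_2pi k x : sin (x - 2 * pi * k%:R) = sin x.
Proof.
elim: k => [|k ih]; first by rewrite mulr0 subr0.
rewrite -[RHS]ih; have -> : x - 2 * pi * k%:R = x - 2 * pi * k.+1%:R + pi + pi.
  by rewrite -addn1 natrD; ring.
by rewrite !sinDpi opprK.
Qed.

(** The terms are odd under [k -> v - k]. As [cos (pi / 2 - t) = sin t], this is the residue at
    [s = 1] of the sum defining [H]; its vanishing makes the singularity removable. *)
Lemma sin_sum u v : (0 < v)%N ->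
  \sum_(1 <= k < v.+1) sin (2 * pi * k%:R * u%:R / v%:R) = 0 :> R.
Proof.
move=> v0; have vn : v%:R != 0 :> R by rewrite pnatr_eq0 -lt0n.
pose s k : R := sin (2 * pi * k%:R * u%:R / v%:R).
have s0 : s 0%N = 0 by rewrite /s mulr0 !mul0r sin0.
have sN k : (k <= v)%N -> s (v - k)%N = - s k.
  move=> kv; rewrite /s natrB//.
  have -> : 2 * pi * (v%:R - k%:R) * u%:R / v%:R = 2 * pi * u%:R - 2 * pi * k%:R * u%:R / v%:R :> R by field.
  by rewrite -opprB sinN sin_sub_2pi.
have sv : s v = 0 by have := sN 0%N isT; rewrite subn0 s0 oppr0.
have E1 : \sum_(1 <= k < v.+1) s k = \sum_(0 <= k < v) s k.
  by rewrite big_nat_recr//= sv addr0 [RHS]big_ltn// s0 add0r.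
have E2 : \sum_(1 <= k < v.+1) s k = - \sum_(0 <= k < v) s k.
  rewrite big_add1 /= big_nat_rev /= -sumrN; apply: eq_big_nat => k /andP[_ kv].
  by rewrite add0n -subSn// subSS sN// ltnW.
change (\sum_(1 <= k < v.+1) s k = 0); move: E1 E2; lra.
Qed.

Lemma entire_quotient f : (forall z r, 0 < r -> exists b, PS f z b r) -> f 1 = 0 ->
  exists2 g, entire g & forall s, s != 1 -> g s = f s / (s - 1).
Proof.
move=> fE f1; have [b hb] := fE 1 1 ltr01.
have b0 : b 0%N = 0 by rewrite -(PS_val hb).
have := PS_shift hb; set g := fun s => _ => hg; exists g; last first.
  by move=> s s1; rewrite /g (negbTE s1) b0 subr0.
move=> z; apply/analytic_PS; have [->|z1] := eqVneq z 1; first by eexists; eexists; exact: hg.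
have c0 : 0 < cabs (1 - z) by rewrite cabs_gt0 subr_eq0 eq_sym.
have [d hd] := fE z (cabs (1 - z)) c0.
have rr : 0 < cabs (1 - z) / 2 < cabs (1 - z) by apply/andP; split; lra.
have n1 : 1 != z by rewrite eq_sym.
have h := PS_mul rr hd (PS_inv n1).
exists (cauchy_prod d (fun j => - (1 - z)^-1 ^+ j.+1)), (cabs (1 - z) / 2).
apply: (PS_ext _ h) => k kr; rewrite /g ifN ?b0 ?subr0//.
apply: contraTneq kr => E; have -> : k = 1 - z by rewrite -E addrC addKr.
by rewrite -leNgt; lra.
Qed.

Definition Hnum (u v : nat) z : R[i] := \sum_(1 <= k < v.+1)
   ccos ((pi / 2)%:C * z - (2 * pi * k%:R * u%:R / v%:R)%:C) * Eh (k%:R / v%:R) z.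

Lemma Hnum_PS u v z (r : R) : (0 < v)%N -> 0 < r -> exists b, PS (Hnum u v) z b r.
Proof.
move=> v0 r0; have r1 : 0 < r + 1 by rewrite addr_gt0.
have rr : 0 < r < r + 1 by rewrite r0 ltrDl ltr01.
suff : forall N, exists b, PS (fun z => \sum_(1 <= k < N.+1)
   ccos ((pi / 2)%:C * z - (2 * pi * k%:R * u%:R / v%:R)%:C) * Eh (k%:R / v%:R) z) z b r.
  exact.
elim=> [|N [b ih]].
  exists (fun k => if k == 0%N then 0 else 0); apply: (PS_ext _ (PS_cst 0 z r0)) => h _.
  by rewrite big_geq.
have y0 : 0 < N.+1%:R / v%:R :> R by rewrite divr_gt0 ?ltr0n.
have [b1 h1] := PS_ccos (pi / 2)%:C (2 * pi * N.+1%:R * u%:R / v%:R)%:C z r1.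
have [b2 h2] := PS_Eh z y0 r1.
eexists; apply: (PS_ext _ (PS_add ih (PS_mul rr h1 h2))) => h _.
by rewrite [RHS]big_nat_recr.
Qed.

(** [Hnum] divided by [s - 1] shows existence, so the choice operator in [Hfun] returns a function
    with the defining properties and not its default. *)
Lemma HfunP u v : (1 <= u <= v)%N -> entire (Hfun u v : R[i] -> R[i]) /\
  forall s : R[i], s != 1 -> Hfun u v s = \sum_(1 <= k < v.+1)
        ccos ((pi / 2)%:C * s - (2 * pi * k%:R * u%:R / v%:R)%:C) * Zh (k%:R / v%:R) s.
Proof.
move=> /andP[u1 uv]; have v0 : (0 < v)%N by exact: leq_trans uv.
have n1 : Hnum u v 1 = 0.
  rewrite /Hnum; have E k : ccos ((pi / 2)%:C * 1 - (2 * pi * k%:R * u%:R / v%:R)%:C) * Eh (k%:R / v%:R) 1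
     = (sin (2 * pi * k%:R * u%:R / v%:R))%:C :> R[i].
    by rewrite Eh1 !mulr1 -rmorphB ccos_real cosB cos_pihalf sin_pihalf mul0r add0r mul1r.
  by under eq_bigr do rewrite E; rewrite -rmorph_sum sin_sum.
have [g ge gP] := entire_quotient (fun z r => @Hnum_PS u v z r v0) n1.
have E s k : s != 1 -> (1 <= k < v.+1)%N -> hurwitz_zeta (k%:R / v%:R) s = Zh (k%:R / v%:R : R) s.
  by move=> s1 /andP[k1 _]; rewrite hurwitzE// divr_gt0 ?ltr0n.
rewrite /Hfun; case: xgetP => [f _ [fe fP]|/(_ g) []].
  by split=> // s s1; rewrite fP//; apply: eq_big_nat => k kv; rewrite E.
split=> // s s1; rewrite gP// /Hnum mulr_suml; apply: eq_big_nat => k kv.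
by rewrite E// /Zh mulrA.
Qed.

End FunctionH.

(** * Taylor coefficients of the Hurwitz zeta function at non-positive integers *)

Section Bracket.
Variable R : realType.
Implicit Types (x y t : R) (z w h : R[i]) (A B C : nat -> R[i]).

Lemma cauchy_prodE A B j n : (j <= n)%N ->
  cauchy_prod A B j = \sum_(a < n.+1) \sum_(b < n.+1 | (a + b)%N == j) A a * B b.
Proof.
move=> jn; rewrite /cauchy_prod big_mkord (big_ord_widen n.+1 (fun i => A i * B (j - i)%N)) ?ltnS//.
rewrite [LHS]big_mkcond /=; apply: eq_bigr => a _; rewrite ltnS; case: leqP => aj.
  rewrite (big_pred1 (inord (j - a))) => [|b]; first by rewrite inordK// ltnS (leq_trans (leq_subr _ _)).
  have ja : (j - a < n.+1)%N by rewrite ltnS (leq_trans (leq_subr _ _)).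
  apply/eqP/eqP => [E|->]; last by rewrite inordK// subnKC.
  by apply/val_inj; rewrite /= inordK// -E addKn.
rewrite big_pred0// => b; apply/negbTE/eqP => E.
by move: aj; rewrite -E ltnNge leq_addr.
Qed.

(** Brings the coefficients of a product of three series to the summation over [a + b + c = j] of
    the theorem. *)
Lemma cauchy_prod3 A B C j : cauchy_prod (cauchy_prod A B) C j =
  \sum_(a < j.+1) \sum_(b < j.+1) \sum_(c < j.+1 | (a + b + c)%N == j) A a * B b * C c.
Proof.
rewrite (cauchy_prodE _ _ (leqnn j)).
(* The intermediate degree [i = a + b] is kept as a summation index and removed last. *)
transitivity (\sum_(i < j.+1) \sum_(a < j.+1) \sum_(b < j.+1) \sum_(c < j.+1)
    (if ((a + b)%N == i) && ((i + c)%N == j) then A a * B b * C c else 0)).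
  apply: eq_bigr => i _; rewrite big_mkcond /=.
  transitivity (\sum_(c < j.+1) \sum_(a < j.+1) \sum_(b < j.+1)
      (if ((a + b)%N == i) && ((i + c)%N == j) then A a * B b * C c else 0)).
    apply: eq_bigr => c _; case: eqP => E; last first.
      by rewrite big1// => a _; rewrite big1// => b _; rewrite andbF.
    rewrite (cauchy_prodE A B (_ : i <= j)%N) -1?ltnS// mulr_suml; apply: eq_bigr => a _.
    rewrite mulr_suml [LHS]big_mkcond /=; apply: eq_bigr => b _.
    by rewrite andbT; case: ifP.
  rewrite exchange_big /=; apply: eq_bigr => a _; exact: exchange_big.
rewrite exchange_big /=; apply: eq_bigr => a _; rewrite exchange_big /=; apply: eq_bigr => b _.
rewrite exchange_big /= [RHS]big_mkcond /=; apply: eq_bigr => c _.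
case: eqP => E.
  have := leq_addr c (a + b); rewrite E => ab'; have ab : (a + b < j.+1)%N by [].
  rewrite (bigD1 (Ordinal ab))//= eqxx E eqxx /= big1 ?addr0// => i ii.
  by rewrite ifF//; apply/negbTE; rewrite negb_and; apply/orP; left; apply: contra ii => /eqP h; apply/eqP/val_inj.
rewrite big1// => i _; case: eqP => //= e1; case: eqP => // e2.
by case: E; rewrite e1 e2.
Qed.

(** What the theorem puts in place of the [j]-th derivative of [zeta (s, u / v)] at [s = - M]. *)
Definition bracket (M u v j : nat) : R[i] :=
  (-1) ^+ j * 2 *
   (\sum_(a < j.+1) \sum_(b < j.+1) \sum_(c < j.+1 | (a + b + c)%N == j)
      j`!%:R / (a`! * b`! * c`!)%:R *
      (derive1n a (@Gamma R) (M + 1)%:R *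
       (- ln (2 * pi * v%:R)) ^+ b *
       (2 * pi * v%:R) ^- (M + 1))%:C *
      cderiven c (Hfun u v) (M + 1)%:R).

(** [hurwitz_reflection] concerns real arguments above [1]; as [PS_unique] compares at [t0 + t] with
    [t > 0], the boundary case [t0 = 1], that is [M = 0], is included. *)
Lemma bracket_PS M u v : (1 <= u <= v)%N -> exists d r,
  PS (Zh (u%:R / v%:R)) (- M%:R) d r /\ forall j, j`!%:R * d j = bracket M u v j.
Proof.
move=> uvP; have /andP[u1 uv] := uvP; have v0 : (0 < v)%N by exact: leq_trans uv.
have y0 : 0 < u%:R / v%:R :> R by rewrite divr_gt0 ?ltr0n.
pose K : R := 2 * pi * v%:R; have K0 : 0 < K by rewrite !mulr_gt0 ?pi_gt0 ?ltr0n.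
pose t0 : R := (M + 1)%:R.
have t01 : 1 <= t0 by rewrite ler1n addn1.
have zn : - M%:R != 1 :> R[i].
  by rewrite -subr_eq0 -opprD oppr_eq0 natr1 pnatr_eq0.
have c0 : 0 < cabs (1 - - M%:R : R[i]) by rewrite cabs_gt0 subr_eq0 eq_sym.
have [|d hd] := @Zh_PS R _ (- M%:R) (cabs (1 - - M%:R : R[i]) / 2) y0 zn; first by apply/andP; split; lra.
exists d; eexists; split; first exact: hd.
have [f [g [rg [hf fG]]]] := gamma_PS t01.
have [He HE] := @HfunP R u v uvP.
have [hc [rh hH]] := (analytic_PS _ _).1 (He t0%:C).
have hK := PS_cpowN K t0%:C ltr01.
have [r1 h1] := PS_prod_exists hf hK; have [r2 h2] := PS_prod_exists h1 hH.
have {}h2 := PS_scale 2 h2.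
have m1 : -1 != 0 :> R[i] by rewrite oppr_eq0 oner_eq0.
have zE : -1 * t0%:C + 1 = - M%:R :> R[i].
  by rewrite /t0 natrD rmorphD rmorph1 rmorph_nat; ring.
have hd' : PS (Zh (u%:R / v%:R)) (-1 * t0%:C + 1) d (cabs (1 - - M%:R : R[i]) / 2) by rewrite zE.
(* The substitution [s = 1 - t] multiplies the [j]-th coefficient by [(-1)^j]. *)
have hL := PS_affine m1 hd'.
have agree t : 0 < t < 2^-1 -> Zh (u%:R / v%:R) (-1 * (t0%:C + t%:C) + 1) =
    2 * (f (t0%:C + t%:C) * cpow K (- (t0%:C + t%:C)) * Hfun u v (t0%:C + t%:C)).
  move=> /andP[tp t2]; have -> : t0%:C + t%:C = (t0 + t)%:C by exact: (esym (rmorphD (real_complex R) t0 t)).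
  have sg1 : 1 < t0 + t by lra.
  have n1 : (t0 + t)%:C != 1 :> R[i] by rewrite fmorph_eq1 gt_eqF.
  rewrite mulN1r addrC (hurwitz_reflection sg1 uvP) HE// fG; last first.
    have -> : t0 + t - t0 = t by ring.
    by rewrite gtr0_norm.
  rewrite -rmorphN cpow_real//.
  have -> : \sum_(1 <= k < v.+1) ccos ((pi / 2)%:C * (t0 + t)%:C - (2 * pi * k%:R * u%:R / v%:R)%:C) * Zh (k%:R / v%:R) (t0 + t)%:C
    = \sum_(1 <= k < v.+1) (cos (pi / 2 * (t0 + t) - 2 * pi * k%:R * u%:R / v%:R))%:C * Zh (k%:R / v%:R) (t0 + t)%:C.
    by apply: eq_bigr => k _; rewrite -rmorphM -rmorphB ccos_real.
  by rewrite !rmorphM rmorph_nat -/K; ring.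
have e20 : (0 : R) < 2^-1 by rewrite invr_gt0.
have dE := PS_unique hL h2 e20 agree.
move=> j; have := congr1 (fun F => (-1) ^+ j * F j) dE => /=.
have s2 : (-1) ^+ j * (-1) ^+ j = 1 :> R[i] by rewrite -expr2 sqrr_sign.
have -> : (-1) ^+ j * (d j * (-1) ^+ j) = d j by rewrite mulrCA s2 mulr1.
move=> ->; rewrite /bracket cauchy_prod3.
have -> S : j`!%:R * ((-1) ^+ j * (2 * S)) = (-1) ^+ j * 2 * (j`!%:R * S) :> R[i] by ring.
congr (_ * _); rewrite mulr_sumr; apply: eq_bigr => a _; rewrite mulr_sumr; apply: eq_bigr => b _.
rewrite mulr_sumr; apply: eq_bigr => c _.
have e0 : (0 : R) < 2^-1 by rewrite invr_gt0.
have hG := derive1n_real a hf e0 fG; rewrite /t0 in hG.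
have tE : (M + 1)%:R = t0%:C :> R[i] by rewrite /t0 rmorph_nat.
have cM p q : (p * q)%:C = p%:C * q%:C :> R[i] by rewrite rmorphM.
rewrite tE (cderiven_PS c hH) !cM hG natrM natrM.
have KE : cpow K (- t0%:C) = (K ^- (M + 1))%:C.
  by rewrite -rmorphN cpow_real// /t0 powRN powR_mulrn// ltW.
rewrite KE.
have -> : ((- ln (2 * pi * v%:R)) ^+ b)%:C = (- (ln K)%:C) ^+ b :> R[i] by rewrite rmorphXn rmorphN.
have fn k : k`!%:R != 0 :> R[i] by rewrite pnatr_eq0 -lt0n fact_gt0.
rewrite -/K; have alg (J A B C G L k h : R[i]) : A != 0 -> B != 0 -> C != 0 ->
    J * (G * (k * (L / B)) * h) = J / (A * B * C) * (A * G * L * k) * (C * h).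
  by move=> A0 B0 C0; field; rewrite A0 B0 C0.
exact: alg.
Qed.

End Bracket.

(** * The Barnes zeta function *)

Section LaurentClosure.
Variable R : realType.
Implicit Types (f g k : R[i] -> R[i]) (a b : nat -> R[i]) (z h : R[i]).

Lemma laurent_add f g z : laurent f z -> laurent g z -> laurent (fun s => f s + g s) z.
Proof.
move=> [m [k [a [r [ka fk]]]]] [m' [k' [a' [r' [ka' fk']]]]].
have [r0 _ _] := ka; have [r'0 _ _] := ka'.
have [r1 h1] := PS_prod_exists ka (PS_Xsub z m' r0).
have [r2 h2] := PS_prod_exists ka' (PS_Xsub z m r'0).
have [r3 h3] := PS_add_exists h1 h2; have [r30 _ _] := h3.
pose r4 : R := Num.min (Num.min r r') r3.
have r40 : 0 < r4 by rewrite !lt_min r0 r'0 r30.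
have [l1 l2 l3] : [/\ r4 <= r, r4 <= r' & r4 <= r3] by rewrite /r4 !ge_min !lexx !orbT.
exists (m + m')%N; eexists; eexists; exists r4; split.
  by apply: PS_le h3; rewrite r40 l3.
move=> h h0 hr /=; have -> : z + h - z = h by rewrite addrC addKr.
by rewrite -(fk h h0 (lt_le_trans hr l1)) -(fk' h h0 (lt_le_trans hr l2)) exprD; ring.
Qed.

Lemma laurent_cst c z : laurent (fun=> c : R[i]) z.
Proof. exact: PS_laurent (PS_cst c z ltr01). Qed.

Lemma laurent_sum (I : Type) (s : seq I) (F : I -> R[i] -> R[i]) z :
  (forall i, laurent (F i) z) -> laurent (fun t => \sum_(i <- s) F i t) z.
Proof.
move=> hF; elim: s => [|i s ih].
  have -> : (fun t => \sum_(i <- [::]) F i t) = (fun=> 0) by apply/funext => t; rewrite big_nil.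
  exact: laurent_cst.
have -> : (fun t => \sum_(j <- i :: s) F j t) = (fun t => F i t + \sum_(j <- s) F j t).
  by apply/funext => t; rewrite big_cons.
exact: laurent_add.
Qed.

Lemma laurent_mul f g z b (r' : R) : laurent f z -> PS g z b r' -> laurent (fun s => g s * f s) z.
Proof.
move=> [m [k [a [r [ka fk]]]]] hg; have [r0 _ _] := ka.
have [r1 h1] := PS_prod_exists hg ka; have [r10 _ _] := h1.
exists m; eexists; eexists; exists (Num.min r r1); split.
  by apply: PS_le h1; rewrite lt_min r0 r10 ge_min lexx orbT.
by move=> h h0; rewrite lt_min => /andP[hr _]; rewrite -mulrA fk.
Qed.

Lemma laurent_translate f c z : laurent f (z + c) -> laurent (fun s => f (s + c)) z.
Proof.
move=> [m [k [a [r [ka fk]]]]]; exists m, (fun s => k (s + c)), a, r; split.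
  have [r0 M H] := ka; split => // h hr; rewrite addrAC; exact: H.
by move=> h h0 hr; rewrite addrAC fk// addrAC.
Qed.

Lemma PS_translate f c z a (r : R) : PS f (z + c) a r -> PS (fun s => f (s + c)) z a r.
Proof. by move=> [r0 M H]; split => // h hr; rewrite addrAC; exact: H. Qed.

(* Sums of meromorphic functions may have removable singularities; away from its poles
   [g] is assumed to be analytic only where the sequence converges. *)
Lemma continuation_laurent (sigma : R) (F : R[i] -> nat -> R[i]) g z a (r : R) :
  (forall w, laurent g w) -> (forall w, sigma < complex.Re w -> exists b (q : R), PS g w b q) ->
  (forall s, sigma < complex.Re s -> F s ~> g s) ->
  PS g z a r -> exists r', PS (continuation sigma F) z a r'.
Proof.
move=> gl gan Fg hg; have [g' g'm g'E] := meromorphic_of_laurent gl.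
have Fg' s : sigma < complex.Re s -> F s ~> g' s.
  by move=> hs; have [b [q hb]] := gan s hs; rewrite (g'E _ _ _ hb); exact: Fg.
have [r0 _ _] := hg; have r2 : 0 < r / 2 <= r by apply/andP; split; lra.
have hg' : PS g' z a (r / 2).
  apply: PS_ext (PS_le r2 hg) => h hr.
  have q0 : 0 < r / 4 by rewrite divr_gt0.
  have dr : cabs h + r / 4 < r by lra.
  by have [b _ hb] := PS_recenter hg q0 dr; rewrite (g'E _ _ _ hb).
exact: continuation_PS g'm Fg' hg'.
Qed.

End LaurentClosure.

(** * Counting multi-indices by their sum *)

Section Counting.

Lemma hockey_stick n M : (\sum_(0 <= i < M.+1) 'C(i + n, n) = 'C(M + n.+1, n.+1))%N.
Proof.
elim: M => [|M ih]; first by rewrite big_nat1 !add0n !binn.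
by rewrite big_nat_recr//= ih [(M.+1 + n.+1)%N]addSn binS addSnnS.
Qed.

(** Below degree [P] the truncation of the geometric series is invisible, and its power has the
    coefficients of [(1 - X)^(- n - 1)]; [hockey_stick] is the induction step. *)
Lemma coef_geometric n P M : (M < P)%N ->
  ((\sum_(0 <= j < P) 'X^j : {poly int}) ^+ n.+1)`_M = ('C(M + n, n))%:R.
Proof.
have g1 i : (i < P)%N -> (\sum_(0 <= j < P) 'X^j : {poly int})`_i = 1.
  move=> iP; rewrite coef_sum big_mkord (bigD1 (Ordinal iP))//= coefXn eqxx big1 ?addr0// => j ji.
  by rewrite coefXn; case: eqP => // E; case/eqP: ji; apply/val_inj.
elim: n M => [|n ih] M MP; first by rewrite expr1 g1// addn0 bin0.
rewrite exprSr coefM -hockey_stick big_mkord natr_sum; apply: eq_bigr => i _.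
have iM : (i <= M)%N by rewrite -ltnS.
by rewrite ih ?(leq_ltn_trans iM)// g1 ?mulr1// (leq_ltn_trans (leq_subr _ _)).
Qed.

(** Generating function: expanding [(1 + X + ... + X^(P - 1))^(n + 1)] gives one monomial, of degree
    the sum of [f], for each [f]. *)
Lemma card_sum_eq n P M : (M < P)%N ->
  #|[pred f : {ffun 'I_n.+1 -> 'I_P} | (\sum_i f i)%N == M]| = 'C(M + n, n).
Proof.
move=> MP; apply/eqP; rewrite -(eqr_nat int) -(coef_geometric n MP) big_mkord.
have -> : (\sum_(j < P) 'X^j : {poly int}) ^+ n.+1 = \prod_(i < n.+1) \sum_(j < P) 'X^j.
  by rewrite prodr_const card_ord.
rewrite bigA_distr_bigA /= coef_sum -sum1_card natr_sum [X in X == _]big_mkcond /=.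
apply/eqP; apply: eq_bigr => f _; rewrite inE -expr_sum coefXn eq_sym.
by case: eqP.
Qed.

Lemma sum_by_level (V : zmodType) n P T (F : nat -> V) : (T <= P)%N ->
  \sum_(f : {ffun 'I_n.+1 -> 'I_P} | (\sum_i f i < T)%N) F (\sum_i f i)%N =
  \sum_(0 <= M < T) F M *+ 'C(M + n, n).
Proof.
move=> TP; rewrite big_mkord.
rewrite (partition_big (fun f : {ffun 'I_n.+1 -> 'I_P} => inord (\sum_i f i) : 'I_T.-1.+1) xpredT)//=.
case: T TP => [|T] TP.
  by rewrite [RHS]big_ord0 big1// => i _; rewrite big1.
apply: eq_bigr => M _; have MP : (M < P)%N by exact: leq_trans TP.
rewrite -(card_sum_eq n MP) -sumr_const; apply: congr_big => //.
  move=> f; rewrite inE; apply/andP/eqP => [[h /eqP <-]|h]; first by rewrite inordK.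
  by split; rewrite h ?inord_val.
by move=> f /andP[h /eqP <-]; rewrite inordK.
Qed.

End Counting.

Section FiniteSandwich.
Variable R : realType.

Lemma sandwich (T : finType) (A S B : pred T) (a : T -> R[i]) :
  (forall t, A t -> S t) -> (forall t, S t -> B t) ->
  cabs (\sum_(t | S t) a t - \sum_(t | A t) a t) <=
  \sum_(t | B t) cabs (a t) - \sum_(t | A t) cabs (a t).
Proof.
move=> AS SB.
have split (P : pred T) (V : zmodType) (f : T -> V) : (forall t, A t -> P t) ->
    \sum_(t | P t) f t - \sum_(t | A t) f t = \sum_(t | P t && ~~ A t) f t.
  move=> AP; rewrite (bigID A P)/= (eq_bigl A) => [|t]; last by case: (boolP (A t)) => [/AP ->|]; rewrite ?andbF.
  by rewrite [X in X - _]addrC addrK.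
rewrite split// split; last by move=> t /AS /SB.
apply: le_trans (cabs_sum _ _ _) _.
rewrite [leRHS](bigID S) /= -[leLHS]addr0; apply: lerD; last by apply: sumr_ge0 => t _; exact: cabs_ge0.
rewrite le_eqVlt; apply/orP; left; apply/eqP; apply: eq_bigl => t.
by case: (boolP (S t)) => [/SB ->|]; rewrite ?andbT ?andbF//= ?andbT.
Qed.

End FiniteSandwich.

(** * The Barnes series summed by levels, and its continuation *)

Section Barnes.
Variables (R : realType) (N' : nat) (ell : 'I_N'.+1 -> nat) (wi : 'I_N'.+1 -> R) (w x : R).
Let N := N'.+1.
Let box := {dffun forall i : 'I_N, 'I_(ell i)}.
Hypotheses (x0 : 0 < x) (w0 : 0 < w) (wi0 : forall i, 0 < wi i) (lw : forall i, (ell i)%:R * wi i = w).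

Let yk (k : box) : R := w^-1 * (x + \sum_(i < N) (k i)%:R * wi i).

Let ell0 i : (0 < ell i)%N.
Proof.
rewrite lt0n; apply/eqP => e; have := lw i; rewrite e mul0r => E.
by move: w0; rewrite -E ltxx.
Qed.

Let yk0 k : 0 < yk k.
Proof.
rewrite mulr_gt0 ?invr_gt0// ltr_wpDr// sumr_ge0// => i _.
by rewrite mulr_ge0// ltW.
Qed.

Definition bterm (s : R[i]) (k : box) (M : nat) : R[i] := cpow (w * (M%:R + yk k)) (- s).
Definition blevel (s : R[i]) (T : nat) : R[i] :=
  \sum_(k : box) \sum_(0 <= M < T) bterm s k M *+ 'C(M + N', N').
Definition bbox (s : R[i]) (K : nat) : R[i] :=
  \sum_(n : {ffun 'I_N -> 'I_K}) cpow (x + \sum_(i < N) (n i)%:R * wi i) (- s).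

(** Sums over boxes and sums over levels are compared as sums over subsets of one finite type, with
    [P] large enough to contain both. *)
Let pairT P := (box * {ffun 'I_N -> 'I_P})%type.
Let lev P (p : pairT P) := (\sum_i p.2 i)%N.

Let blevelE s T P : (T <= P)%N -> blevel s T = \sum_(p : pairT P | (lev p < T)%N) bterm s p.1 (lev p).
Proof.
move=> TP; rewrite /blevel; under eq_bigr do rewrite -(sum_by_level N' _ TP).
by rewrite pair_big_dep.
Qed.

(** Euclidean division [n_i = k_i + ell_i m_i] in each coordinate. *)
Let split_n K P (KP : (K <= P)%N) (n : {ffun 'I_N -> 'I_K}) : pairT P :=
  ([ffun i => Ordinal (ltn_pmod (n i) (ell0 i))],
   [ffun i => Ordinal (leq_ltn_trans (leq_div (n i) (ell i)) (leq_trans (ltn_ord (n i)) KP))]).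

Let split_inj K P (KP : (K <= P)%N) : injective (split_n KP).
Proof.
move=> n n' [/ffunP h1 /ffunP h2]; apply/ffunP => i; apply/val_inj => /=.
have := h1 i; have := h2 i; rewrite !ffunE => /(congr1 val) /= e2 /(congr1 val) /= e1.
by rewrite (divn_eq (n i) (ell i)) (divn_eq (n' i) (ell i)) e1 e2.
Qed.

Let split_term s K P (KP : (K <= P)%N) n :
  bterm s (split_n KP n).1 (lev (split_n KP n)) = cpow (x + \sum_(i < N) (n i)%:R * wi i) (- s).
Proof.
have E : w * ((lev (split_n KP n))%:R + yk (split_n KP n).1) = x + \sum_(i < N) (n i)%:R * wi i.
  rewrite /yk mulrDr [in X in _ + X]mulrA mulfV ?gt_eqF// mul1r addrCA; congr (_ + _).
  rewrite /lev natr_sum mulr_sumr -big_split /=; apply: eq_bigr => i _; rewrite !ffunE /=.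
  by rewrite [in RHS](divn_eq (n i) (ell i)) natrD natrM -[in LHS](lw i); ring.
by rewrite /bterm E.
Qed.

Let bboxE s K P (KP : (K <= P)%N) :
  bbox s K = \sum_(p : pairT P | p \in codom (split_n KP)) bterm s p.1 (lev p).
Proof.
rewrite /bbox -(eq_bigr _ (fun n _ => split_term s KP n)).
rewrite -(big_image _ _ (split_n KP) xpredT (fun p => bterm s p.1 (lev p))) /=.
rewrite big_uniq; last by rewrite map_inj_uniq ?enum_uniq//; exact: split_inj.
by apply: eq_bigl => p; rewrite codomE.
Qed.

Let cabs_bterm (s : R[i]) k M : (cabs (bterm s k M))%:C = bterm (complex.Re s)%:C k M.
Proof.
have a0 : 0 < w * (M%:R + yk k) by rewrite mulr_gt0// ltr_wpDl.
by rewrite /bterm cabs_cpow// -rmorphN cpow_real// ReN.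
Qed.

(** For large [K] the box contains every multi-index of level below [T], and its levels are at most
    [N K]. The moduli of the terms are the terms at [Re s], so the error is bounded by a piece of
    the level series at [Re s]. *)
Lemma barnes_sandwich (s : R[i]) T : exists K0, forall K, (K0 <= K)%N ->
  cabs (bbox s K - blevel s T) <=
  cabs (blevel (complex.Re s)%:C (N * K).+1 - blevel (complex.Re s)%:C T).
Proof.
exists ((\sum_i ell i) * T)%N => K K0.
pose P := ((N * K).+1 + T + K)%N.
have KP : (K <= P)%N by exact: leq_addl.
have TP : (T <= P)%N by rewrite /P addnAC leq_addl.
have BP : ((N * K).+1 <= P)%N by rewrite /P -addnA leq_addr.
have absE T' : (T' <= P)%N -> blevel (complex.Re s)%:C T' =
    (\sum_(p : pairT P | (lev p < T')%N) cabs (bterm s p.1 (lev p)))%:C.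
  move=> TP'; rewrite (blevelE _ TP') rmorph_sum; apply: eq_bigr => p _.
  exact: esym (cabs_bterm _ _ _).
rewrite (bboxE s KP) (blevelE s TP) (absE _ BP) (absE _ TP) -rmorphB cabs_real.
apply: le_trans (ler_norm _); apply: sandwich => p.
  case: p => k m hp; have hm i : (m i < T)%N.
    by apply: leq_ltn_trans hp; rewrite /lev /= (bigD1 i)//= leq_addr.
  have hn i : (m i * ell i + k i < K)%N.
    apply: leq_trans K0; apply: (@leq_trans (ell i * T)); last first.
      by rewrite leq_mul2r (bigD1 i)//= leq_addr orbT.
    apply: (@leq_trans (m i * ell i + ell i)); first by rewrite ltn_add2l.
    by rewrite addnC -mulSn mulnC leq_mul2l hm orbT.
  apply/codomP; exists [ffun i => Ordinal (hn i)].
  congr pair; apply/ffunP => i; apply/val_inj; rewrite !ffunE /=.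
    by rewrite modnMDl modn_small.
  by rewrite divnMDl// divn_small// addn0.
move=> /codomP[n ->]; rewrite ltnS /lev /=.
apply: (@leq_trans (\sum_(i < N) K)%N); last by rewrite sum_nat_const card_ord.
apply: leq_sum => i _; rewrite ffunE /=.
by apply: leq_trans (leq_div _ _) _; rewrite ltnW.
Qed.

(** Convergence at [Re s] is absolute convergence; it makes the bound of [barnes_sandwich] small, so
    that boxes and levels give the same limit. *)
Lemma barnes_box_cvg (s g g' : R[i]) : blevel s ~> g -> blevel (complex.Re s)%:C ~> g' -> bbox s ~> g.
Proof.
move=> h h' e e0; have e2 : 0 < e / 2 by rewrite divr_gt0.
have e4 : 0 < e / 4 by rewrite divr_gt0.
have [T1 hT1] := h _ e2; have [T2 hT2] := h' _ e4.
pose T := maxn T1 T2; have [K0 hK] := barnes_sandwich s T.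
exists (maxn K0 T) => K; rewrite geq_max => /andP[k0 kT].
have c1 := hK K k0; have c2 := hT1 T (leq_maxl _ _); have c3 := hT2 T (leq_maxr _ _).
have c4 : cabs (blevel (complex.Re s)%:C (N * K).+1 - g') < e / 4.
  apply: hT2; apply: leq_trans (leq_maxr T1 _) _; apply: leq_trans kT _.
  by rewrite leqW// leq_pmull.
have -> : bbox s K - g = (bbox s K - blevel s T) + (blevel s T - g) by ring.
have E : blevel (complex.Re s)%:C (N * K).+1 - blevel (complex.Re s)%:C T =
  (blevel (complex.Re s)%:C (N * K).+1 - g') - (blevel (complex.Re s)%:C T - g') by ring.
rewrite E in c1; have := cabsB (blevel (complex.Re s)%:C (N * K).+1 - g') (blevel (complex.Re s)%:C T - g').
have := cabsD (bbox s K - blevel s T) (blevel s T - g).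
lra.
Qed.

(** The continuation in closed form: a finite combination of shifted Hurwitz zeta functions, to
    which the level sums converge for [Re s > N]. *)
Definition bgen (s : R[i]) : R[i] := (N'`!%:R)^-1 * (cpow w (- s) *
  \sum_(k : box) \sum_(m < N) ((CNx N (yk k))`_m)%:C * Zh (yk k) (s - m%:R)).

Lemma CN_bin n M : (CN n.+1 : {poly R}).[M%:R] = n`!%:R * 'C(M + n, n)%:R.
Proof.
elim: n => [|n ih]; first by rewrite /CN big_geq// hornerC addn0 bin0 mulr1.
rewrite /CN big_nat_recr//= hornerM -/(CN n.+1) ih hornerD hornerX hornerC factS -!natrM -natrD -!natrM.
congr (_%:R); have := mul_bin_diag (M + n.+1) n; rewrite addnS /= => h.
by rewrite [(n.+1 * n`!)%N]mulnC -[RHS]mulnA -h; ring.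
Qed.

Lemma size_CN n : (size (CN n.+1 : {poly R}) <= n.+1)%N.
Proof.
elim: n => [|n ih]; first by rewrite /CN big_geq// size_poly1.
rewrite /CN big_nat_recr//= -/(CN n.+1); apply: leq_trans (size_polyMleq _ _) _.
by rewrite size_XaddC addn2 /= ltnS.
Qed.

(** Powers of [M + y] are used because each multiplies the general term, a power of [w (M + y)],
    into a term of a Hurwitz series. *)
Lemma CNx_eval (y : R) M : 'C(M + N', N')%:R = N'`!%:R^-1 * \sum_(m < N) (CNx N y)`_m * (M%:R + y) ^+ m.
Proof.
have f0 : N'`!%:R != 0 :> R by rewrite pnatr_eq0 -lt0n fact_gt0.
have sz : (size (CNx N y) <= N)%N.
  by rewrite /CNx size_comp_poly2 ?size_XsubC// size_CN.
rewrite -(horner_coef_wide _ sz) /CNx horner_comp hornerXsubC addrK CN_bin mulKf//.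
Qed.

Lemma blevel_cvg (s : R[i]) : N%:R < complex.Re s -> blevel s ~> bgen s.
Proof.
move=> hs; rewrite /bgen mulrA mulr_sumr; apply: cvgC_sum => k.
have hm m : (m < N)%N -> 1 < complex.Re (s - m%:R).
  move=> mN; rewrite ReD ReN.
  have -> : complex.Re (m%:R : R[i]) = m%:R by rewrite -(rmorph_nat (real_complex R)).
  rewrite ltrBrDr (le_lt_trans _ hs)// -natr1 addrC lerD2r// ler_nat; exact: mN.
have hz (m : 'I_N) := series_scale ((CNx N (yk k))`_m)%:C (Zh_series (yk0 k) (hm m (ltn_ord m))).
have := cvgC_scale (N'`!%:R^-1 * cpow w (- s)) (cvgC_sum (index_enum _) xpredT hz).
congr cvgC; apply/funext => T; rewrite /series /= exchange_big mulr_sumr; apply: eq_bigr => M _.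
have a0 : 0 < M%:R + yk k by rewrite ltr_wpDl.
rewrite /bterm cpowM// -[RHS]mulr_natr.
have -> : 'C(M + N', N')%:R = N'`!%:R^-1 * \sum_(m < N) ((CNx N (yk k))`_m)%:C * (M%:R + yk k)%:C ^+ m :> R[i].
  rewrite -[LHS](rmorph_nat (real_complex R)) (CNx_eval (yk k) M) rmorphM fmorphV rmorph_nat rmorph_sum.
  by congr (_ * _); apply: eq_bigr => m _; rewrite rmorphM rmorphXn.
rewrite !mulr_sumr; apply: eq_bigr => m _.
by rewrite opprB [m%:R - s]addrC cpowD cpow_nat//; ring.
Qed.

Lemma bgen_laurent z : laurent bgen z.
Proof.
have r1 := PS_scale (N'`!%:R)^-1 (PS_cpowN w z ltr01).
have -> : bgen = fun s => (N'`!%:R)^-1 * cpow w (- s) * \sum_(k : box) \sum_(m < N) ((CNx N (yk k))`_m)%:C * Zh (yk k) (s - m%:R).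
  by apply/funext => s; rewrite /bgen mulrA.
apply: laurent_mul r1; apply: laurent_sum => k; apply: laurent_sum => m.
apply: (laurent_mul (g := fun=> _) _ (PS_cst _ z ltr01)).
apply: (laurent_translate (c := - m%:R)); apply: meromorphic_laurent.
exact: Zh_meromorphic.
Qed.

Lemma PS_sum_exists (I : eqType) (t : seq I) (F : I -> R[i] -> R[i]) (A : I -> nat -> R[i]) z :
  (forall i, i \in t -> exists r, PS (F i) z (A i) r) ->
  exists r, PS (fun s => \sum_(i <- t) F i s) z (fun k => \sum_(i <- t) A i k) r.
Proof.
elim: t => [_|i t ih hF].
  exists 1; have -> : (fun k : nat => \sum_(i <- [::]) A i k) = (fun k => if k == 0%N then 0 else 0).
    by apply/funext => k; rewrite big_nil; case: ifP.
  by apply: (PS_ext _ (PS_cst 0 z ltr01)) => h _; rewrite big_nil.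
have [r1 h1] := hF i (mem_head _ _).
have [|r2 h2] := ih; first by move=> j jt; apply: hF; rewrite in_cons jt orbT.
have [r3 h3] := PS_add_exists h1 h2; exists r3.
have -> : (fun k : nat => \sum_(j <- i :: t) A j k) = (fun k => A i k + \sum_(j <- t) A j k).
  by apply/funext => k; rewrite big_cons.
by apply: (PS_ext _ h3) => h _; rewrite big_cons.
Qed.

Lemma bgen_PS z (D : box -> nat -> nat -> R[i]) :
  (forall k m, (m < N)%N -> exists r, PS (Zh (yk k)) (z - m%:R) (D k m) r) ->
  exists r, PS bgen z (fun n => (N'`!%:R)^-1 * cauchy_prod
    (fun i => cpow w (- z) * ((- (ln w)%:C) ^+ i / i`!%:R))
    (fun j => \sum_(k : box) \sum_(m < N) ((CNx N (yk k))`_m)%:C * D k m j) n) r.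
Proof.
move=> hD.
have [|r1 h1] := @PS_sum_exists _ (index_enum box)
    (fun k s => \sum_(m < N) ((CNx N (yk k))`_m)%:C * Zh (yk k) (s - m%:R))
    (fun k j => \sum_(m < N) ((CNx N (yk k))`_m)%:C * D k m j) z.
  move=> k _; apply: (@PS_sum_exists _ (index_enum _) (fun (m : 'I_N) s => ((CNx N (yk k))`_m)%:C * Zh (yk k) (s - m%:R))
    (fun (m : 'I_N) j => ((CNx N (yk k))`_m)%:C * D k m j)) => m _.
  have [r h] := hD k m (ltn_ord m); exists r; apply: PS_scale.
  exact: (PS_translate (c := - m%:R) h).
have [r2 h2] := PS_prod_exists (PS_cpowN w z ltr01) h1.
by exists r2; exact: PS_scale.
Qed.

(** For [Re z > N] no point [z - m] with [m < N] meets the pole [1]. *)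
Lemma bgen_PS_right z : N%:R < complex.Re z -> exists b r, PS bgen z b r.
Proof.
move=> hz.
have hD (k : box) (m : nat) : exists b : nat -> R[i], (m < N)%N -> exists r, PS (Zh (yk k)) (z - m%:R) b r.
  case: (ltnP m N) => mN; last by exists (fun=> 0).
  have n1 : z - m%:R != 1.
    apply/eqP => /(congr1 (@complex.Re R)); rewrite ReD ReN.
    have -> : complex.Re (m%:R : R[i]) = m%:R by rewrite -(rmorph_nat (real_complex R)).
    move=> E; have E' : complex.Re z - m%:R = 1 := E.
    have e : m.+1%:R = m%:R + 1 :> R by rewrite natr1.
    have E2 : complex.Re z = m.+1%:R by rewrite e; lra.
     move: hz; rewrite E2 ltr_nat ltnNge mN.
    by [].
  have c0 : 0 < cabs (1 - (z - m%:R)) by rewrite cabs_gt0 subr_eq0 eq_sym.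
  have [|b hb] := @Zh_PS R _ (z - m%:R) (cabs (1 - (z - m%:R)) / 2) (yk0 k) n1.
    by apply/andP; split; lra.
  by exists b => _; eexists; exact: hb.
have [D DP] : exists D : box -> nat -> nat -> R[i], forall k m, (m < N)%N -> exists r, PS (Zh (yk k)) (z - m%:R) (D k m) r.
  exists (fun k m => projT1 (cid (hD k m))) => k m; exact: projT2 (cid (hD k m)).
have [r h] := bgen_PS DP; eexists; eexists; exact: h.
Qed.

Lemma barnes_PS z (D : box -> nat -> nat -> R[i]) :
  (forall k m, (m < N)%N -> exists r, PS (Zh (yk k)) (z - m%:R) (D k m) r) ->
  exists r, PS (continuation N%:R bbox) z (fun n => (N'`!%:R)^-1 * cauchy_prod
    (fun i => cpow w (- z) * ((- (ln w)%:C) ^+ i / i`!%:R))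
    (fun j => \sum_(k : box) \sum_(m < N) ((CNx N (yk k))`_m)%:C * D k m j) n) r.
Proof.
move=> /bgen_PS[r h]; apply: continuation_laurent h.
- exact: bgen_laurent.
- exact: bgen_PS_right.
- by move=> s hs; apply: barnes_box_cvg; apply: blevel_cvg.
Qed.

End Barnes.

(** * Removal of the integer part Y *)

Section Shift.
Variable R : realType.
Implicit Types (y : R) (z : R[i]).

(** The first [Y] terms are split off the Dirichlet series; after multiplication by [z - 1] the
    relation is continued to the plane. *)
Lemma Eh_shift y Y z : 0 < y ->
  Eh y z = Eh (Y%:R + y) z + (z - 1) * \sum_(0 <= i < Y) cpow (i%:R + y) (- z).
Proof.
move=> y0; have Yy : 0 < Y%:R + y by rewrite ltr_wpDl.
have hS (r : R) : 0 < r -> exists b, PS (fun z => \sum_(0 <= i < Y) cpow (i%:R + y) (- z)) 2%:C b r.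
  by move=> r0; eexists; exact: (PS_sum (index_iota 0 Y) r0 (fun i => PS_cpowN (i%:R + y) 2%:C r0)).
apply: (entire_eq (f := Eh y) (g := fun z => Eh (Y%:R + y) z + (z - 1) * \sum_(0 <= i < Y) cpow (i%:R + y) (- z))) => [r r0|r r0|u /andP[u0 _]]; first exact: PS_Eh.
  have r1 : 0 < r + 1 by rewrite addr_gt0.
  have rr : 0 < r < r + 1 by rewrite r0 ltrDl ltr01.
  have [b1 h1] := PS_Eh 2%:C Yy r0; have [b2 h2] := hS _ r1.
  eexists; exact: (PS_add h1 (PS_mul rr (PS_add (PS_id 2%:C r1) (PS_cst (-1) 2%:C r1)) h2)).
have s1 : 1 < complex.Re (2 + u)%:C by rewrite /=; lra.
have n0 : (2 + u)%:C - 1 != 0 :> R[i].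
  by rewrite -(rmorph1 (real_complex R)) -rmorphB fmorph_eq0 subr_eq0 gt_eqF//; lra.
have h1 := Zh_series y0 s1; have h2 := Zh_series Yy s1.
have h3 : series (fun n => cpow (n%:R + y) (- (2 + u)%:C)) ~>
   (\sum_(0 <= i < Y) cpow (i%:R + y) (- (2 + u)%:C) + Zh (Y%:R + y) (2 + u)%:C).
  apply: series_shift; move: h2; congr cvgC; apply/funext => n; apply: eq_bigr => k _.
  by rewrite natrD addrA.
have alg (a b t c : R[i]) : c != 0 -> a / c = t + b / c -> a = b + c * t.
  by move=> c0 E; rewrite -[a](divfK c0) E mulrDl divfK// addrC mulrC.
exact: alg n0 (cvgC_unique h1 h3).
Qed.

Lemma Zh_shift y Y z : 0 < y -> z != 1 ->
  Zh (Y%:R + y) z = Zh y z - \sum_(0 <= i < Y) cpow (i%:R + y) (- z).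
Proof.
move=> y0 z1; have n0 : z - 1 != 0 by rewrite subr_eq0.
rewrite /Zh (Eh_shift Y z y0).
have alg (b t c : R[i]) : c != 0 -> b / c = (b + c * t) / c - t.
  by move=> c0; rewrite mulrDl [c * t]mulrC mulfK// addrK.
exact: alg n0.
Qed.

Lemma Zh_shift_PS y Y M d (r : R) : 0 < y -> PS (Zh y) (- M%:R) d r ->
  exists r', PS (Zh (Y%:R + y)) (- M%:R)
    (fun j => d j - j`!%:R^-1 * (\sum_(0 <= i < Y) (- ln (i%:R + y)) ^+ j * (i%:R + y) ^+ M)%:C) r'.
Proof.
move=> y0 hd.
have hS := PS_sum (index_iota 0 Y) ltr01 (fun i => PS_cpowN (i%:R + y) (- M%:R) ltr01).
have [r1 h1] := PS_add_exists hd (PS_scale (-1) hS); have [r10 _ _] := h1.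
(* A radius of at most [1] keeps the open disc around [- M] away from the pole [1], at distance
   [M + 1]. *)
have r2 : 0 < Num.min r1 1 <= r1 by rewrite lt_min r10 ltr01 ge_min lexx.
exists (Num.min r1 1); have {}h1 := PS_le r2 h1.
have E j : d j - j`!%:R^-1 * (\sum_(0 <= i < Y) (- ln (i%:R + y)) ^+ j * (i%:R + y) ^+ M)%:C =
    d j + -1 * \sum_(0 <= i < Y) cpow (i%:R + y) (- - M%:R) * ((- (ln (i%:R + y))%:C) ^+ j / j`!%:R).
  rewrite mulN1r; congr (_ - _); rewrite rmorph_sum mulr_sumr; apply: eq_bigr => i _.
  have a0 : 0 < i%:R + y by rewrite ltr_wpDl.
  rewrite opprK cpow_nat// rmorphM !rmorphXn rmorphN; ring.
rewrite (funext E).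
apply: (PS_ext _ h1) => k; rewrite lt_min => /andP[_ k1].
rewrite Zh_shift// ?mulN1r//.
apply: contraTneq k1 => Ek; have kE : k = M%:R + (- M%:R + k) by ring.
by rewrite kE Ek natr1 cabs_nat -leNgt ler1n.
Qed.

End Shift.

Theorem theorem4p8 (R : realType) (N : nat) (r q : 'I_N -> nat) (x : rat)
    (l n : nat) (Y u v : kbox r q -> nat) :
  (0 < N)%N ->
  (forall i, [/\ (0 < r i)%N, (0 < q i)%N & coprime (r i) (q i)]) ->
  0 < x ->
  (forall k, (1 <= u k <= v k)%N) ->
  (forall k, yk (ratr x : R) k = (Y k)%:R + (u k)%:R / (v k)%:R) ->
  cderiven n (barnes_zeta (wpar R r q) (ratr x)) (- l%:R) =
  ((N.-1)`!%:R)^-1 *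
  \sum_(j < n.+1) 'C(n, j)%:R *
    ((- ln (wcom R r q)) ^+ (n - j) * wcom R r q ^+ l)%:C *
    \sum_(k : kbox r q) \sum_(m < N)
      ((derivn m (CNx N (yk (ratr x : R) k))).[0] / m`!%:R)%:C *
      ((-1) ^+ j * 2 *
         (\sum_(a < j.+1) \sum_(b < j.+1) \sum_(c < j.+1 | (a + b + c)%N == j)
            j`!%:R / (a`! * b`! * c`!)%:R *
            (derive1n a (@Gamma R) (l + m + 1)%:R *
             (- ln (2 * pi * (v k)%:R)) ^+ b *
             (2 * pi * (v k)%:R) ^- (l + m + 1))%:C *
            cderiven c (Hfun (u k) (v k)) (l + m + 1)%:R)
       - (\sum_(0 <= i < Y k)
            (- ln (i%:R + (u k)%:R / (v k)%:R)) ^+ j *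
            (i%:R + (u k)%:R / (v k)%:R) ^+ (l + m))%:C).
Proof.
case: N r q Y u v => [//|N'] r q Y u v _ rq x0 uv yE.
have r0 i : (0 < r i)%N by case: (rq i).
have q0 i : (0 < q i)%N by case: (rq i).
have wi0 i : 0 < wpar R r q i by rewrite divr_gt0 ?ltr0n.
have lw i : (ell r q i)%:R * wpar R r q i = wcom R r q.
  by rewrite ellE// divfK// gt_eqF.
have w0 : 0 < wcom R r q.
  rewrite /wcom divr_gt0 ?ltr0n//.
    by apply: (big_ind (fun m => 0 < m)%N) => // a b a0 b0; rewrite lcmn_gt0 a0.
  by rewrite (bigD1 ord0)//= gcdn_gt0 q0.
have xR : 0 < ratr x :> R by rewrite ltr0q.
pose y k : R := (u k)%:R / (v k)%:R.
have y0 k : 0 < y k.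
  by have /andP[u1 uv'] := uv k; rewrite divr_gt0 ?ltr0n// (leq_trans u1).
pose M m := (l + m)%N.
have hd (k : kbox r q) m : exists d, exists r, PS (Zh (y k)) (- (M m)%:R) d r /\ forall j, j`!%:R * d j = bracket R (M m) (u k) (v k) j.
  exact: bracket_PS.
pose d k m := projT1 (cid (hd k m)).
have dP k m : exists r, PS (Zh (y k)) (- (M m)%:R) (d k m) r by have [r' [h _]] := projT2 (cid (hd k m)); exists r'.
have dE k m j : j`!%:R * d k m j = bracket R (M m) (u k) (v k) j by have [r' [_ h]] := projT2 (cid (hd k m)).
(* Taylor coefficients of [zeta (s, y (k))] at [- (l + m)]: those of [zeta (s, u / v)] less the
   contribution of the [Y k] terms split off. *)
pose D (k : kbox r q) (m j : nat) : R[i] := d k m j -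
   j`!%:R^-1 * (\sum_(0 <= i < Y k) (- ln (i%:R + y k)) ^+ j * (i%:R + y k) ^+ (M m))%:C.
have DP (k : kbox r q) m : (m < N'.+1)%N -> exists r', PS (Zh (yk (ratr x : R) k)) (- l%:R - m%:R) (D k m) r'.
  move=> _; have [r' h] := dP k m; rewrite yE -opprD -natrD.
  exact: Zh_shift_PS (y0 k) h.
have [r' h] := barnes_PS xR w0 wi0 lw DP.
rewrite /barnes_zeta (cderiven_PS n h).
rewrite mulrCA; congr (_ * _); rewrite /cauchy_prod big_mkord mulr_sumr.
(* After the reversal [j] counts the derivatives falling on the zeta functions and [n - j] those
   falling on [w^(- s)]. *)
rewrite (reindex_inj rev_ord_inj) /=; apply: eq_bigr => j _.
have jn : (j <= n)%N by rewrite -ltnS.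
rewrite subSS subKn// opprK cpow_nat//.
have -> : n`!%:R = 'C(n, j)%:R * j`!%:R * (n - j)`!%:R :> R[i] by rewrite -!natrM -mulnA bin_fact.
have fn : (n - j)`!%:R != 0 :> R[i] by rewrite pnatr_eq0 -lt0n fact_gt0.
set S := \sum_k _; set S' := \sum_k _.
have SE : j`!%:R * S = S'.
  rewrite /S mulr_sumr; apply: eq_bigr => k _; rewrite mulr_sumr; apply: eq_bigr => m _.
  (* The Taylor quotient at [0] in the theorem is the coefficient of degree [m]. *)
  have -> : (CNx N'.+1 (yk (ratr x) k))`_m = (derivn m (CNx N'.+1 (yk (ratr x : R) k))).[0] / m`!%:R.
    have fm : m`!%:R != 0 :> R by rewrite pnatr_eq0 -lt0n fact_gt0.
    by rewrite horner_coef0 coef_derivn addn0 ffactnn -[_ *+ m`!]mulr_natr mulfK.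
  have fj : j`!%:R != 0 :> R[i] by rewrite pnatr_eq0 -lt0n fact_gt0.
  by rewrite mulrCA; congr (_ * _); rewrite /D mulrBr dE mulrA mulfV ?mul1r.
have wE : ((- ln (wcom R r q)) ^+ (n - j) * wcom R r q ^+ l)%:C = (- (ln (wcom R r q))%:C) ^+ (n - j) * (wcom R r q)%:C ^+ l :> R[i].
  by rewrite rmorphM !rmorphXn rmorphN.
rewrite wE -SE; have alg (c J F W L Z : R[i]) : F != 0 -> c * J * F * (W * (L / F) * Z) = c * (L * W) * (J * Z).
  by move=> F0; field.
exact: alg.
Qed.
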